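(* Let $M$ be an irreducible quasi-finite highest weight $\widehat{\mathcal C}$-module with highest weight $\xi$. Then $M$ is unitarizable (with respect to the $\ast$-structure $\omega$) if and only if $\xi=\Lambda^{\widehat{\mathcal C}}(\lambda)$ for some partition $\lambda$ of length $d$ (for some $d\in\mathbb Z_+$). In other words, $M$ is unitarizable if and only if $$\xi=\sum_{j\in\frac12\mathbb N,\ j\le r}\xi_j\omega_j+d\Lambda_0$$ for some $d\in\mathbb Z_+$, $r\in\mathbb N$ and $\xi_j\in\mathbb Z$ satisfying: (i) $\xi_{\frac12}>\xi_{\frac32}>\cdots>\xi_{r-\frac12}\ge0$, $\ \xi_1>\xi_2>\cdots>\xi_r\ge0$, and $\xi_{r-\frac12}=0$ if and only if $r=1$ and $\xi_{\frac12}=\xi_1=0$; (ii) $\min\{\xi_{\frac12},1\}+\xi_1\le d$.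
   Context: All vector spaces are over $\mathbb C$; $\mathbb N=\{1,2,\dots\}$, $\mathbb Z_+=\{0,1,2,\dots\}$, $\mathbb Z^*=\mathbb Z\setminus\{0\}$. Let $\mathrm{gl}_{\infty|\infty}$ be the space of complex matrices $(a_{ij})_{i,j\in\frac12\mathbb Z}$ with $a_{ij}=0$ for $|i-j|\gg0$; $e_{pq}$ denotes the matrix unit. It is $\frac12\mathbb Z$-graded: the degree-$k$ component consists of all $\sum_{j\in\frac12\mathbb Z}a_je_{j-k,j}$. Elements of integer degree are even, elements of degree in $\frac12+\mathbb Z$ are odd, and $[A,B]=AB-(-1)^{|A||B|}BA$. Let $J=\sum_{r\le0}e_{rr}$, $\mathrm{Str}(D)=\sum_{r}(-1)^{2r}d_{rr}$, $\alpha(A,B)=\mathrm{Str}([J,A]B)$. Then $\widehat{\mathrm{gl}}_{\infty|\infty}=\mathrm{gl}_{\infty|\infty}\oplus\mathbb CC$ is the central extension with $C$ even, central, of degree $0$, and the bracket of $A,B\in\mathrm{gl}_{\infty|\infty}$ equal to $[A,B]+\alpha(A,B)C$. Let $\mathcal A\subset \mathrm{gl}_{\infty|\infty}$ be the matrices with $a_{ij}=0$ if $i=0$ or $j=0$; it acts on the superspace $V$ with even basis $e_j$ ($j\in\mathbb Z^*$) and odd basis $e_r$ ($r\in\frac12+\mathbb Z$). Let $(\cdot|\cdot)$ be the bilinear form on $V$ with $(e_i|e_j)=\mathrm{sgn}(i)\delta_{i,-j}$ ($i,j\in\mathbb Z^*$), $(e_r|e_s)=\delta_{r,-s}$ ($r,s\in\frac12+\mathbb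 Z$), $(e_i|e_r)=(e_r|e_i)=0$. Let $\mathcal C\subset\mathcal A$ be the graded subalgebra spanned by the $A\in\mathcal A$ of parity $\epsilon\in\{0,1\}$ satisfying $(Av|w)=-(-1)^{\epsilon|v|}(v|Aw)$ for all homogeneous $v$ and all $w$ in $V$, and let $\widehat{\mathcal C}=\mathcal C\oplus\mathbb CC\subset\widehat{\mathrm{gl}}_{\infty|\infty}$ with the induced grading. Put $\tilde e_{rr}=e_{rr}-e_{-r,-r}$ for $r\in\frac12\mathbb N$; $\widehat{\mathcal C}_0=\{\sum_{r\in\frac12\mathbb N}a_r\tilde e_{rr}+dC\}$, and $\omega_s$ ($s\in\frac12\mathbb N$), $\Lambda_0\in(\widehat{\mathcal C}_0)^*$ are defined by $\omega_s(\sum a_r\tilde e_{rr}+dC)=a_s$, $\Lambda_0(\sum a_r\tilde e_{rr}+dC)=d$. For a $\frac12\mathbb Z$-graded Lie superalgebra $\mathfrak g$ with $\mathfrak g_0$ abelian, put $\mathfrak g_\pm=\bigoplus_{r>0}\mathfrak g_{\pm r}$. A highest weight module with highest weight $\xi\in\mathfrak g_0^*$ is a module $M$ containing $v_\xi\neq0$ with $hv_\xi=\xi(h)v_\xi$ for $h\in\mathfrak g_0$, $\mathfrak g_+v_\xi=0$, $\mathcal U(\mathfrak g_-)v_\xi=M$; it is graded by giving $v_\xi$ degree $0$, and is quasi-finite if all homogeneous components are finite dimensional. $\ast$-structure: $\omega$ is the restriction to $\widehat{\mathcal C}$ of the anti-linear map of $\widehat{\mathrm{gl}}_{\infty|\infty}$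 with $\omega(C)=C$, $\omega(\sum_pa_pe_{p-k,p})=\sum_p(-1)^{[p]+[p-k]}\overline{a_p}\,e_{p,p-k}$, where $[r]=1$ if $r\in\frac12+\mathbb Z$ and $r<0$, and $[r]=0$ otherwise; it preserves $\widehat{\mathcal C}$ and satisfies $\omega([x,y])=[\omega(y),\omega(x)]$. A module $M$ is unitarizable if it admits a positive definite Hermitian form with $\langle xv|v'\rangle=\langle v|\omega(x)v'\rangle$ for all $x$ and all $v,v'\in M$. A partition of length $d$ is a non-increasing sequence $\lambda=(\lambda_1,\dots,\lambda_d)$ of non-negative integers (zeros allowed); $\lambda'_j=\#\{i:\lambda_i\ge j\}$; $\mathrm{rank}(\lambda)$ is the largest $i$ with $\lambda_i\ge i$. For $\lambda\ne0$ of rank $r$ put $\xi_i=\lambda_{i+\frac12}-i+\frac12$ ($i=\frac12,\frac32,\dots,r-\frac12$), $\xi_j=\lambda'_j-j$ ($j=1,\dots,r$); for $\lambda=0$ put $r=1$, $\xi_{\frac12}=\xi_1=0$. Then $\Lambda^{\widehat{\mathcal C}}(\lambda):=\sum_{j\in\frac12\mathbb N,\,j\le r}\xi_j\omega_j+d\Lambda_0$. *)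

(* Defs.v *)
From HB Require Import structures.
From mathcomp Require Import all_boot all_order all_algebra.
From mathcomp Require Import boolp classical_sets functions cardinality fsbigop.
From mathcomp Require Import reals.
From mathcomp Require Import complex.
From mathcomp Require Import zify ring.

Set Implicit Arguments.
Unset Strict Implicit.
Unset Printing Implicit Defensive.

Import Order.TTheory GRing.Theory Num.Theory.
Local Open Scope classical_set_scope.
Local Open Scope ring_scope.

(* The index set 1/2 Z is encoded by int, the integer n standing for n/2; all
   degrees are doubled in the same way.  Infinite sums are the finitely
   supported sums of fsbigop: on the matrices and vectors considered below
   every one of them has finitely many nonzero terms. *)

Definition halfint (n : int) : bool := odd `|n|%N.

Notation mat R := (int -> int -> R[i]).

Section Matrices.
Variable R : realType.
Implicit Types (A B : mat R) (v w : int -> R[i]) (p q : bool).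

Definition banded A : Prop :=
  exists N : nat, forall i j : int, (N < `|i - j|)%N -> A i j = 0.

Definition has_degree (k : int) A : Prop :=
  forall i j : int, A i j != 0 -> j - i = k.

Definition has_parity p A : Prop :=
  forall i j : int, A i j != 0 -> halfint (j - i) = p.

Definition parity_part p A : mat R :=
  fun i j => if halfint (j - i) == p then A i j else 0.

Definition mul A B : mat R :=
  fun i j => \sum_(k \in [set: int]) A i k * B k j.

(* Bilinear extension of [A, B] = AB - (-1)^{|A||B|} BA. *)
Definition superbracket A B : mat R :=
  \sum_(p : bool) \sum_(q : bool)
    (mul (parity_part p A) (parity_part q B)
     - (-1) ^+ (p && q) *: mul (parity_part q B) (parity_part p A)).

Definition supertrace A : R[i] :=
  \sum_(r \in [set: int]) (-1) ^+ halfint r * A r r.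

Definition Jmat : mat R := fun i j => ((i == j) && (i <= 0))%:R.

Definition cocycle A B : R[i] := supertrace (mul (superbracket Jmat A) B).

Definition calA A : Prop :=
  banded A /\ forall i : int, A i 0 = 0 /\ A 0 i = 0.

(* Vectors of V, given by their coordinates in the basis (e_j), j <> 0. *)
Definition inV v : Prop := finite_set [set i | v i != 0] /\ v 0 = 0.

Definition vec_parity p v : Prop := forall i : int, v i != 0 -> halfint i = p.

Definition mat_act A v : int -> R[i] :=
  fun i => \sum_(j \in [set: int]) A i j * v j.

Definition basis_form (i j : int) : R[i] :=
  if j == - i then (if halfint i then 1 else (Num.sg i)%:~R) else 0.

Definition Vform v w : R[i] :=
  \sum_(i \in [set: int]) \sum_(j \in [set: int]) v i * w j * basis_form i j.

Definition calC_hom p A : Prop :=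
  [/\ calA A, has_parity p A &
   forall q v w, inV v -> vec_parity q v -> inV w ->
     Vform (mat_act A v) w = - (-1) ^+ (p && q) * Vform v (mat_act A w)].

Definition calC A : Prop :=
  exists A0 A1, [/\ calC_hom false A0, calC_hom true A1 & A = A0 + A1].

(* The sign exponent [r] of the star structure. *)
Definition neg_half (r : int) : bool := halfint r && (r < 0).

Definition star_mat A : mat R :=
  fun i j => (-1) ^+ (neg_half i + neg_half j) * Num.conj (A j i).

(* Entrywise form of the condition defining calC, used to prove that calC is
   closed under linear combinations, bracket and star. *)
Definition beta (i : int) : R[i] := basis_form i (- i).

Definition skew A : Prop := forall i j : int, A i j * beta i =
  - (-1) ^+ (halfint (j - i) && halfint j) * (A (- j) (- i) * beta j).

Lemma betaE i : beta i = if halfint i then 1 else (Num.sg i)%:~R.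
Proof. by rewrite /beta /basis_form eqxx. Qed.

Lemma halfintN i : halfint (- i) = halfint i.
Proof. by rewrite /halfint abszN. Qed.

Lemma halfintD i j : halfint (i + j) = halfint i (+) halfint j.
Proof. rewrite /halfint; lia. Qed.

Lemma beta_sq i : i != 0 -> beta i * beta i = 1.
Proof.
rewrite betaE; case: halfint => // i0; first by rewrite mulr1.
by rewrite -intrM -expr2 sqr_sg i0.
Qed.

Lemma beta0 : beta 0 = 0. Proof. by rewrite betaE. Qed.

Lemma fsum1 (F : int -> R[i]) (a : int) : (forall i, i != a -> F i = 0) ->
  \sum_(i \in [set: int]) F i = F a.
Proof.
move=> F0; rewrite -(fsbig_widen [set a]) ?fsbig_set1//.
by move=> i [_ /= /eqP]; apply: F0.
Qed.

Lemma VformE v w :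
  Vform v w = \sum_(i \in [set: int]) v i * w (- i) * beta i.
Proof.
apply: eq_fsbigr => i _; rewrite (fsum1 (a := - i)) => [//|j /negPf ji].
by rewrite /basis_form ji mulr0.
Qed.

Definition dvec (a : int) : int -> R[i] := fun i => (i == a)%:R.

Lemma dvec_inV a : a != 0 -> inV (dvec a).
Proof.
move=> a0; split; last by rewrite /dvec eq_sym (negPf a0).
apply: (sub_finite_set (B := [set a])) => // i /=; rewrite /dvec.
by rewrite pnatr_eq0 eqb0 negbK => /eqP.
Qed.

Lemma dvec_parity a : vec_parity (halfint a) (dvec a).
Proof. by move=> i; rewrite /dvec pnatr_eq0 eqb0 negbK => /eqP->. Qed.

Lemma mat_act_dvec A a i : mat_act A (dvec a) i = A i a.
Proof.
rewrite /mat_act (fsum1 (a := a)) => [|j /negPf ja].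
  by rewrite /dvec eqxx mulr1.
by rewrite /dvec ja mulr0.
Qed.

Lemma calC_hom_skew p A : calC_hom p A -> skew A.
Proof.
move=> [[_ A0] Ap H] i j.
have [->|i0] := eqVneq i 0.
  by rewrite (A0 j).2 oppr0 (A0 (- j)).1 !mul0r mulr0.
have [->|j0] := eqVneq j 0; first by rewrite (A0 i).1 beta0 mul0r !mulr0.
have Ni0 : - i != 0 by rewrite oppr_eq0.
have := H _ _ _ (dvec_inV j0) (@dvec_parity j) (dvec_inV Ni0).
rewrite !VformE (fsum1 (a := i)) => [|k ki]; last first.
  by rewrite /dvec eqr_opp (negPf ki) mulr0 mul0r.
rewrite (fsum1 (a := j)) => [|k kj]; last by rewrite /dvec (negPf kj) !mul0r.
rewrite !mat_act_dvec /dvec !eqxx mulr1 mul1r => E; rewrite E.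
have [->|Aij] := eqVneq (A (- j) (- i)) 0; first by rewrite !mul0r !mulr0.
by have := Ap _ _ Aij; rewrite opprK addrC => ->.
Qed.

Lemma skew_add A B : skew A -> skew B -> skew (A + B).
Proof.
move=> sA sB i j; have -> : (A + B) i j = A i j + B i j by [].
have -> : (A + B) (- j) (- i) = A (- j) (- i) + B (- j) (- i) by [].
by rewrite !mulrDl mulrDr sA sB.
Qed.

Lemma skew_scale a A : skew A -> skew (a *: A).
Proof.
move=> sA i j; have E k l : (a *: A) k l = a * A k l by [].
by rewrite !E -!mulrA sA mulrCA.
Qed.

Lemma skew_part p A : skew A -> skew (parity_part p A).
Proof.
move=> sA i j; rewrite /parity_part opprK [- i + j]addrC.
by case: ifP => // _; rewrite !mul0r mulr0.
Qed.

Lemma calA_part p A : calA A -> calA (parity_part p A).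
Proof.
move=> [[N bN] A0]; split.
  by exists N => i j /bN E; rewrite /parity_part E if_same.
by move=> i; rewrite /parity_part (A0 i).1 (A0 i).2 !if_same.
Qed.

Lemma has_parity_part p A : has_parity p (parity_part p A).
Proof. by move=> i j; rewrite /parity_part; case: ifP => [/eqP //|_]; rewrite eqxx. Qed.

Lemma calA_add A B : calA A -> calA B -> calA (A + B).
Proof.
have E k l : (A + B) k l = A k l + B k l by [].
move=> [[N bN] A0] [[M bM] B0]; split.
  by exists (maxn N M) => i j; rewrite gtn_max => /andP[/bN F /bM G];
    rewrite E F G addr0.
by move=> i; rewrite !E (A0 i).1 (A0 i).2 (B0 i).1 (B0 i).2 !addr0.
Qed.

Lemma calA_scale a A : calA A -> calA (a *: A).
Proof.
move=> [[N bN] A0]; have E k l : (a *: A) k l = a * A k l by [].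
split; first by exists N => i j /bN F; rewrite E F mulr0.
by move=> i; rewrite !E (A0 i).1 (A0 i).2 !mulr0.
Qed.

Lemma parity_partD A : A = parity_part false A + parity_part true A.
Proof.
apply/funext => i; apply/funext => j.
have -> : (parity_part false A + parity_part true A) i j =
  parity_part false A i j + parity_part true A i j by [].
by rewrite /parity_part; case: halfint => /=; rewrite ?addr0 ?add0r.
Qed.

Lemma skew_calC_hom p A : calA A -> has_parity p A -> skew A -> calC_hom p A.
Proof.
move=> cA Ap sA; split=> // q v w [fv v0] vq [fw w0]; rewrite !VformE.
set P := [set i | v i != 0] in fv; set Q := [set i | w i != 0] in fw.
pose Q' := -%R @` Q.
have fQ' : finite_set Q' by exact: finite_image.
have restr (S : set int) (F : int -> R[i]) : (forall i, ~ S i -> F i = 0) ->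
    \sum_(i \in [set: int]) F i = \sum_(i \in S) F i.
  by move=> F0; apply/esym/fsbig_widen => // i [_ /= /F0].
have nw i : ~ Q' i -> w (- i) = 0.
  move=> Qi; apply/eqP; apply: contra_notT Qi => wi.
  by exists (- i); rewrite ?opprK.
have nv i : ~ P i -> v i = 0 by move=> Pi; apply/eqP; apply: contra_notT Pi.
transitivity (\sum_(i \in Q') \sum_(j \in P) A i j * v j * w (- i) * beta i).
  rewrite (restr Q') => [|i /nw->]; last by rewrite mulr0 mul0r.
  apply: eq_fsbigr => i _; rewrite /mat_act (restr P) => [|j /nv->].
    by rewrite !mulr_fsuml.
  by rewrite mulr0.
rewrite exchange_fsbig // mulr_fsumr (restr P) => [|i /nv->]; last first.
  by rewrite !mul0r mulr0.
apply: eq_fsbigr => j /set_mem Pj; rewrite /mat_act.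
rewrite (reindex_fsbigT (-%R)) /=; last by exists (-%R) => x; rewrite opprK.
rewrite (restr Q') => [|i /nw->]; last by rewrite mulr0.
rewrite mulr_fsumr mulr_fsuml mulr_fsumr; apply: eq_fsbigr => i _.
have -> : A i j * v j * w (- i) * beta i = (A i j * beta i) * (v j * w (- i)).
  by rewrite -!mulrA; congr (_ * _); rewrite [w _ * _]mulrC mulrCA.
rewrite sA -(vq j Pj).
have [->|Aij] := eqVneq (A (- j) (- i)) 0; first by rewrite !(mul0r, mulr0).
have := Ap _ _ Aij; rewrite opprK addrC => ->.
rewrite -!mulrA; congr (_ * _).
by rewrite [RHS]mulrCA; congr (_ * _); rewrite mulrC -!mulrA.
Qed.

Lemma calCP A : calC A <-> calA A /\ skew A.
Proof.
split=> [[A0 [A1 [C0 C1 ->]]]|[cA sA]].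
  split; first by apply: calA_add; [case: C0|case: C1].
  by apply: skew_add; [exact: calC_hom_skew C0|exact: calC_hom_skew C1].
exists (parity_part false A), (parity_part true A); split;
  last exact: parity_partD.
- by apply: skew_calC_hom;
    [exact: calA_part|exact: has_parity_part|exact: skew_part].
- by apply: skew_calC_hom;
    [exact: calA_part|exact: has_parity_part|exact: skew_part].
Qed.

Lemma calC0 : calC 0.
Proof.
apply/calCP; split; first by split; [exists 0%N|].
by move=> i j; have E k l : (0 : mat R) k l = 0 by []; rewrite !E !mul0r mulr0.
Qed.

Lemma calCD A B : calC A -> calC B -> calC (A + B).
Proof.
move=> /calCP[cA sA] /calCP[cB sB].
by apply/calCP; split; [exact: calA_add|exact: skew_add].
Qed.

Lemma calCZ a A : calC A -> calC (a *: A).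
Proof.
by move=> /calCP[cA sA]; apply/calCP; split; [exact: calA_scale|exact: skew_scale].
Qed.

Lemma calA_mul A B : calA A -> calA B -> calA (mul A B).
Proof.
move=> [[N bN] A0] [[M bM] B0]; split; last first.
  by move=> i; split; apply: fsbig1 => k _;
     rewrite ?(A0 k).2 ?(B0 k).1 ?mul0r ?mulr0.
exists (N + M)%N => i j Hij; apply: fsbig1 => k _.
have [/bN->|le] := ltnP N `|i - k|; first by rewrite mul0r.
by rewrite (bM k j) ?mulr0//; lia.
Qed.

Lemma skew_mul p q A B : skew A -> skew B -> calA A ->
  has_parity p A -> has_parity q B -> forall i j, mul A B i j * beta i =
  (-1) ^+ (halfint (j - i) && halfint j) * (-1) ^+ (p && q) *
  (mul B A (- j) (- i) * beta j).
Proof.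
move=> sA sB [_ A0] Ap Bq i j; rewrite /mul [in RHS](reindex_fsbigT (-%R)) /=;
  last by exists (-%R) => x; rewrite opprK.
rewrite !mulr_fsuml mulr_fsumr; apply: eq_fsbigr => k _.
have [->|k0] := eqVneq k 0.
  by rewrite oppr0 (A0 i).1 (A0 (- i)).2 mul0r mulr0 !mul0r mulr0.
rewrite mulrAC sA -mulrA -mulrA (mulrC (beta k)) sB.
have [->|Nz1] := eqVneq (A (- k) (- i)) 0; first by rewrite !(mul0r, mulr0).
have [->|Nz2] := eqVneq (B (- j) (- k)) 0; first by rewrite !(mul0r, mulr0).
rewrite -(Ap _ _ Nz1) -(Bq _ _ Nz2) !halfintD !halfintN.
have -> : A (- k) (- i) * (- (-1) ^+ ((halfint j (+) halfint k) && halfint j) *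
   (B (- j) (- k) * beta j)) = - (-1) ^+ ((halfint j (+) halfint k) && halfint j)
   * (B (- j) (- k) * A (- k) (- i) * beta j).
  by rewrite mulrCA; congr (_ * _); rewrite mulrCA mulrA.
rewrite [LHS]mulrA mulrNN; congr (_ * _).
by case: (halfint i) (halfint j) (halfint k) => [] [] [] /=;
  rewrite ?expr0 ?expr1 ?mulrNN ?mulr1 ?mul1r.
Qed.

Lemma calC_superbracket A B : calC A -> calC B -> calC (superbracket A B).
Proof.
move=> /calCP[cA sA] /calCP[cB sB].
have cp p X : calA X -> calA (parity_part p X) by exact: calA_part.
suff H p q : calC (mul (parity_part p A) (parity_part q B)
     - (-1) ^+ (p && q) *: mul (parity_part q B) (parity_part p A)).
  apply: big_ind => [||p _]; [exact: calC0|exact: calCD|].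
  by apply: big_ind => [||q _]; [exact: calC0|exact: calCD|exact: H].
rewrite -scaleNr; apply/calCP; split.
  by apply: calA_add; [|apply: calA_scale]; apply: calA_mul; exact: calA_part.
move=> i j; set X := mul _ _; set Y := mul _ _.
have E k l : (X - (-1) ^+ (p && q) *: Y) k l = X k l - (-1) ^+ (p && q) * Y k l.
  by [].
rewrite scaleNr !E !mulrBl -mulrA.
rewrite (skew_mul (skew_part p sA) (skew_part q sB) (calA_part p cA)
  (@has_parity_part p A) (@has_parity_part q B)).
rewrite (skew_mul (skew_part q sB) (skew_part p sA) (calA_part q cB)
  (@has_parity_part q B) (@has_parity_part p A)).
rewrite -/X -/Y [q && p]andbC; set s := (-1) ^+ (p && q).
have ss : s * s = 1 by rewrite /s -expr2 sqrr_sign.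
ring: ss.
Qed.

Lemma calC_star A : calC A -> calC (star_mat A).
Proof.
move=> /calCP[[[N bN] A0] sA]; apply/calCP; split.
  split; last by move=> i; rewrite /star_mat (A0 i).1 (A0 i).2 rmorph0 !mulr0.
  by exists N => i j Nij; rewrite /star_mat bN ?rmorph0 ?mulr0 //; lia.
move=> i j; rewrite /star_mat.
have [->|i0] := eqVneq i 0.
  by rewrite oppr0 beta0 (A0 _).2 rmorph0 !(mulr0, mul0r).
have [->|j0] := eqVneq j 0.
  by rewrite beta0 (A0 _).2 rmorph0 !(mulr0, mul0r).
have Bc k : Num.conj (beta k) = beta k.
  by rewrite betaE; case: halfint; rewrite ?rmorph1 // rmorph_int.
have /(congr1 Num.conj) := sA j i.
rewrite !rmorphM /= !Bc => E.
have {}E : Num.conj (A j i) = Num.conj (- (-1) ^+ (halfint (i - j) && halfint i))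
   * Num.conj (A (- i) (- j)) * beta i * beta j.
  by rewrite -[LHS]mulr1 -[X in _ * X = _](beta_sq j0) mulrA E !mulrA.
rewrite E rmorphN rmorphXn rmorphN rmorph1 /neg_half !halfintD !halfintN.
have -> : (-1) ^+ ((halfint i && (i < 0)) + (halfint j && (j < 0))) *
   (- (-1) ^+ ((halfint i (+) halfint j) && halfint i)
   * Num.conj (A (- i) (- j)) * beta i * beta j) * beta i =
   (-1) ^+ ((halfint i && (i < 0)) + (halfint j && (j < 0))) *
   (- (-1) ^+ ((halfint i (+) halfint j) && halfint i)) *
   (Num.conj (A (- i) (- j)) * beta j).
  have bb := beta_sq i0; move: ((-1) ^+ (_ + _)) ((-1) ^+ (_ && _)) => s1 s2.
  ring: bb.
rewrite !mulrA; congr (_ * _ * _).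
have -> : (- i < 0) = ~~ (i < 0) by lia.
have -> : (- j < 0) = ~~ (j < 0) by lia.
by case: (halfint i) (halfint j) (i < 0) (j < 0) => [] [] [] [] /=;
  rewrite ?(expr0, expr1, expr2, mulrNN, mulr1, mul1r, mulrN, mulNr, opprK).
Qed.

End Matrices.

(* The pair (A, c) stands for A + c C. *)
Notation glhat R := (mat R * R[i]^o)%type.

Definition hatC_pred (R : realType) : {pred glhat R} :=
  [pred x : glhat R | `[< calC x.1 >]].
Arguments hatC_pred : clear implicits.

Record hatC (R : realType) :=
  HatC { hatC_val : glhat R; hatC_valP : hatC_val \in hatC_pred R }.

Section HatC.
Variable R : realType.

Lemma hatC_submod_closed : subsemimod_closed (hatC_pred R).
Proof.
split; first split.
- by apply/asboolP; exact: calC0.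
- by move=> x y /asboolP cx /asboolP cy; apply/asboolP; exact: calCD.
- by move=> a x /asboolP cx; apply/asboolP; exact: calCZ.
Qed.

HB.instance Definition _ := GRing.isSubmodClosed.Build R[i] (glhat R)
  (hatC_pred R) hatC_submod_closed.
HB.instance Definition _ := [isSub for @hatC_val R].
HB.instance Definition _ := [Choice of hatC R by <:].
HB.instance Definition _ := [SubChoice_isSubLmodule of hatC R by <:].

Implicit Types (x y : hatC R).

Definition hmat x : mat R := (hatC_val x).1.
Definition hcen x : R[i] := (hatC_val x).2.

Lemma hmatP x : calC (hmat x).
Proof. by case: x => z zP; apply/asboolP. Qed.

Lemma hatC_bracket_subproof x y :
  (superbracket (hmat x) (hmat y), cocycle (hmat x) (hmat y)) \in hatC_pred R.
Proof. by apply/asboolP; apply: calC_superbracket; exact: hmatP. Qed.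

Definition bracket x y : hatC R := HatC (hatC_bracket_subproof x y).

Lemma hatC_star_subproof x :
  (star_mat (hmat x), Num.conj (hcen x)) \in hatC_pred R.
Proof. by apply/asboolP; apply: calC_star; exact: hmatP. Qed.

Definition star x : hatC R := HatC (hatC_star_subproof x).

Definition degree (k : int) x : Prop :=
  has_degree k (hmat x) /\ (k != 0 -> hcen x = 0).

Definition parity (p : bool) x : Prop :=
  has_parity p (hmat x) /\ (p -> hcen x = 0).

Definition hatC0_pred : {pred hatC R} := [pred x : hatC R | `[< degree 0 x >]].

Lemma hatC0_submod_closed : subsemimod_closed hatC0_pred.
Proof.
have E x : degree 0 x <-> forall i j, i != j -> hmat x i j = 0.
  split=> [[dx _] i j ij|H].
    apply/eqP; apply: contraT => /dx /eqP.
    by rewrite subr_eq0 eq_sym (negPf ij).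
  split=> [i j|]; last by rewrite eqxx.
  by have [->|/H->] := eqVneq i j; rewrite ?subrr ?eqxx.
split; first split.
- by apply/asboolP/E.
- move=> x y /asboolP/E dx /asboolP/E dy; apply/asboolP/E => i j ij.
  have -> : hmat (x + y) i j = hmat x i j + hmat y i j by [].
  by rewrite dx // dy // addr0.
- move=> a x /asboolP/E dx; apply/asboolP/E => i j ij.
  have -> : hmat (a *: x) i j = a * hmat x i j by [].
  by rewrite dx // mulr0.
Qed.

HB.instance Definition _ := GRing.isSubmodClosed.Build R[i] (hatC R)
  hatC0_pred hatC0_submod_closed.

End HatC.
Arguments hatC0_pred : clear implicits.

Record hatC0 (R : realType) :=
  HatC0 { hatC0_val :> hatC R; hatC0_valP : hatC0_val \in hatC0_pred R }.

HB.instance Definition _ R := [isSub for @hatC0_val R].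
HB.instance Definition _ R := [Choice of hatC0 R by <:].
HB.instance Definition _ R := [SubChoice_isSubLmodule of hatC0 R by <:].

Section Weights.
Variable R : realType.
Implicit Types (h : hatC0 R).

(* An element h of hatC0 is sum_(s > 0) a_s (e_ss - e_{-s,-s}) + d C with
   a_s = hmat h s s and d = hcen h. *)
Lemma hatC0E h (i j : int) : hmat h i j =
  if i == j then (Num.sg i)%:~R * hmat h `|i|%N `|i|%N else 0.
Proof.
have /asboolP[dh _] := hatC0_valP h.
have [<-|ij] := eqVneq i j; last first.
  apply/eqP; apply: contraT => /dh /eqP.
  by rewrite subr_eq0 eq_sym (negPf ij).
have /calCP[[_ A0] sA] := hmatP h.
have [->|i0] := eqVneq i 0; first by rewrite (A0 0).1 mul0r.
have := sA i i; rewrite subrr mulN1r => E.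
have {}E : hmat h i i = - hmat h (- i) (- i).
  rewrite -[LHS]mulr1 -[X in _ * X = _](beta_sq R i0) mulrA E mulNr -mulrA.
  by rewrite beta_sq // mulr1.
case: (ltrgt0P i) i0 => // ip _.
  by rewrite gtz0_abs // gtr0_sg // mul1r.
by rewrite ltz0_abs // ltr0_sg // mulN1r.
Qed.

Definition omega (s : nat) h : R[i] := hmat h s s.
Definition Lambda0 h : R[i] := hcen h.

Definition weight (d r : nat) (c : nat -> int) h : R[i] :=
  \sum_(1 <= s < r.*2.+1) (c s)%:~R * omega s h + d%:R * Lambda0 h.

End Weights.

Definition is_partition (d : nat) (lam : d.-tuple nat) : bool :=
  sorted geq lam.

Definition conj_part (d : nat) (lam : d.-tuple nat) (j : nat) : nat :=
  count (leq j) lam.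

Definition rank (d : nat) (lam : d.-tuple nat) : nat :=
  \max_(i < d | (i.+1 <= tnth lam i)%N) i.+1.

(* s stands for s/2: the odd s = 2m - 1 gives lam_m - m + 1, the even s = 2j
   gives lam'_j - j; nth is 0-based, so lam_m is nth 0 lam m.-1. *)
Definition frob (d : nat) (lam : d.-tuple nat) (s : nat) : int :=
  if odd s then (nth 0%N lam s./2)%:Z - (s./2)%:Z
  else (conj_part lam s./2)%:Z - (s./2)%:Z.

Definition Lambda (R : realType) (d : nat) (lam : d.-tuple nat) :
    hatC0 R -> R[i] :=
  if all (pred1 0%N) lam then weight d 1 (fun=> 0)
  else weight d (rank lam) (frob lam).

Section Modules.
Variables (R : realType) (M : lmodType R[i]) (rho : {bilinear hatC R -> M -> M}).

Definition is_module : Prop := forall p q x y (v : M),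
  parity p x -> parity q y ->
  rho (bracket x y) v = rho x (rho y v) - (-1) ^+ (p && q) *: rho y (rho x v).

Definition irreducible : Prop :=
  (exists v : M, v != 0) /\
  forall N : set M, N 0 -> (forall a u v, N u -> N v -> N (a *: u + v)) ->
    (forall x v, N v -> N (rho x v)) ->
    N = [set 0] \/ N = setT.

(* U(g_-)_k v is spanned by the x_1 ... x_n v with x_i in g_{-k_i}, k_i > 0,
   of total degree k = - (k_1 + ... + k_n). *)
Inductive lowered (v : M) : int -> M -> Prop :=
| lowered_nil : lowered v 0 v
| lowered_cons (k l : int) (x : hatC R) (u : M) :
    0 < k -> degree (- k) x -> lowered v l u -> lowered v (l - k) (rho x u).

Definition span (S : set M) : set M :=
  [set u | exists n (a : 'I_n -> R[i]) (s : 'I_n -> M),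
    (forall i, S (s i)) /\ u = \sum_i a i *: s i].

Definition component (v : M) (k : int) : set M := span (lowered v k).

Definition finite_dim (S : set M) : Prop :=
  exists n (b : 'I_n -> M), forall u, S u ->
    exists a : 'I_n -> R[i], u = \sum_i a i *: b i.

(* The degree operator sum_(s > 0) s (e_ss - e_{-s,-s}) lies in hatC0, so the
   components below are its eigenspaces: their sum is direct, and they give M
   its superspace structure, inherited by every submodule. *)
Definition highest_weight_vector (xi : {scalar hatC0 R}) (v : M) : Prop :=
  [/\ v != 0,
      forall h : hatC0 R, rho h v = xi h *: v,
      forall (k : int) x, 0 < k -> degree k x -> rho x v = 0 &
      span [set u | exists k, lowered v k u] = setT].

Definition quasi_finite_highest_weight (xi : {scalar hatC0 R}) : Prop :=
  exists v, highest_weight_vector xi v /\ forall k, finite_dim (component v k).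

Definition unitarizable : Prop :=
  exists f : {dot M for Num.conj}, forall x u v,
    f (rho x u) v = f u (rho (star x) v).

End Modules.

(* Conditions (i) and (ii); c s is the coefficient indexed by s/2. *)
Definition admissible (d r : nat) (c : nat -> int) : Prop :=
  [/\ (0 < r)%N,
      (forall m, (0 < m < r)%N -> c m.*2.+1 < c m.*2.-1) /\ 0 <= c r.*2.-1,
      (forall m, (0 < m < r)%N -> c m.+1.*2 < c m.*2) /\ 0 <= c r.*2,
      c r.*2.-1 = 0 <-> [/\ r = 1%N, c 1%N = 0 & c 2%N = 0] &
      Num.min (c 1%N) 1 + c 2%N <= d%:Z].

(* Main.v *)
(* Weights.  If M is unitarizable, quasi-finiteness makes the vectors
   (sum_j j^m e_(j+1,j)) v linearly dependent, which forces xi to be finitely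
   supported.  Compact sl2-triples of equal parity make the coefficients of xi
   natural numbers; applying them after an odd reflection makes the inequalities
   strict, and the long root of the symplectic part bounds xi_1 by the level d.

   Unitarity.  Conversely, d copies of a Fock space with one boson for each
   half-integer and one fermion for each integer form a unitary module of level
   d over the whole of gl-hat.  For a partition lambda, the state in which the
   fermion l occupies the first lambda'_l copies is singular for the order of the
   modes in which all fermions precede all bosons.  Moving the bosons one by one
   to their place in the order 1/2 < 1 < 3/2 < ... by odd reflections turns it
   into a singular vector w of weight Lambda(lambda), and the submodule generated
   by (v, w) in M x Fock is the graph of an isometric embedding of M. *)

Require Import Defs.
From HB Require Import structures.
From mathcomp Require Import all_boot ssrAC all_order all_algebra.
From mathcomp Require Import boolp classical_sets functions cardinality fsbigop.
From mathcomp Require Import reals.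
From mathcomp Require Import complex.
From mathcomp Require Import zify ring.

Set Implicit Arguments.
Unset Strict Implicit.
Unset Printing Implicit Defensive.

Import Order.TTheory GRing.Theory Num.Theory.
Local Open Scope classical_set_scope.
Local Open Scope ring_scope.

Local Notation mul := Defs.mul.

(** * Matrices and the homogeneous components *)

(** An element of [hatC] has infinitely many entries, so on the Fock space it acts by an infinite
    sum. Once the vacuum value is subtracted from every quadratic operator, a banded matrix acts on
    a vector with bounded modes as its truncation to any large enough box, and all identities are
    proved inside a box. The subtracted constants also produce the central term: the vacuum value of
    a commutator of truncated matrices is d times the cocycle.

    Modes of index at most 0 exchange creation and annihilation. For a boson this reverses the
    commutator, and the compensating sign is exactly the exponent [r] of omega; hence the positive
    Fock form is contravariant.

    In the embedding step the obstacle is that the graph must be single-valued: a vector paired with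
    0 has to vanish, which follows from positivity of the form on the Fock side. Positivity also
    decides each odd reflection: the squared norm of the reflected vector is the sum of two
    occupation numbers times that of the old one, so it vanishes exactly when both are zero. *)

Definition box (L : nat) : seq int :=
  [seq n%:Z - L%:Z | n <- iota 0 L.*2.+1].

Lemma mem_box L i : (i \in box L) = (`|i| <= L)%N.
Proof.
apply/mapP/idP => [[n]|iL]; first by rewrite mem_iota; lia.
by exists (absz (i + L%:Z)%R); rewrite ?mem_iota; lia.
Qed.

Lemma box_uniq L : uniq (box L).
Proof. by rewrite map_inj_uniq ?iota_uniq // => m n /(congr1 (fun x => x + L%:Z)); lia. Qed.

Section MatrixTools.
Variable R : realType.
Local Notation C := R[i].
Implicit Types (A B : mat R) (p q : bool).

Definition bnd (b : nat) A : Prop := forall i j : int, (b < `|i - j|)%N -> A i j = 0.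

Lemma bndW b b' A : (b <= b')%N -> bnd b A -> bnd b' A.
Proof. by move=> bb Ab i j ij; apply: Ab; apply: leq_ltn_trans bb ij. Qed.

Lemma fsum_seq (F : int -> C) (s : seq int) : uniq s ->
  (forall i, i \notin s -> F i = 0) ->
  \sum_(i \in [set: int]) F i = \sum_(i <- s) F i.
Proof.
move=> us F0; rewrite (fsbig_seq _ _ us); apply/esym/fsbig_widen => //.
by move=> i [_ /= /negP]; apply: F0.
Qed.

Lemma mulEl b L A B i j : bnd b A -> (`|i| + b <= L)%N ->
  mul A B i j = \sum_(k <- box L) A i k * B k j.
Proof.
move=> Ab iL; apply: fsum_seq; first exact: box_uniq.
by move=> k; rewrite mem_box => kL; rewrite Ab ?mul0r//; lia.
Qed.

Lemma mulEr b L A B i j : bnd b B -> (`|j| + b <= L)%N ->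
  mul A B i j = \sum_(k <- box L) A i k * B k j.
Proof.
move=> Ab iL; apply: fsum_seq; first exact: box_uniq.
by move=> k; rewrite mem_box => kL; rewrite Ab ?mulr0//; lia.
Qed.

Lemma parity_part_id p A : has_parity p A -> parity_part p A = A.
Proof.
move=> Ap; apply/funext => i; apply/funext => j; rewrite /parity_part.
case: ifPn => // /negP ij; apply/esym/eqP; apply/negPn/negP => /Ap H.
by apply: ij; rewrite H.
Qed.

Lemma parity_part_0 p q A : has_parity p A -> p != q -> parity_part q A = 0.
Proof.
move=> Ap pq; apply/funext => i; apply/funext => j; rewrite /parity_part.
case: ifPn => // /eqP ij; apply/eqP; apply/negPn/negP => /Ap H.
by move: pq; rewrite -H ij eqxx.
Qed.

Lemma mul0m A : mul 0 A = 0.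
Proof.
by apply/funext => i; apply/funext => j; apply: fsbig1 => k _; exact: mul0r.
Qed.

Lemma mulm0 A : mul A 0 = 0.
Proof.
by apply/funext => i; apply/funext => j; apply: fsbig1 => k _; exact: mulr0.
Qed.

Lemma superbracket_hom p q A B : has_parity p A -> has_parity q B ->
  superbracket A B = mul A B - (-1) ^+ (p && q) *: mul B A.
Proof.
move=> Ap Bq; rewrite /superbracket (bigD1 p) //= [X in _ + X]big1 ?addr0.
  rewrite (bigD1 q) //= [X in _ + X]big1 ?addr0.
    by rewrite !parity_part_id.
  move=> q' qq'; rewrite (parity_part_0 Bq) 1?eq_sym //.
  by rewrite mulm0 mul0m scaler0 subr0.
move=> p' pp'; rewrite (parity_part_0 Ap) 1?eq_sym //.
by rewrite big1 // => q' _; rewrite mulm0 mul0m scaler0 subr0.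
Qed.

Lemma superbracketE p q A B i j : has_parity p A -> has_parity q B ->
  superbracket A B i j = mul A B i j - (-1) ^+ (p && q) * mul B A i j.
Proof. by move=> Ap Bq; rewrite (superbracket_hom Ap Bq). Qed.

Lemma has_degree_parity k A : has_degree k A -> has_parity (halfint k) A.
Proof. by move=> Ak i j /Ak ->. Qed.

Lemma has_degree_mul k l A B : has_degree k A -> has_degree l B ->
  has_degree (k + l) (mul A B).
Proof.
move=> Ak Bl i j; apply: contraNeq => ij; apply/eqP; apply: fsbig1 => m _.
have [->|/Ak im] := eqVneq (A i m) 0; first by rewrite mul0r.
have [->|/Bl mj] := eqVneq (B m j) 0; first by rewrite mulr0.
by move: ij; rewrite -im -mj; lia.
Qed.

Lemma has_degree_superbracket k l A B : has_degree k A -> has_degree l B ->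
  has_degree (k + l) (superbracket A B).
Proof.
move=> Ak Bl i j.
rewrite (superbracketE _ _ (has_degree_parity Ak) (has_degree_parity Bl)).
apply: contraNeq => ij.
have [->|/(has_degree_mul Ak Bl) E] := eqVneq (mul A B i j) 0; last first.
  by rewrite E eqxx in ij.
have [->|/(has_degree_mul Bl Ak) E] := eqVneq (mul B A i j) 0; last first.
  by rewrite E addrC eqxx in ij.
by rewrite mulr0 subr0.
Qed.

Lemma Jmat_parity : has_parity false (Jmat R).
Proof.
move=> i j; rewrite /Jmat; have [->|] := eqVneq i j; last by rewrite eqxx.
by rewrite subrr.
Qed.

Lemma mulJm A i j : mul (Jmat R) A i j = (i <= 0)%R%:R * A i j.
Proof.
rewrite /mul (fsum1 (a := i)) /Jmat ?eqxx// => k ki.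
by rewrite eq_sym (negPf ki) mul0r.
Qed.

Lemma mulmJ A i j : mul A (Jmat R) i j = (j <= 0)%R%:R * A i j.
Proof.
rewrite /mul (fsum1 (a := j)) /Jmat ?eqxx 1?mulrC// => k ki.
by rewrite (negPf ki) mulr0.
Qed.

Lemma superbracketJ A i j :
  superbracket (Jmat R) A i j = ((i <= 0)%R%:R - (j <= 0)%R%:R) * A i j.
Proof.
rewrite /superbracket (bigD1 false) //= [X in _ + X]big1 ?addr0; last first.
  move=> [] // _; rewrite (parity_part_0 Jmat_parity) //.
  by rewrite big1 // => q' _; rewrite mulm0 mul0m scaler0 subr0.
rewrite (parity_part_id Jmat_parity) (bigD1 false) //= (bigD1 true) //= big1.
  rewrite addr0 /= !expr0 !scale1r.
  set X1 := mul _ _; set X2 := mul _ _; set X3 := mul _ _; set X4 := mul _ _.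
  rewrite -[LHS]/(X1 i j - X2 i j + (X3 i j - X4 i j)) /X1 /X2 /X3 /X4.
  rewrite !mulJm !mulmJ [in RHS](parity_partD A).
  rewrite -[(parity_part false A + parity_part true A) i j]/(parity_part false A i j + parity_part true A i j).
  ring.
by case.
Qed.

(** Commuting with J keeps only the entries that join an index at most 0 to a positive one. In a
    matrix of bandwidth b both indices of such an entry have absolute value at most b, so the
    supertrace is a finite sum. *)
Lemma cocycleE b L A B : bnd b A -> (b <= L)%N ->
  cocycle A B = \sum_(i <- box L) \sum_(k <- box L)
    (-1) ^+ halfint i * (((i <= 0)%R%:R - (k <= 0)%R%:R) * (A i k * B k i)).
Proof.
move=> Ab bL; rewrite /cocycle /supertrace.
have key i k : k \notin box L \/ i \notin box L ->
    ((i <= 0)%R%:R - (k <= 0)%R%:R) * A i k = 0.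
  rewrite !mem_box => ik.
  have [/Ab ->|ikb] := ltnP b `|i - k|; first by rewrite mulr0.
  suff -> : (i <= 0) = (k <= 0) by rewrite subrr mul0r.
  by lia.
rewrite (fsum_seq (s := box L)) ?box_uniq//.
  apply: eq_bigr => i _; rewrite -mulr_sumr; congr (_ * _).
  rewrite /mul (fsum_seq (s := box L)) ?box_uniq//.
    by apply: eq_bigr => k _; rewrite superbracketJ mulrA.
  by move=> k kL; rewrite superbracketJ key ?mul0r//; left.
move=> i iL; rewrite /mul fsbig1 ?mulr0// => k _.
by rewrite superbracketJ key ?mul0r//; right.
Qed.

End MatrixTools.

Section HatCTools.
Variable R : realType.
Local Notation C := R[i].
Implicit Types (x y : hatC R).

Lemma hmat_banded x : exists b, bnd b (hmat x).
Proof. by have /calCP[[[b Ab] _] _] := hmatP x; exists b. Qed.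

Lemma hatC_eq x y : hmat x = hmat y -> hcen x = hcen y -> x = y.
Proof.
move=> E1 E2; apply: val_inj; case: x y E1 E2 => [[A a] pA] [[B b] pB].
by rewrite /hmat /hcen /= => -> ->.
Qed.

Definition mkC (A : mat R) (c : C) (H : calC A) : hatC R :=
  @HatC R (A, c) (introT (asboolP _) H).

Lemma hmatD x y : hmat (x + y) = hmat x + hmat y. Proof. by []. Qed.
Lemma hmatZ a x : hmat (a *: x) = a *: hmat x. Proof. by []. Qed.
Lemma hcenD x y : hcen (x + y) = hcen x + hcen y. Proof. by []. Qed.
Lemma hcenZ a x : hcen (a *: x) = a * hcen x. Proof. by []. Qed.
Lemma hmat_sum I (r : seq I) (P : pred I) (F : I -> hatC R) i j :
  hmat (\sum_(t <- r | P t) F t) i j = \sum_(t <- r | P t) hmat (F t) i j.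
Proof. by elim/big_rec2: _ => // t a b _ <-. Qed.

Lemma hcen_sum I (r : seq I) (P : pred I) (F : I -> hatC R) :
  hcen (\sum_(t <- r | P t) F t) = \sum_(t <- r | P t) hcen (F t).
Proof. by elim/big_rec2: _ => // t a b _ <-. Qed.

Lemma degree_parity k x : degree k x -> parity (halfint k) x.
Proof.
move=> [kx cx]; split; first exact: has_degree_parity.
by move=> hk; apply: cx; apply: contraTneq hk => ->.
Qed.

Lemma cocycle_degree k l x y : degree k x -> degree l y -> k + l != 0 ->
  cocycle (hmat x) (hmat y) = 0.
Proof.
move=> [xk _] [yl _] kl; have [b xb] := hmat_banded x.
rewrite (cocycleE _ xb (leqnn b)) big1 // => i _; rewrite big1 // => j _.
have [->|/xk E] := eqVneq (hmat x i j) 0; first by rewrite mul0r !mulr0.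
have [->|/yl E'] := eqVneq (hmat y j i) 0; first by rewrite !mulr0.
by move: kl; rewrite -E -E'; lia.
Qed.

Lemma degree_bracket k l x y : degree k x -> degree l y ->
  degree (k + l) (bracket x y).
Proof.
move=> kx ly; split; last by move=> kl; apply: (cocycle_degree kx ly).
by apply: has_degree_superbracket; [case: kx|case: ly].
Qed.

Lemma degree_star k x : degree k x -> degree (- k) (star x).
Proof.
move=> [kx cx]; split.
  move=> i j; rewrite /star /hmat /= /star_mat mulf_eq0 negb_or => /andP[_].
  by rewrite conjC_eq0 => /kx <-; lia.
by rewrite oppr_eq0 => /cx E; rewrite /star /hcen /=; rewrite -/(hcen x) E rmorph0.
Qed.

Lemma star_matK : involutive (@star_mat R).
Proof.
move=> A; apply/funext => i; apply/funext => j; rewrite /star_mat.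
rewrite rmorphM rmorphXn rmorphN rmorph1 /= conjCK addnC mulrA -exprD.
by rewrite addnn -mul2n exprM sqrrN !expr1n mul1r.
Qed.

Lemma starK : involutive (@star R).
Proof.
move=> x; apply: hatC_eq; first exact: star_matK.
by rewrite /star /hcen /= conjCK.
Qed.

Definition deg_mat (k : int) (A : mat R) : mat R :=
  fun i j => if j - i == k then A i j else 0.

Lemma calC_deg k (A : mat R) : calC A -> calC (deg_mat k A).
Proof.
move=> /calCP[[[b bA] A0] sA]; apply/calCP; split.
  split; last by move=> i; rewrite /deg_mat (A0 i).1 (A0 i).2 !if_same.
  by exists b => i j /bA E; rewrite /deg_mat E if_same.
move=> i j; rewrite /deg_mat opprK [- i + j]addrC.
by case: ifP => // _; rewrite !mul0r mulr0.
Qed.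

Definition deg_part k x : hatC R :=
  mkC (if k == 0 then hcen x else 0) (calC_deg k (hmatP x)).

Lemma degree_deg_part k x : degree k (deg_part k x).
Proof.
split; last by move=> /negPf k0; rewrite /deg_part /hcen /= k0.
move=> i j; rewrite /deg_part /hmat /= /deg_mat.
by case: ifP => [/eqP//|_]; rewrite eqxx.
Qed.

(** A banded matrix has finitely many nonzero diagonals. This reduces statements about all of [hatC]
    to homogeneous elements, for which the module axiom is stated. *)
Lemma deg_part_sum x : exists b, x = \sum_(k <- box b) deg_part k x.
Proof.
have [b xb] := hmat_banded x; exists b; apply: hatC_eq.
  apply/funext => i; apply/funext => j; rewrite hmat_sum.
  have [ij|ij] := boolP (j - i \in box b); last first.
    rewrite xb ?big1_seq//; last by move: ij; rewrite mem_box; lia.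
    move=> k /andP[_ kb]; rewrite /deg_part /hmat /= /deg_mat.
    by case: eqP => // E; rewrite -E (negPf ij) in kb.
  rewrite (bigD1_seq (j - i)) ?box_uniq//= big1 ?addr0.
    by rewrite /deg_part /hmat /= /deg_mat eqxx.
  move=> k kij; rewrite /deg_part /hmat /= /deg_mat.
  by rewrite eq_sym (negPf kij).
rewrite hcen_sum (bigD1_seq 0) ?box_uniq ?mem_box//= big1 ?addr0.
  by rewrite /deg_part /hcen /=.
by move=> k /negPf k0; rewrite /deg_part /hcen /= k0.
Qed.

Lemma cocycle0 (A B : mat R) : calC A ->
  (forall i j : int, (i <= 0) != (j <= 0) -> A i j = 0) -> cocycle A B = 0.
Proof.
move=> /calCP[[[b bA] _] _] H; rewrite (cocycleE _ bA (leqnn b)).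
rewrite big1 // => i _; rewrite big1 // => j _.
have [->|/H ->] := eqVneq (i <= 0) (j <= 0); last by rewrite mul0r !mulr0.
by rewrite subrr !mul0r mulr0.
Qed.

End HatCTools.

(** * A Fock space of bosons and fermions *)

Section Fock.
Variables (R : realType) (par : nat -> bool).
Local Notation C := R[i].
Implicit Types (m : nat) (s : nat -> nat) (f g : (nat -> nat) -> C).

Definition inc m s : nat -> nat := fun n => (s n + (n == m))%N.
Definition dec m s : nat -> nat := fun n => (s n - (n == m))%N.

(* [odd n], rather than [n == 1], makes the anticommutation relations hold at
   every occupation number, so that no exclusion constraint is needed. *)
Definition phi m (n : nat) : C := if par m then (odd n)%:R else sqrtC n%:R.
(** The Jordan-Wigner sign: it makes distinct fermionic modes anticommute and is 1 on bosonic
    ones. *)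
Definition eps m s : C := (-1) ^+ (par m * \sum_(n < m | par n) s n).

(** Vectors are coordinate functions on occupation states, so creation reads its argument at the
    lowered state. At an empty mode the truncated [dec] changes nothing, but the factor
    [phi m 0 = 0] removes the term. *)
Definition crt m f : (nat -> nat) -> C :=
  fun s => eps m s * phi m (s m) * f (dec m s).
Definition ann m f : (nat -> nat) -> C :=
  fun s => eps m s * phi m (s m).+1 * f (inc m s).

Lemma crt_is_linear m : linear (crt m).
Proof.
move=> a f g; apply/funext => s; rewrite /crt.
rewrite -[(a *: f + g) _]/(a * f _ + g _) -[RHS]/(a * _ + _); ring.
Qed.

Lemma ann_is_linear m : linear (ann m).
Proof.
move=> a f g; apply/funext => s; rewrite /ann.
rewrite -[(a *: f + g) _]/(a * f _ + g _) -[RHS]/(a * _ + _); ring.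
Qed.

HB.instance Definition _ m := GRing.isLinear.Build _ _ _ _ (crt m) (crt_is_linear m).
HB.instance Definition _ m := GRing.isLinear.Build _ _ _ _ (ann m) (ann_is_linear m).

Lemma phi0 m : phi m 0 = 0.
Proof. by rewrite /phi; case: par => //; rewrite sqrtC0. Qed.

(** The square of [phi] is n for a boson and the parity of n for a fermion; this recursion is the
    commutation relation of a single mode. *)
Lemma phi_sq m n : phi m n.+1 ^+ 2 = (-1) ^+ par m * phi m n ^+ 2 + 1.
Proof.
rewrite /phi; case: par; last first.
  by rewrite !sqrtCK expr0 mul1r -natr1.
by rewrite /= expr1; case: odd; rewrite /= ?expr1n ?expr0n /=; ring.
Qed.

Lemma phi_conj m n : Num.conj (phi m n) = phi m n.
Proof.
rewrite /phi; case: par; first by rewrite conjC_nat.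
by apply: conj_Creal; rewrite ger0_real // sqrtC_ge0 ler0n.
Qed.

Lemma eps_conj m s : Num.conj (eps m s) = eps m s.
Proof. by rewrite /eps rmorphXn rmorphN rmorph1. Qed.

Lemma eps_sq m s : eps m s * eps m s = 1.
Proof. by rewrite /eps -expr2 -exprM mulnC exprM sqrrN !expr1n. Qed.

Lemma eps_inc m m' s :
  eps m (inc m' s) = (-1) ^+ [&& par m, par m' & (m' < m)%N] * eps m s.
Proof.
rewrite /eps -exprD; case pm : (par m) => /=; last by rewrite !mul0n.
rewrite !mul1n /inc big_split /= addnC; congr (_ ^+ (_ + _)).
have [m'm|mm'] := ltnP m' m; last first.
  rewrite andbF big1// => i _; apply/eqP; rewrite eqb0; apply: contraTneq (ltn_ord i) => ->.
  by rewrite -leqNgt.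
rewrite andbT; case pm' : (par m') => /=.
  rewrite (bigD1 (Ordinal m'm)) //= eqxx big1 // => i /andP[_ im].
  by apply/eqP; rewrite eqb0; apply: contraNneq im => E; apply/eqP/val_inj.
by rewrite big1 // => i pi; apply/eqP; rewrite eqb0; apply: contraTneq pi => ->; rewrite pm'.
Qed.

Lemma dec_inc m s : dec m (inc m s) = s.
Proof. by apply/funext => n; rewrite /dec /inc addnK. Qed.

Lemma inc_dec m s : (0 < s m)%N -> inc m (dec m s) = s.
Proof.
by move=> sm; apply/funext => n; rewrite /dec /inc; have [->|] := eqVneq n m; lia.
Qed.

Lemma incC m m' s : inc m (inc m' s) = inc m' (inc m s).
Proof. by apply/funext => n; rewrite /inc; lia. Qed.

Lemma decC m m' s : dec m (dec m' s) = dec m' (dec m s).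
Proof. by apply/funext => n; rewrite /dec; lia. Qed.

Lemma dec_incC m m' s : m != m' -> dec m (inc m' s) = inc m' (dec m s).
Proof.
move=> mm'; apply/funext => n; rewrite /inc /dec.
by have [->|nm] := eqVneq n m; rewrite ?(negPf mm') ?addn0 //; lia.
Qed.

Lemma inc_self m s : inc m s m = (s m).+1.
Proof. by rewrite /inc eqxx addn1. Qed.
Lemma dec_self m s : dec m s m = (s m).-1.
Proof. by rewrite /dec eqxx subn1. Qed.
Lemma inc_neq m m' s : m != m' -> inc m s m' = s m'.
Proof. by rewrite /inc eq_sym => /negPf ->; rewrite addn0. Qed.
Lemma dec_neq m m' s : m != m' -> dec m s m' = s m'.
Proof. by rewrite /dec eq_sym => /negPf ->; rewrite subn0. Qed.

Lemma eps_dec m m' s : (0 < s m')%N ->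
  eps m (dec m' s) = (-1) ^+ [&& par m, par m' & (m' < m)%N] * eps m s.
Proof.
move=> sm; rewrite -[in RHS](inc_dec sm) eps_inc mulrA -exprD addnn.
by rewrite -mul2n exprM sqrrN !expr1n mul1r.
Qed.

Lemma swap_sign m m' : m != m' ->
  (-1) ^+ [&& par m, par m' & (m' < m)%N] =
  (-1) ^+ (par m && par m') * (-1) ^+ [&& par m', par m & (m < m')%N] :> C.
Proof.
case: ltngtP => // _ _; case: (par m) (par m') => [] [] /=;
  by rewrite ?expr0 ?expr1 ?mulr1 ?mulrNN ?mulr1.
Qed.

Lemma phi_ferm m n : par m -> phi m n * phi m n.+1 = 0.
Proof.
by rewrite /phi => -> /=; case: odd; rewrite ?mulr0 ?mul0r.
Qed.

Lemma ann_ann m m' f :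
  ann m (ann m' f) = (-1) ^+ (par m && par m') *: ann m' (ann m f).
Proof.
apply/funext => s; rewrite -[RHS]/(_ * _) /ann.
have [<-|mm'] := eqVneq m m'.
  case pm : (par m); last by rewrite expr0 mul1r.
  rewrite inc_self.
  have E : phi m (s m).+1 * phi m (s m).+2 = 0 by exact: phi_ferm.
  by ring: E.
have m'm : m' != m by rewrite eq_sym.
rewrite !eps_inc !inc_neq// (swap_sign mm') [inc m' (inc m s)]incC.
have E : (-1) ^+ (par m && par m') * (-1) ^+ (par m && par m') = 1 :> C.
  by rewrite -expr2 sqrr_sign.
by ring: E.
Qed.

Lemma crt_crt m m' f :
  crt m (crt m' f) = (-1) ^+ (par m && par m') *: crt m' (crt m f).
Proof.
apply/funext => s; rewrite -[RHS]/(_ * _) /crt.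
have [<-|mm'] := eqVneq m m'.
  case pm : (par m); last by rewrite expr0 mul1r.
  rewrite dec_self.
  have E : phi m (s m) * phi m (s m).-1 = 0.
    by case: (s m) => [|n]; rewrite ?phi0 ?mul0r //= mulrC phi_ferm.
  by ring: E.
have m'm : m' != m by rewrite eq_sym.
rewrite !dec_neq//.
have [->|sm] := posnP (s m); first by rewrite phi0 !(mul0r, mulr0).
have [->|sm'] := posnP (s m'); first by rewrite phi0 !(mul0r, mulr0).
rewrite !eps_dec ?dec_neq// [in RHS](swap_sign mm') [dec m' (dec m s)]decC.
have E : (-1) ^+ (par m && par m') * (-1) ^+ (par m && par m') = 1 :> C.
  by rewrite -expr2 sqrr_sign.
by ring: E.
Qed.

Lemma ann_crt m m' f : ann m (crt m' f) =
  (-1) ^+ (par m && par m') *: crt m' (ann m f) + (m == m')%:R *: f.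
Proof.
apply/funext => s; rewrite -[RHS]/(_ * _ + _ * _) /ann /crt.
have [<-|mm'] := eqVneq m m'.
  rewrite inc_self dec_inc mul1r dec_self eps_inc ltnn !andbF mul1r.
  rewrite andbb.
  have [s0|sm] := posnP (s m).
    have := phi_sq m 0; have := eps_sq m s; rewrite s0 phi0 => E1 E2.
    by ring: E1 E2.
  rewrite eps_dec// ltnn !andbF mul1r inc_dec// prednK//.
  have := phi_sq m (s m); have := eps_sq m s.
  by move=> E1 E2; ring: E1 E2.
have m'm : m' != m by rewrite eq_sym.
rewrite mul0r addr0 eps_inc inc_neq// dec_incC// dec_neq//.
have [->|sm'] := posnP (s m'); first by rewrite phi0 !(mul0r, mulr0).
rewrite eps_dec// (swap_sign m'm) [par m' && par m]andbC; ring.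
Qed.

End Fock.

(** * The inner product on finitely supported states *)

Section FockForm.
Variables (R : realType) (par : nat -> bool).
Local Notation C := R[i].
Local Notation st := (nat -> nat).
Implicit Types (m : nat) (s : st) (f g : st -> C).

Definition finS f : Prop := exists X : seq st, forall s, f s != 0 -> s \in X.

Definition fdot f g : C := \sum_(s \in [set: st]) f s * Num.conj (g s).

Lemma fdotE (X : seq st) f g : uniq X ->
  (forall s, f s * Num.conj (g s) != 0 -> s \in X) ->
  fdot f g = \sum_(s <- X) f s * Num.conj (g s).
Proof.
move=> uX fX; rewrite (fsbig_seq _ _ uX); apply/esym/fsbig_widen => //.
by move=> i [_ /= /negP]; apply: contraNeq; apply: fX.
Qed.

Lemma finSP f : finS f -> exists2 X : seq st, uniq X & forall s, f s != 0 -> s \in X.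
Proof.
by move=> [X fX]; exists (undup X); rewrite ?undup_uniq// => s /fX; rewrite mem_undup.
Qed.

Lemma finS_lin a f g : finS f -> finS g -> finS (a *: f + g).
Proof.
move=> [X fX] [Y gY]; exists (X ++ Y) => s; rewrite mem_cat.
rewrite -[(_ + _) s]/(a * f s + g s); apply: contraNT.
rewrite negb_or => /andP[sX sY].
have -> : f s = 0 by apply/eqP; apply: contraNT sX; exact: fX.
have -> : g s = 0 by apply/eqP; apply: contraNT sY; exact: gY.
by rewrite mulr0 addr0.
Qed.

Lemma finS0 : finS 0.
Proof. by exists [::] => s; rewrite eqxx. Qed.

Lemma fdot_linl g a f1 f2 : finS f1 -> finS f2 ->
  fdot (a *: f1 + f2) g = a * fdot f1 g + fdot f2 g.
Proof.
move=> [X1 F1] [X2 F2]; pose X := undup (X1 ++ X2).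
have S f : (forall s, s \notin X -> f s = 0) ->
    fdot f g = \sum_(s <- X) f s * Num.conj (g s).
  move=> H; apply: fdotE; rewrite ?undup_uniq// => s; apply: contraNT => /H ->.
  by rewrite mul0r.
have H1 s : s \notin X -> f1 s = 0.
  rewrite mem_undup mem_cat negb_or => /andP[s1 _]; apply/eqP.
  by apply: contraNT s1; exact: F1.
have H2 s : s \notin X -> f2 s = 0.
  rewrite mem_undup mem_cat negb_or => /andP[_ s1]; apply/eqP.
  by apply: contraNT s1; exact: F2.
rewrite !S//; last first.
  by move=> s sX; rewrite -[LHS]/(a * f1 s + f2 s) H1// H2// mulr0 addr0.
rewrite mulr_sumr -big_split /=; apply: eq_bigr => s _.
by rewrite -[(_ + _) s]/(a * f1 s + f2 s) mulrDl mulrA.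
Qed.

Lemma fdot_conj f g : finS f -> fdot g f = Num.conj (fdot f g).
Proof.
move=> /finSP[X uX fX].
rewrite !(@fdotE X)//.
- rewrite rmorph_sum; apply: eq_bigr => s _.
  by rewrite rmorphM /= conjCK mulrC.
- by move=> s; apply: contraNT => sX; rewrite (_ : f s = 0) ?mul0r//;
    apply/eqP; apply: contraNT sX; exact: fX.
- by move=> s; apply: contraNT => sX; rewrite (_ : f s = 0) ?conjC0 ?mulr0//;
    apply/eqP; apply: contraNT sX; exact: fX.
Qed.

Lemma fdot_ge0 f : finS f -> f != 0 -> 0 < fdot f f.
Proof.
move=> /finSP[X uX fX] f0; rewrite (@fdotE X)//; last first.
  by move=> s; rewrite mulf_eq0 negb_or => /andP[/fX].
have [s fs] : exists s, f s != 0.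
  apply: contrapT => H; case/eqP: f0; apply/funext => s; apply/eqP/negPn/negP.
  by move=> fs; apply: H; exists s.
rewrite (bigD1_seq s) ?fX//=; apply: ltr_wpDr.
  by apply: sumr_ge0 => t _; exact: mul_conjC_ge0.
by rewrite mul_conjC_gt0.
Qed.

Lemma finS_crt m f : finS f -> finS (crt par m f).
Proof.
move=> [X fX]; exists (map (inc m) X) => s; rewrite /crt.
rewrite !mulf_eq0 !negb_or => /andP[/andP[_ ps] /fX sX].
apply/mapP; exists (dec m s); rewrite ?inc_dec//.
by rewrite lt0n; apply: contraNneq ps => ->; rewrite phi0.
Qed.

Lemma finS_ann m f : finS f -> finS (ann par m f).
Proof.
move=> [X fX]; exists (map (dec m) X) => s; rewrite /ann.
rewrite !mulf_eq0 !negb_or => /andP[_ /fX sX].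
by apply/mapP; exists (inc m s); rewrite ?dec_inc.
Qed.

Lemma fdot_crt m f g : finS f -> fdot (crt par m f) g = fdot f (ann par m g).
Proof.
move=> /finSP[X uX fX].
have f0 s : s \notin X -> f s = 0.
  by move=> sX; apply/eqP; apply: contraNT sX; exact: fX.
rewrite (@fdotE X f)//; last first.
  by move=> s; apply: contraNT => /f0 ->; rewrite mul0r.
have inc_inj : injective (inc m) by apply: can_inj (dec_inc m).
rewrite (@fdotE (map (inc m) X) (crt par m f)) ?map_inj_uniq//; last first.
  move=> s; rewrite /crt !mulf_eq0 !negb_or => /andP[/andP[/andP[_ ps] /fX sX] _].
  apply/mapP; exists (dec m s); rewrite ?inc_dec//.
  by rewrite lt0n; apply: contraNneq ps => ->; rewrite phi0.
rewrite big_map; apply: eq_bigr => s _; rewrite /crt /ann.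
rewrite dec_inc inc_self eps_inc ltnn !andbF mul1r !rmorphM /= eps_conj phi_conj.
ring.
Qed.

End FockForm.

(** * Oscillators and quadratic operators *)

Local Notation ferm2 i j := (~~ halfint i && ~~ halfint j).

(** The quadratic operators and the reflections are built on these relations alone; [Fockd] is the
    model. The form is sesquilinear and positive on [fin] only, because the model consists of all
    functions on the set of states. *)
Record fock (R : realType) (d : nat) := Fock {
  fsp :> lmodType R[i];
  crt_ : int -> 'I_d -> {linear fsp -> fsp};
  ann_ : int -> 'I_d -> {linear fsp -> fsp};
  ann_annE : forall i p j q f,
    ann_ i p (ann_ j q f) = (-1) ^+ ferm2 i j *: ann_ j q (ann_ i p f);
  crt_crtE : forall i p j q f,
    crt_ i p (crt_ j q f) = (-1) ^+ ferm2 i j *: crt_ j q (crt_ i p f);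
  ann_crtE : forall i p j q f, ann_ i p (crt_ j q f) =
    (-1) ^+ ferm2 i j *: crt_ j q (ann_ i p f) + ((i == j) && (p == q))%:R *: f;
  fin : fsp -> Prop;
  fin_lin : forall a f g, fin f -> fin g -> fin (a *: f + g);
  fin0 : fin 0;
  fin_crt : forall i p f, fin f -> fin (crt_ i p f);
  fin_ann : forall i p f, fin f -> fin (ann_ i p f);
  dot_ : fsp -> fsp -> R[i];
  dot_linl : forall g a f1 f2, fin f1 -> fin f2 ->
    dot_ (a *: f1 + f2) g = a * dot_ f1 g + dot_ f2 g;
  dot_conj : forall f g, fin f -> dot_ g f = Num.conj (dot_ f g);
  dot_gt0 : forall f, fin f -> f != 0 -> 0 < dot_ f f;
  dot_crt : forall i p f g, fin f -> dot_ (crt_ i p f) g = dot_ f (ann_ i p g) }.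

Arguments crt_ {R d f} : rename.
Arguments ann_ {R d f} : rename.
Arguments fin {R d f} : rename.
Arguments dot_ {R d f} : rename.

Section Oscillators.
Variables (R : realType) (d : nat) (F : fock R d).
Local Notation C := R[i].
Implicit Types (i j k l : int) (p q : 'I_d) (f g : F).

(* Quantised matrix units are [sum_p ad i p (an j p f)]: a particle-hole
   transformation of the modes [i <= 0], with the sign of the star structure on
   the bosonic ones. *)
Definition ad i p f : F :=
  if 0 < i then crt_ i p f else (-1) ^+ halfint i *: ann_ i p f.
Definition an i p f : F := if 0 < i then ann_ i p f else crt_ i p f.

Lemma ad_is_linear i p : linear (ad i p).
Proof.
move=> a f g; rewrite /ad; case: ifP => _; first by rewrite linearP.
by rewrite linearP scalerDr !scalerA mulrC.
Qed.
Lemma an_is_linear i p : linear (an i p).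
Proof. by move=> a f g; rewrite /an; case: ifP => _; rewrite linearP. Qed.

HB.instance Definition _ i p := GRing.isLinear.Build _ _ _ _ (ad i p) (ad_is_linear i p).
HB.instance Definition _ i p := GRing.isLinear.Build _ _ _ _ (an i p) (an_is_linear i p).

Lemma sign2 (b : bool) : (-1) ^+ b * (-1) ^+ b = 1 :> C.
Proof. by rewrite -expr2 sqrr_sign. Qed.

Lemma an_an i p j q f : an i p (an j q f) = (-1) ^+ ferm2 i j *: an j q (an i p f).
Proof.
rewrite /an; case: (ltP 0 i) => ip; case: (ltP 0 j) => jp.
- exact: ann_annE.
- rewrite ann_crtE (_ : i == j = false); last by lia.
  by rewrite scale0r addr0.
- rewrite ann_crtE (_ : j == i = false); last by lia.
  by rewrite scale0r addr0 andbC scalerA sign2 scale1r.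
- exact: crt_crtE.
Qed.

Lemma ad_ad i p j q f : ad i p (ad j q f) = (-1) ^+ ferm2 i j *: ad j q (ad i p f).
Proof.
rewrite /ad; case: (ltP 0 i) => ip; case: (ltP 0 j) => jp.
- exact: crt_crtE.
- rewrite linearZ /= ann_crtE (_ : j == i = false); last by lia.
  rewrite scale0r addr0 !scalerA [~~ halfint j && _]andbC; congr (_ *: _).
  by have E := sign2 (ferm2 i j); ring: E.
- rewrite linearZ /= ann_crtE (_ : i == j = false); last by lia.
  by rewrite scale0r addr0 !scalerA mulrC.
- by rewrite !linearZ /= ann_annE !scalerA; congr (_ *: _); ring.
Qed.

(** For two modes of index at most 0 the canonical relation is read backwards. This changes the sign
    of its constant for bosons only, which the factor [(-1) ^+ halfint i] in [ad] repairs. *)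
Lemma an_ad i p j q f : an i p (ad j q f) =
  (-1) ^+ ferm2 i j *: ad j q (an i p f) + ((i == j) && (p == q))%:R *: f.
Proof.
rewrite /ad /an; case: (ltP 0 i) => ip; case: (ltP 0 j) => jp.
- exact: ann_crtE.
- rewrite linearZ /= ann_annE (_ : i == j = false); last by lia.
  by rewrite scale0r addr0 !scalerA mulrC.
- rewrite crt_crtE (_ : i == j = false); last by lia.
  by rewrite scale0r addr0.
rewrite linearZ /= ann_crtE [j == i]eq_sym [q == p]eq_sym scalerDr !scalerA.
rewrite [~~ halfint j && _]andbC.
have E := sign2 (ferm2 i j).
have [ij|ij] := eqVneq i j; last first.
  by rewrite !mulr0 !scale0r !addr0 scalerA; congr (_ *: _); ring: E.
have [<-|pq] := eqVneq p q; last first.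
  by rewrite !mulr0 !scale0r !addr0 scalerA; congr (_ *: _); ring: E.
rewrite -ij andbb in E *; rewrite scalerDr !scalerA -addrA -scalerDl.
set X := crt_ i p _.
have -> : (-1) ^+ (~~ halfint i) * ((-1) ^+ halfint i * (-1) ^+ (~~ halfint i)) =
  (-1) ^+ halfint i :> C by ring: E.
rewrite -[LHS]addr0; congr (_ + _); apply/esym.
by case: halfint => /=; rewrite !(expr0, expr1, mulr1, mul1r, mulN1r, mulrN1, subrr, addNr) ?scale0r.
Qed.

End Oscillators.

Local Notation odd2 i j := (halfint i (+) halfint j).

(** * Quantised matrix units: brackets and adjoints *)

Section Quadratic.
Variables (R : realType) (d : nat) (F : fock R d).
Local Notation C := R[i].
Implicit Types (i j k l : int) (p q : 'I_d) (f g : F).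

Definition qunit i j f : F := \sum_p ad i p (an j p f).

Lemma qunit_is_linear i j : linear (qunit i j).
Proof.
move=> a f g; rewrite /qunit scaler_sumr -big_split /=; apply: eq_bigr => p _.
by rewrite !linearP.
Qed.
HB.instance Definition _ i j := GRing.isLinear.Build _ _ _ _ (qunit i j) (qunit_is_linear i j).

Lemma an_qunit k q i j f : an k q (qunit i j f) =
  (-1) ^+ (~~ halfint k && odd2 i j) *: qunit i j (an k q f) + (k == i)%:R *: an j q f.
Proof.
rewrite /qunit linear_sum scaler_sumr /=.
have -> : (k == i)%:R *: an j q f = \sum_p ((k == i) && (q == p))%:R *: an j p f.
  rewrite (bigD1 q) //= eqxx andbT big1 ?addr0// => p /negPf pq.
  by rewrite [q == p]eq_sym pq andbF scale0r.
rewrite -big_split /=; apply: eq_bigr => p _.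
rewrite an_ad an_an linearZ /= scalerA; congr (_ *: _ + _).
by case: halfint; case: halfint; case: halfint; rewrite /= ?expr0 ?expr1 ?mulrNN ?mul1r ?mulr1.
Qed.

Lemma qunit_ad k q i j f : qunit i j (ad k q f) =
  (-1) ^+ (~~ halfint k && odd2 i j) *: ad k q (qunit i j f) + (j == k)%:R *: ad i q f.
Proof.
rewrite /qunit linear_sum scaler_sumr /=.
have -> : (j == k)%:R *: ad i q f = \sum_p ((j == k) && (p == q))%:R *: ad i p f.
  rewrite (bigD1 q) //= eqxx andbT big1 ?addr0// => p /negPf pq.
  by rewrite pq andbF scale0r.
rewrite -big_split /=; apply: eq_bigr => p _.
rewrite an_ad linearP /= ad_ad !linearZ /= scalerA; congr (_ *: _ + _).
by case: halfint; case: halfint; case: halfint; rewrite /= ?expr0 ?expr1 ?mulrNN ?mul1r ?mulr1.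
Qed.

(** No quartic terms have to be reordered: [qunit i j] acts on the two modes inside [qunit k l] as a
    superderivation, through [qunit_ad] and [an_qunit]. *)
Lemma qunit_qunit i j k l f :
  qunit i j (qunit k l f) = (-1) ^+ (odd2 i j && odd2 k l) *: qunit k l (qunit i j f)
    + (j == k)%:R *: qunit i l f
    - ((-1) ^+ (odd2 i j && odd2 k l) * (l == i)%:R) *: qunit k j f.
Proof.
rewrite {2}/qunit linear_sum [qunit k l _]/qunit [qunit i l _]/qunit [qunit k j _]/qunit !scaler_sumr.
rewrite -big_split -sumrB /=; apply: eq_bigr => q _.
rewrite qunit_ad.
set s2 := (-1) ^+ (~~ halfint l && odd2 i j) : C.
have s22 : s2 * s2 = 1 by exact: sign2.
have -> : qunit i j (an l q f) = s2 *: (an l q (qunit i j f) - (l == i)%:R *: an j q f).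
  by rewrite an_qunit addrK scalerA s22 scale1r.
rewrite !(linearZ, linearB) /= ?scalerBr !scalerA addrAC.
have E : s2 * (-1) ^+ (~~ halfint k && odd2 i j) = (-1) ^+ (odd2 i j && odd2 k l) :> C.
  by rewrite /s2; case: (halfint k); case: (halfint l); case: (_ (+) _);
    rewrite /= ?expr0 ?expr1 ?mulrNN ?mul1r ?mulr1.
by rewrite scalerDr !scalerA mulrA E.
Qed.

Lemma fin_sum I (r : seq I) (P : pred I) (G : I -> F) :
  (forall t, P t -> fin (G t)) -> fin (\sum_(i <- r | P i) G i).
Proof.
move=> H; apply: big_ind => //; first exact: fin0.
by move=> f g ff fg; rewrite -[f]scale1r; apply: fin_lin.
Qed.

Lemma finZ a f : fin f -> fin (a *: f).
Proof. by move=> ff; rewrite -[_ *: _]addr0; apply: fin_lin => //; exact: fin0. Qed.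

Lemma fin_ad i p f : fin f -> fin (ad i p f).
Proof. by rewrite /ad; case: ifP => _ ff; [|apply: finZ]; [apply: fin_crt|apply: fin_ann]. Qed.
Lemma fin_an i p f : fin f -> fin (an i p f).
Proof. by rewrite /an; case: ifP => _ ff; [apply: fin_ann|apply: fin_crt]. Qed.
Lemma fin_qunit i j f : fin f -> fin (qunit i j f).
Proof. by move=> ff; apply: fin_sum => p _; apply: fin_ad; apply: fin_an. Qed.

Lemma dot_linr g a f1 f2 : fin f1 -> fin f2 -> fin g ->
  dot_ g (a *: f1 + f2) = Num.conj a * dot_ g f1 + dot_ g f2.
Proof.
move=> F1 F2 G; rewrite dot_conj; last exact: fin_lin.
by rewrite dot_linl// rmorphD rmorphM /= -!dot_conj.
Qed.

Lemma dot0l g : dot_ 0 g = 0 :> C.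
Proof.
have := @dot_linl _ _ F g (-1) 0 0 (fin0 F) (fin0 F).
by rewrite scaler0 addr0 mulN1r addNr.
Qed.

Lemma dot0r g : fin g -> dot_ g 0 = 0 :> C.
Proof. by move=> G; rewrite dot_conj ?dot0l ?conjC0//; exact: fin0. Qed.

Lemma dot_suml I (r : seq I) (P : pred I) (G : I -> F) g :
  (forall t, P t -> fin (G t)) ->
  dot_ (\sum_(i <- r | P i) G i) g = \sum_(i <- r | P i) dot_ (G i) g.
Proof.
move=> H; elim: r => [|t r IH]; first by rewrite !big_nil dot0l.
rewrite !big_cons; case: ifP => // Pi; rewrite -IH -[G t]scale1r dot_linl ?mul1r ?scale1r//.
  exact: H.
exact: fin_sum.
Qed.

Lemma dot_sumr I (r : seq I) (P : pred I) (G : I -> F) g : fin g ->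
  (forall t, P t -> fin (G t)) ->
  dot_ g (\sum_(i <- r | P i) G i) = \sum_(i <- r | P i) dot_ g (G i).
Proof.
move=> gg H; rewrite dot_conj; last exact: fin_sum.
rewrite dot_suml// rmorph_sum; apply: eq_bigr => t Pi.
by rewrite /= -dot_conj//; exact: H.
Qed.

Lemma dotZl a f g : fin f -> dot_ (a *: f) g = a * dot_ f g.
Proof. by move=> ff; rewrite -[a *: f]addr0 dot_linl ?dot0l ?addr0//; exact: fin0. Qed.

Lemma dotZr a f g : fin f -> fin g -> dot_ f (a *: g) = Num.conj a * dot_ f g.
Proof.
by move=> ff gg; rewrite -[a *: g]addr0 dot_linr ?dot0r ?addr0//; exact: fin0.
Qed.

Lemma dot_ann i p f g : fin f -> fin g -> dot_ (ann_ i p f) g = dot_ f (crt_ i p g).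
Proof.
move=> ff gg; rewrite (dot_conj (f := g))// -(dot_crt i p f gg) -dot_conj//.
exact: fin_crt.
Qed.

Definition nh i : bool := (i <= 0) && halfint i.

Lemma conj_sign (b : bool) : Num.conj ((-1) ^+ b : C) = (-1) ^+ b.
Proof. by rewrite rmorphXn rmorphN rmorph1. Qed.

Lemma dot_ad i p f g : fin f -> fin g ->
  dot_ (ad i p f) g = (-1) ^+ nh i * dot_ f (an i p g).
Proof.
move=> ff gg; rewrite /ad /an /nh; case: (ltP 0 i) => /= _.
  by rewrite mul1r dot_crt.
by rewrite dotZl ?dot_ann//; exact: fin_ann.
Qed.

Lemma dot_an i p f g : fin f -> fin g ->
  dot_ (an i p f) g = (-1) ^+ nh i * dot_ f (ad i p g).
Proof.
move=> ff gg; rewrite (dot_conj (f := g))//.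
have -> : dot_ g (an i p f) = (-1) ^+ nh i * dot_ (ad i p g) f.
  by rewrite dot_ad// mulrA sign2 mul1r.
rewrite rmorphM /= conj_sign -dot_conj//; exact: fin_ad.
Qed.

Lemma dot_qunit i j f g : fin f -> fin g ->
  dot_ (qunit i j f) g = (-1) ^+ (nh i + nh j) * dot_ f (qunit j i g).
Proof.
move=> ff gg; rewrite dot_suml; last by move=> p _; apply/fin_ad/fin_an.
rewrite dot_sumr//; last by move=> p _; apply/fin_ad/fin_an.
rewrite mulr_sumr; apply: eq_bigr => p _.
have fa k (h : F) : fin h -> fin (an k p h) by move=> ?; apply: fin_an.
by rewrite dot_ad ?dot_an ?mulrA ?exprD //; apply: fa.
Qed.

End Quadratic.

(** * The Fock space as a highest weight module *)

Lemma big_box_widen (V : nmodType) (L L' : nat) (G : int -> V) : (L <= L')%N ->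
  (forall i, i \notin box L -> G i = 0) ->
  \sum_(i <- box L') G i = \sum_(i <- box L) G i.
Proof.
move=> LL' G0; rewrite (bigID (mem (box L))) /= [X in _ + X]big1 ?addr0//.
rewrite -big_filter; apply: perm_big; apply: uniq_perm.
- by rewrite filter_uniq// box_uniq.
- exact: box_uniq.
by move=> i; rewrite mem_filter !mem_box; lia.
Qed.

Section BoxAction.
Variables (R : realType) (d : nat) (F : fock R d).
Local Notation C := R[i].
Implicit Types (i j k l : int) (f g : F) (A B : mat R) (p q : bool).

(** The vacuum expectation value of [qunit i j]: each of the d copies of a mode of index at most 0
    contributes the sign built into [ad]. *)
Definition vac i j : C := ((i == j) && (i <= 0)%R)%:R * (-1) ^+ halfint i * d%:R.
Definition nqunit i j f : F := qunit i j f - vac i j *: f.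

Definition qsum (L : nat) A f : F :=
  \sum_(i <- box L) \sum_(j <- box L) A i j *: qunit i j f.
Definition nqsum (L : nat) A f : F :=
  \sum_(i <- box L) \sum_(j <- box L) A i j *: nqunit i j f.
Definition vacsum (L : nat) A : C := \sum_(i <- box L) A i i * vac i i.

Lemma qsum_is_linear L A : linear (qsum L A).
Proof.
move=> a f g; rewrite /qsum scaler_sumr -big_split /=; apply: eq_bigr => i _.
rewrite scaler_sumr -big_split /=; apply: eq_bigr => j _.
by rewrite linearP /= scalerDr !scalerA mulrC.
Qed.
HB.instance Definition _ L A := GRing.isLinear.Build _ _ _ _ (qsum L A) (qsum_is_linear L A).

Lemma nqsum_qsum L A f : nqsum L A f = qsum L A f - vacsum L A *: f.
Proof.
rewrite /nqsum /qsum /vacsum scaler_suml -sumrB big_seq [RHS]big_seq.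
apply: eq_bigr => i iL.
have -> : (A i i * vac i i) *: f = \sum_(j <- box L) (A i j * vac i j) *: f.
  rewrite (bigD1_seq i) ?box_uniq//= big1 ?addr0// => j ji.
  by rewrite /vac eq_sym (negPf ji) /= !mul0r mulr0 scale0r.
rewrite -sumrB; apply: eq_bigr => j _.
by rewrite /nqunit scalerBr scalerA.
Qed.

Lemma nqsum_is_linear L A : linear (nqsum L A).
Proof.
move=> a f g; rewrite !nqsum_qsum linearP /= !scalerBr !scalerDr !scalerA opprD.
by rewrite [_ * a]mulrC addrACA.
Qed.
HB.instance Definition _ L A := GRing.isLinear.Build _ _ _ _ (nqsum L A) (nqsum_is_linear L A).

Lemma nqsum_linl L a A B f : nqsum L (a *: A + B) f = a *: nqsum L A f + nqsum L B f.
Proof.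
rewrite /nqsum scaler_sumr -big_split /=; apply: eq_bigr => i _.
rewrite scaler_sumr -big_split /=; apply: eq_bigr => j _.
by rewrite -[(_ + _) i j]/(a * A i j + B i j) scalerDl scalerA.
Qed.

Definition bd (K : nat) f : Prop :=
  forall i (p : 'I_d), (K < `|i|)%N -> ann_ i p f = 0.

Lemma bdW K K' f : (K <= K')%N -> bd K f -> bd K' f.
Proof. by move=> KK' H i p ip; apply: H; apply: leq_ltn_trans ip. Qed.

Lemma bd_lin K a f g : bd K f -> bd K g -> bd K (a *: f + g).
Proof. by move=> H1 H2 i p ip; rewrite linearP /= H1// H2// scaler0 addr0. Qed.

Lemma bd0 K : bd K 0. Proof. by move=> i p _; rewrite linear0. Qed.

Lemma bdZ K a f : bd K f -> bd K (a *: f).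
Proof. by move=> H; rewrite -[_ *: _]addr0; apply: bd_lin => //; exact: bd0. Qed.

Lemma bd_sum K I (r : seq I) (P : pred I) (G : I -> F) :
  (forall t, P t -> bd K (G t)) -> bd K (\sum_(t <- r | P t) G t).
Proof.
move=> H; apply: big_ind => //; first exact: bd0.
by move=> f g ff fg; rewrite -[f]scale1r; apply: bd_lin.
Qed.

Lemma bd_crt K i (p : 'I_d) f : (`|i| <= K)%N -> bd K f -> bd K (crt_ i p f).
Proof.
move=> iK H j q jK; rewrite ann_crtE H// linear0 scaler0 add0r.
by rewrite (_ : j == i = false) ?scale0r//; lia.
Qed.

Lemma bd_ann K i (p : 'I_d) f : bd K f -> bd K (ann_ i p f).
Proof. by move=> H j q jK; rewrite ann_annE H// linear0 scaler0. Qed.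

Lemma bd_ad K i (p : 'I_d) f : (`|i| <= K)%N -> bd K f -> bd K (ad i p f).
Proof.
move=> iK H; rewrite /ad; case: ifP => _; first exact: bd_crt.
by apply: bdZ; exact: bd_ann.
Qed.

Lemma bd_an K i (p : 'I_d) f : (`|i| <= K)%N -> bd K f -> bd K (an i p f).
Proof.
by move=> iK H; rewrite /an; case: ifP => _; [exact: bd_ann|exact: bd_crt].
Qed.

Lemma bd_qunit K i j f : (`|i| <= K)%N -> (`|j| <= K)%N -> bd K f -> bd K (qunit i j f).
Proof. by move=> iK jK H; apply: bd_sum => p _; apply: bd_ad => //; apply: bd_an. Qed.

Lemma bd_nqsum K L A f : bd K f -> (K <= L)%N -> bd L (nqsum L A f).
Proof.
move=> H KL; rewrite /nqsum big_seq; apply: bd_sum => i; rewrite mem_box => iL.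
rewrite big_seq; apply: bd_sum => j; rewrite mem_box => jL; apply: bdZ.
have H' := bdW KL H; rewrite /nqunit -scaleNr addrC; apply: bd_lin => //.
exact: bd_qunit.
Qed.

(** On the positive side the annihilator kills f. On the other side only the contraction of [ann_]
    with [crt_] survives, and it equals the vacuum value that normal ordering subtracts. *)
Lemma nqunit_far K i j f : bd K f -> (K < `|i|)%N -> (K < `|j|)%N ->
  (0 < i) = (0 < j) -> nqunit i j f = 0.
Proof.
move=> H iK jK ij; rewrite /nqunit /qunit.
have [j0|j0] := boolP (0 < j).
  rewrite big1 => [|p _]; last by rewrite /an j0 H// linear0.
  rewrite /vac (_ : (i <= 0) = false) ?andbF ?mul0r ?scale0r ?subr0//.
  by rewrite leNgt ij j0.
have i0 : i <= 0 by rewrite leNgt ij.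
have E (t : 'I_d) : ad i t (an j t f) = (i == j)%:R * (-1) ^+ halfint i *: f.
  rewrite /ad /an ij (negPf j0) ann_crtE H// linear0 scaler0 add0r.
  by rewrite eqxx andbT scalerA mulrC.
under eq_bigr do rewrite E.
by rewrite sumr_const card_ord /vac i0 andbT -scaler_nat scalerA [d%:R * _]mulrC subrr.
Qed.

(** If one index of a nonzero entry leaves the box, the bandwidth puts both indices beyond K on the
    same side of 0, where [nqunit_far] applies. *)
Lemma nqsum_widen b K L L' A f : bnd b A -> bd K f -> (K + b <= L)%N ->
  (L <= L')%N -> nqsum L' A f = nqsum L A f.
Proof.
move=> bA H KL LL'.
have far i j : (i \notin box L) || (j \notin box L) -> A i j *: nqunit i j f = 0.
  rewrite !mem_box => ij.
  have [/bA ->|ijb] := ltnP b `|i - j|; first by rewrite scale0r.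
  by rewrite (nqunit_far H) ?scaler0//; lia.
rewrite /nqsum (big_box_widen LL'); last first.
  by move=> i iL; rewrite big1// => j _; rewrite far// iL.
apply: eq_bigr => i _; rewrite (big_box_widen LL')// => j jL.
by rewrite far// jL orbT.
Qed.

Lemma qunit_qsum L q B i j f : has_parity q B -> i \in box L -> j \in box L ->
  qunit i j (qsum L B f) = (-1) ^+ (odd2 i j && q) *: qsum L B (qunit i j f)
   + \sum_(l <- box L) B j l *: qunit i l f
   - (-1) ^+ (odd2 i j && q) *: \sum_(k <- box L) B k i *: qunit k j f.
Proof.
move=> Bq iL jL; rewrite /qsum linear_sum /=.
have E1 : \sum_(l <- box L) B j l *: qunit i l f =
    \sum_(k <- box L) \sum_(l <- box L) (B k l * (j == k)%:R) *: qunit i l f.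
  rewrite [RHS](bigD1_seq j) ?box_uniq//= [X in _ + X]big1 ?addr0.
    by apply: eq_bigr => l _; rewrite eqxx mulr1.
  by move=> k /negPf kj; rewrite big1// => l _; rewrite eq_sym kj mulr0 scale0r.
have E2 : \sum_(k <- box L) B k i *: qunit k j f =
    \sum_(k <- box L) \sum_(l <- box L) (B k l * (l == i)%:R) *: qunit k j f.
  apply: eq_bigr => k _.
  rewrite [RHS](bigD1_seq i) ?box_uniq//= [X in _ + X]big1 ?addr0.
    by rewrite eqxx mulr1.
  by move=> l /negPf li; rewrite li mulr0 scale0r.
rewrite E1 E2 !scaler_sumr -big_split -sumrB /=; apply: eq_bigr => k _.
rewrite linear_sum !scaler_sumr -big_split -sumrB /=; apply: eq_bigr => l _.
rewrite linearZ /= qunit_qunit scalerBr scalerDr !scalerA.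
have [->|Bkl] := eqVneq (B k l) 0.
  by rewrite !(mul0r, mulr0, scale0r, addr0, subr0).
have -> : odd2 k l = q by rewrite -(Bq _ _ Bkl) halfintD halfintN addbC.
by congr (_ *: _ + _ - _ *: _); ring.
Qed.

Lemma exchange_box3 L (G : int -> int -> int -> F) :
  \sum_(i <- box L) \sum_(j <- box L) \sum_(k <- box L) G i j k =
  \sum_(i <- box L) \sum_(k <- box L) \sum_(j <- box L) G i j k.
Proof. by apply: eq_bigr => i _; rewrite exchange_big. Qed.

(** The bracket of the truncated matrices; near the edge of the box it differs from the truncation
    of [superbracket]. *)
Definition boxbracket L (s : C) A B : mat R := fun i l =>
  \sum_(j <- box L) (A i j * B j l - s * (B i j * A j l)).

Lemma qsum_qsum L p q A B f : has_parity p A -> has_parity q B ->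
  qsum L A (qsum L B f) = (-1) ^+ (p && q) *: qsum L B (qsum L A f)
    + qsum L (boxbracket L ((-1) ^+ (p && q)) A B) f.
Proof.
move=> Ap Bq; set s := (-1) ^+ (p && q).
have -> : qsum L (boxbracket L s A B) f =
    (\sum_(i <- box L) \sum_(j <- box L) A i j *: \sum_(l <- box L) B j l *: qunit i l f)
    - s *: \sum_(i <- box L) \sum_(j <- box L) A i j *: \sum_(k <- box L) B k i *: qunit k j f.
  have -> : \sum_(i <- box L) \sum_(j <- box L) A i j *: \sum_(l <- box L) B j l *: qunit i l f
    = \sum_(i <- box L) \sum_(l <- box L) \sum_(j <- box L) (A i j * B j l) *: qunit i l f.
    rewrite -exchange_box3; do 2!apply: eq_bigr => ? _; rewrite scaler_sumr.
    by apply: eq_bigr => ? _; rewrite scalerA.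
  have -> : \sum_(i <- box L) \sum_(j <- box L) A i j *: \sum_(k <- box L) B k i *: qunit k j f
    = \sum_(i <- box L) \sum_(l <- box L) \sum_(j <- box L) (B i j * A j l) *: qunit i l f.
    transitivity (\sum_(i <- box L) \sum_(j <- box L) \sum_(k <- box L)
        (B k i * A i j) *: qunit k j f).
      do 2!apply: eq_bigr => ? _; rewrite scaler_sumr.
      by apply: eq_bigr => ? _; rewrite scalerA mulrC.
    rewrite exchange_box3 exchange_big /=; apply: eq_bigr => k _.
    by rewrite exchange_big.
  rewrite scaler_sumr -sumrB; apply: eq_bigr => i _.
  rewrite scaler_sumr -sumrB; apply: eq_bigr => l _.
  rewrite [s *: _]scaler_sumr -sumrB scaler_suml; apply: eq_bigr => j _.
  by rewrite scalerA scalerBl.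
have -> : qsum L B (qsum L A f) =
    \sum_(i <- box L) \sum_(j <- box L) A i j *: qsum L B (qunit i j f).
  rewrite [qsum L A f]/qsum linear_sum; apply: eq_bigr => i _.
  by rewrite linear_sum; apply: eq_bigr => j _; rewrite linearZ.
rewrite {1}/qsum !scaler_sumr -sumrB -big_split /= big_seq [RHS]big_seq.
apply: eq_bigr => i iL; rewrite !scaler_sumr -sumrB -big_split /=.
rewrite big_seq [RHS]big_seq; apply: eq_bigr => j jL.
rewrite (qunit_qsum _ Bq)//.
have [->|Aij] := eqVneq (A i j) 0.
  by rewrite !(scale0r, scaler0, addr0, subr0).
have -> : odd2 i j = p by rewrite -(Ap _ _ Aij) halfintD halfintN addbC.
by rewrite -/s scalerBr scalerDr !scalerA [s * _]mulrC addrA.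
Qed.

(** Here the cocycle arises. Exchanging the summation indices in the second product turns the
    indicator of indices at most 0 into the difference of indicators produced by the bracket with J,
    and the parity signs combine into the supertrace. *)
Lemma vacsum_boxbracket L b p q A B : has_parity p A -> has_parity q B ->
  bnd b A -> (b <= L)%N ->
  vacsum L (boxbracket L ((-1) ^+ (p && q)) A B) = d%:R * cocycle A B.
Proof.
move=> Ap Bq bA bL; rewrite (cocycleE _ bA bL) /vacsum /boxbracket.
set s := (-1) ^+ (p && q).
transitivity (d%:R * (\sum_(i <- box L) \sum_(k <- box L)
    (-1) ^+ halfint i * (i <= 0)%R%:R * (A i k * B k i) -
  \sum_(i <- box L) \sum_(k <- box L)
    (-1) ^+ halfint i * (i <= 0)%R%:R * (s * (B i k * A k i)))).
  rewrite -sumrB mulr_sumr; apply: eq_bigr => i _.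
  rewrite -sumrB mulr_suml mulr_sumr; apply: eq_bigr => k _.
  by rewrite /vac eqxx /=; ring.
congr (_ * _); rewrite [X in _ - X]exchange_big -sumrB /=.
apply: eq_bigr => i _; rewrite -sumrB; apply: eq_bigr => k _.
have [->|Aik] := eqVneq (A i k) 0; first by rewrite !(mul0r, mulr0) subr0.
have [->|Bki] := eqVneq (B k i) 0; first by rewrite !(mul0r, mulr0) subr0.
have E : (-1) ^+ halfint k * s = (-1) ^+ halfint i :> C.
  rewrite /s -(Ap _ _ Aik) -(Bq _ _ Bki) !halfintD !halfintN.
  by case: (halfint i); case: (halfint k); rewrite /= ?expr0 ?expr1 ?mulrNN ?mul1r ?mulr1.
rewrite -E; ring.
Qed.

Lemma vacsum_odd L A : has_parity true A -> vacsum L A = 0.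
Proof.
move=> Ap; rewrite /vacsum big1// => i _; suff -> : A i i = 0 by rewrite mul0r.
by apply/eqP; apply: contraT => /Ap; rewrite subrr.
Qed.

(** [boxbracket] and [superbracket] can disagree only near the edge of the box, where both indices
    lie beyond K. On the same side of 0 the normally ordered unit kills f; on opposite sides the
    bandwidth makes the entry zero. The bound [K + 4 * b] leaves room for both cases. *)
Lemma nqsum_nqsum K b L p q A B f : has_parity p A -> has_parity q B ->
  bnd b A -> bnd b B -> bd K f -> (K + 4 * b <= L)%N ->
  nqsum L A (nqsum L B f) - (-1) ^+ (p && q) *: nqsum L B (nqsum L A f) =
  nqsum L (superbracket A B) f + (d%:R * cocycle A B) *: f.
Proof.
move=> Ap Bq bA bB H KL; have bL : (b <= L)%N by lia.
rewrite -(vacsum_boxbracket Ap Bq bA bL).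
set s := (-1) ^+ (p && q).
(* The scalars removed by normal ordering cancel in a commutator. In an anticommutator they would
   not, but then both matrices are odd and the scalars are 0. *)
have pq : s != 1 -> p /\ q.
  by rewrite /s; case: (p) (q) => [] []; rewrite ?expr0 ?eqxx.
have kA0 : s != 1 -> vacsum L A = 0.
  by move=> /pq[p1 _]; rewrite p1 in Ap; exact: vacsum_odd.
have kB0 : s != 1 -> vacsum L B = 0.
  by move=> /pq[_ q1]; rewrite q1 in Bq; exact: vacsum_odd.
transitivity (qsum L (boxbracket L s A B) f).
  have := qsum_qsum L f Ap Bq; rewrite -/s => E.
  have [s1|s1] := eqVneq s 1.
    rewrite s1 !scale1r in E *; rewrite !nqsum_qsum !linearB !linearZ /= E.
    rewrite !scalerN !opprK !scalerA [vacsum L B * vacsum L A]mulrC !addrA.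
    by rewrite [LHS](ACl (2*(1*6)*(8*3)*(7*4)*(5*9)))/= !subrr !addr0.
  rewrite !nqsum_qsum kA0// kB0// !scale0r !subr0 E.
  by rewrite addrAC subrr add0r.
have -> : qsum L (boxbracket L s A B) f =
    nqsum L (boxbracket L s A B) f + vacsum L (boxbracket L s A B) *: f.
  by rewrite nqsum_qsum subrK.
congr (_ + _); rewrite /nqsum big_seq [RHS]big_seq; apply: eq_bigr => i iL.
rewrite big_seq [RHS]big_seq; apply: eq_bigr => l lL.
have [near|far] := leqP (minn `|i| `|l| + b) L.
  congr (_ *: _); rewrite (superbracketE _ _ Ap Bq) -/s /boxbracket sumrB -mulr_sumr.
  have [il|il] := leqP `|i| `|l|.
    by rewrite (mulEl (L := L) _ _ bA) ?(mulEl (L := L) _ _ bB)//; lia.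
  by rewrite (mulEr (L := L) _ _ bB) ?(mulEr (L := L) _ _ bA)//; lia.
have [il|il] := boolP ((0 < i) == (0 < l)).
  by rewrite (nqunit_far H) ?scaler0//; first lia; [lia|exact/eqP].
have Z X Y j : bnd b X -> bnd b Y -> X i j * Y j l = 0.
  move=> bX bY; have [/bX ->|ij] := ltnP b `|i - j|; first by rewrite mul0r.
  by rewrite bY ?mulr0//; lia.
rewrite (superbracketE _ _ Ap Bq) /boxbracket big1 => [|j _].
  by rewrite /Defs.mul !fsbig1 ?mulr0 ?subr0 => // j _; apply: Z.
by rewrite !Z// mulr0 subr0.
Qed.

End BoxAction.

(** * The contravariant action of the central extension *)

Section FockModule.
Variables (R : realType) (d : nat) (F : fock R d).
Local Notation C := R[i].
Implicit Types (i j : int) (f g : F) (x y : hatC R).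

Definition dom f : Prop := fin f /\ exists K, bd K f.

(** The box comes from a chosen mode bound of f and a chosen bandwidth of x. On [dom] such bounds
    exist, and by [nqsum_widen] every larger box gives the same vector; [actE] is the form in which
    this is used. The central element acts by d. *)
Definition act x f : F :=
  nqsum (xget 0%N [set K | bd K f] + xget 0%N [set b | bnd b (hmat x)]) (hmat x) f
  + (d%:R * hcen x) *: f.

Lemma actE x f : dom f -> exists L0, forall L, (L0 <= L)%N ->
  act x f = nqsum L (hmat x) f + (d%:R * hcen x) *: f.
Proof.
move=> [_ Kf]; have bx := hmat_banded x; rewrite /act.
set K := xget _ _; set b := xget _ _.
have HK : bd K f by exact: (xgetPex 0%N Kf).
have Hb : bnd b (hmat x) by exact: (xgetPex 0%N bx).
by exists (K + b)%N => L KL; rewrite (nqsum_widen Hb HK (leqnn _) KL).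
Qed.

Lemma dom_lin a f g : dom f -> dom g -> dom (a *: f + g).
Proof.
move=> [ff [K Kf]] [gf [K' Kg]]; split; first exact: fin_lin.
exists (maxn K K'); apply: bd_lin; first exact: bdW (leq_maxl _ _) Kf.
exact: bdW (leq_maxr _ _) Kg.
Qed.

Lemma dom0 : dom 0.
Proof. by split; [exact: fin0|exists 0%N; exact: bd0]. Qed.

Lemma fin_nqsum L A f : fin f -> fin (nqsum L A f).
Proof.
move=> ff; apply: fin_sum => i _; apply: fin_sum => j _; apply: finZ.
by rewrite /nqunit -scaleNr addrC; apply: fin_lin => //; exact: fin_qunit.
Qed.

Lemma dom_act x f : dom f -> dom (act x f).
Proof.
move=> df; have [L0 E] := actE x df; case: (df) => ff [K Kf].
rewrite (E (maxn L0 K) (leq_maxl _ _)) addrC; apply: dom_lin => //.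
split; first exact: fin_nqsum.
by exists (maxn L0 K); apply: (bd_nqsum _ Kf); exact: leq_maxr.
Qed.

Lemma act_linr x a f g : dom f -> dom g ->
  act x (a *: f + g) = a *: act x f + act x g.
Proof.
move=> df dg; have [L1 E1] := actE x df; have [L2 E2] := actE x dg.
have [L3 E3] := actE x (dom_lin a df dg); pose L := (L1 + L2 + L3)%N.
rewrite (E1 L) ?(E2 L) ?(E3 L); try by rewrite /L; lia.
by rewrite linearP /= !scalerDr !scalerA [_ * a]mulrC addrACA.
Qed.

Lemma act_linl a x y f : dom f -> act (a *: x + y) f = a *: act x f + act y f.
Proof.
move=> df; have [L1 E1] := actE x df; have [L2 E2] := actE y df.
have [L3 E3] := actE (a *: x + y) df; pose L := (L1 + L2 + L3)%N.
rewrite (E1 L) ?(E2 L) ?(E3 L); try by rewrite /L; lia.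
rewrite hmatD hmatZ nqsum_linl hcenD hcenZ mulrDr scalerDl !scalerDr !scalerA.
by rewrite mulrCA addrACA.
Qed.

Lemma act_bracket p q x y f : parity p x -> parity q y -> dom f ->
  act (bracket x y) f = act x (act y f) - (-1) ^+ (p && q) *: act y (act x f).
Proof.
move=> px py df; have [L1 E1] := actE x df; have [L2 E2] := actE y df.
have [L3 E3] := actE (bracket x y) df.
have [L4 E4] := actE x (dom_act y df); have [L5 E5] := actE y (dom_act x df).
have [bx Bx] := hmat_banded x; have [by' By] := hmat_banded y.
case: (df) => ff [K Kf]; pose b := (bx + by')%N.
pose L := (L1 + L2 + L3 + L4 + L5 + K + 4 * b)%N.
rewrite (E3 L) ?(E4 L) ?(E5 L) ?(E1 L) ?(E2 L); try by rewrite /L; lia.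
case: px py => [px cx] [py cy].
have := @nqsum_nqsum _ _ F K b L p q (hmat x) (hmat y) f px py.
have Bx' : bnd b (hmat x) by apply: bndW Bx; exact: leq_addr.
have By' : bnd b (hmat y) by apply: bndW By; exact: leq_addl.
move=> /(_ Bx' By' Kf); rewrite (_ : K + 4 * b <= L)%N; last by rewrite /L; lia.
move=> /(_ isT) /eqP; rewrite subr_eq => /eqP E.
rewrite !linearD !linearZ /= E {E}; set s := (-1) ^+ (p && q).
have sc : (s == 1) || ((hcen x == 0) && (hcen y == 0)).
  rewrite /s; case: (p) (q) cx cy => [] [] cx cy; rewrite ?expr0 ?eqxx//.
  by rewrite cx ?cy ?eqxx ?orbT.
have -> : hmat (bracket x y) = superbracket (hmat x) (hmat y) by [].
have -> : hcen (bracket x y) = cocycle (hmat x) (hmat y) by [].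
set Z := nqsum L _ f; set W := (_ * cocycle _ _) *: f; set V := nqsum L _ (nqsum _ _ f).
case/orP: sc => [/eqP->|/andP[/eqP-> /eqP->]]; last first.
  by rewrite !mulr0 !scale0r ?scaler0 !addr0 scalerN addrK.
rewrite !scale1r !scalerN !scalerA [d%:R * hcen y * _]mulrC !addrA.
by rewrite [RHS](ACl (1*2*(3*7)*(4*9)*(5*8)*(6*10)))/= !subrr !addr0.
Qed.

Lemma vac_conj i j : Num.conj (vac R d i j) = vac R d i j.
Proof. by rewrite /vac !rmorphM /= conj_sign !conjC_nat. Qed.

Lemma dot_nqunit i j f g : fin f -> fin g ->
  dot_ (nqunit i j f) g = (-1) ^+ (nh i + nh j) * dot_ f (nqunit j i g).
Proof.
move=> ff gg; have fi k l : fin (qunit k l f) by exact: fin_qunit.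
have gi k l : fin (qunit k l g) by exact: fin_qunit.
rewrite /nqunit -(scaleNr (vac R d i j)) -(scaleNr (vac R d j i)) ![_ + _ *: _]addrC dot_linl// dot_linr// dot_qunit//.
rewrite mulrDr rmorphN /= vac_conj; congr (_ + _).
have [<-|ij] := eqVneq i j.
  by rewrite addnn -mul2n exprM sqrrN !expr1n mul1r.
by rewrite /vac [j == i]eq_sym (negPf ij) /= !mul0r oppr0 !mul0r mulr0.
Qed.

Lemma neg_halfE i : neg_half i = nh i.
Proof. by rewrite /neg_half /nh; case hi : (halfint i); rewrite ?andbF ?andbT //=; move: hi; rewrite /halfint; lia. Qed.

Lemma dot_nqsum L A f g : fin f -> fin g ->
  dot_ (nqsum L A f) g = dot_ f (nqsum L (star_mat A) g).
Proof.
move=> ff gg; have fi k l : fin (nqunit k l f).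
  by rewrite /nqunit -scaleNr addrC; apply: fin_lin => //; exact: fin_qunit.
have gi k l : fin (nqunit k l g).
  by rewrite /nqunit -scaleNr addrC; apply: fin_lin => //; exact: fin_qunit.
rewrite dot_suml; last by move=> i _; apply: fin_sum => j _; exact: finZ.
rewrite dot_sumr//; last by move=> i _; apply: fin_sum => j _; exact: finZ.
under eq_bigr do (rewrite dot_suml; last by move=> j _; exact: finZ).
under [RHS]eq_bigr do (rewrite dot_sumr//; last by move=> j _; exact: finZ).
rewrite exchange_big /=; apply: eq_bigr => i _; apply: eq_bigr => j _.
rewrite dotZl// dotZr// dot_nqunit// /star_mat rmorphM /= conjCK.
by rewrite rmorphXn rmorphN rmorph1 !neg_halfE [(nh j + nh i)%N]addnC; ring.
Qed.

Lemma act_star x f g : dom f -> dom g -> dot_ (act x f) g = dot_ f (act (star x) g).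
Proof.
move=> df dg; have [L1 E1] := actE x df; have [L2 E2] := actE (star x) dg.
case: (df) (dg) => ff _ [gg _].
rewrite (E1 (L1 + L2)%N) ?(E2 (L1 + L2)%N) ?leq_addl ?leq_addr//.
rewrite ![nqsum _ _ _ + _]addrC dot_linl ?dot_linr ?dot_nqsum//; try exact: fin_nqsum.
by rewrite rmorphM /= conjC_nat /star /hcen /= conjCK.
Qed.

End FockModule.

(** * Embedding the irreducible module *)

Section Transfer.
Variables (R : realType) (M : lmodType R[i]) (rho : {bilinear hatC R -> M -> M}).
Variables (xi : {scalar hatC0 R}) (v : M).
Local Notation C := R[i].
Implicit Types (x y : hatC R).

Definition degop_mat : mat R := fun i j => if i == j then i%:~R else 0.

Lemma calC_degop : calC degop_mat.
Proof.
apply/calCP; split.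
  split; first by exists 0%N => i j ij; rewrite /degop_mat; case: eqP => // E; lia.
  by move=> i; rewrite /degop_mat [0 == i]eq_sym; case: eqP => // ->.
move=> i j; rewrite /degop_mat eqr_opp [j == i]eq_sym.
case: eqP => [->|_]; last by rewrite !mul0r mulr0.
by rewrite subrr /= expr0 mulN1r intrN mulNr opprK.
Qed.

Definition degop : hatC R := mkC 0 calC_degop.

Lemma degop_degree : degree 0 degop.
Proof.
split; last by rewrite eqxx.
move=> i j; rewrite /degop /hmat /= /degop_mat; have [->|_] := eqVneq i j; last by rewrite eqxx.
by rewrite subrr.
Qed.

Definition degop0 : hatC0 R := @HatC0 R degop (introT (asboolP _) degop_degree).

Lemma bracket_degop k x : degree k x -> k != 0 -> bracket degop x = (- k)%:~R *: x.
Proof.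
move=> [kx cx] k0; apply: hatC_eq; last first.
  rewrite hcenZ cx// mulr0; apply: cocycle0; first exact: calC_degop.
  move=> i j ij; rewrite /degop /hmat /= /degop_mat; case: eqP => // E.
  by rewrite E eqxx in ij.
apply/funext => i; apply/funext => j.
have HH : has_parity false (hmat degop).
  by apply: (has_degree_parity (k := 0)); case: degop_degree.
rewrite [LHS](superbracketE _ _ HH (has_degree_parity kx)) /= expr0 mul1r.
rewrite /Defs.mul (fsum1 (a := i)); last first.
  by move=> t ti; rewrite {1}/hmat /= /degop_mat eq_sym (negPf ti) mul0r.
rewrite (fsum1 (a := j)); last first.
  by move=> t tj; rewrite {2}/hmat /= /degop_mat (negPf tj) mulr0.
rewrite hmatZ -[RHS]/(_ * hmat x i j) {1 4}/hmat /= /degop_mat !eqxx.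
have [->|/kx <-] := eqVneq (hmat x i j) 0; first by rewrite !(mulr0, mul0r) subr0.
by rewrite opprB intrB mulrBl [_ * j%:~R]mulrC.
Qed.

Hypothesis Mmod : is_module rho.
Hypothesis Mirr : irreducible rho.
Hypothesis v0 : v != 0.
Hypothesis vwt : forall h : hatC0 R, rho h v = xi h *: v.
Hypothesis vsing : forall (k : int) x, 0 < k -> degree k x -> rho x v = 0.

Variables (N : lmodType R[i]) (D : N -> Prop) (act : hatC R -> N -> N).
Variables (B : N -> N -> C) (w : N).
Hypothesis D0 : D 0.
Hypothesis Dlin : forall a f g, D f -> D g -> D (a *: f + g).
Hypothesis Dact : forall x f, D f -> D (act x f).
Hypothesis Dw : D w.
Hypothesis act_linr : forall x a f g, D f -> D g ->
  act x (a *: f + g) = a *: act x f + act x g.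
Hypothesis act_linl : forall a x y f, D f ->
  act (a *: x + y) f = a *: act x f + act y f.
Hypothesis act_bracket : forall p q x y f, parity p x -> parity q y -> D f ->
  act (bracket x y) f = act x (act y f) - (-1) ^+ (p && q) *: act y (act x f).
Hypothesis act_star : forall x f g, D f -> D g ->
  B (act x f) g = B f (act (star x) g).
Hypothesis B_lin : forall g a f1 f2, D f1 -> D f2 ->
  B (a *: f1 + f2) g = a * B f1 g + B f2 g.
Hypothesis B_conj : forall f g, D f -> B g f = Num.conj (B f g).
Hypothesis B_gt0 : forall f, D f -> f != 0 -> 0 < B f f.
Hypothesis w0 : w != 0.
Hypothesis wwt : forall h : hatC0 R, act h w = xi h *: w.
Hypothesis wsing : forall (k : int) x, 0 < k -> degree k x -> act x w = 0.

(* The cyclic submodule of [M * N] generated by [(v, w)] is the graph of an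
   embedding of [M]. *)
Inductive lows : nat -> M -> N -> Prop :=
| lows0 : lows 0 v w
| lowsS n k x u f : (0 < k)%N -> degree (- k%:Z) x -> lows n u f ->
    lows (n + k) (rho x u) (act x f).

Inductive graph : M -> N -> Prop :=
| graph0 : graph 0 0
| graphS a n u f u' f' : lows n u f -> graph u' f' ->
    graph (a *: u + u') (a *: f + f').

Lemma lows_D n u f : lows n u f -> D f.
Proof. by elim=> // *; exact: Dact. Qed.

Lemma graph_D u f : graph u f -> D f.
Proof. by elim=> // a n u1 f1 u2 f2 L _ IH; apply: Dlin => //; exact: lows_D L. Qed.

Lemma graph_lin a u f u' f' : graph u f -> graph u' f' ->
  graph (a *: u + u') (a *: f + f').
Proof.
move=> G G'; elim: G => [|b n u1 f1 u2 f2 L _ IH]; first by rewrite !scaler0 !add0r.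
by rewrite !scalerDr !scalerA -!addrA; apply: graphS L IH.
Qed.

Lemma lows_graph n u f : lows n u f -> graph u f.
Proof.
by move=> L; rewrite -[u]scale1r -[f]scale1r -[_ *: u]addr0 -[_ *: f]addr0;
  apply: graphS L graph0.
Qed.

Lemma graphZ a u f : graph u f -> graph (a *: u) (a *: f).
Proof.
by move=> G; rewrite -[a *: u]addr0 -[a *: f]addr0; apply: graph_lin => //; exact: graph0.
Qed.

Lemma act0r x : act x 0 = 0.
Proof.
have := act_linr x (-1) D0 D0; rewrite scaler0 addr0 => {1}->.
by rewrite scaleN1r addNr.
Qed.

Lemma act0l f : D f -> act 0 f = 0.
Proof.
move=> Df; have := act_linl (-1) 0 0 Df; rewrite scaler0 addr0 => {1}->.
by rewrite scaleN1r addNr.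
Qed.

Lemma graph_act_lin x : (forall n u f, lows n u f -> graph (rho x u) (act x f)) ->
  forall u f, graph u f -> graph (rho x u) (act x f).
Proof.
move=> H u f; elim=> [|a n u1 f1 u2 f2 L G IH]; first by rewrite linear0r act0r; exact: graph0.
rewrite linearPr act_linr; [|exact: lows_D L|exact: graph_D G].
by apply: graph_lin => //; exact: H L.
Qed.

(** Both factors obey the same bracket relation, so x can be moved past the lowering operators
    simultaneously. What reaches [(v, w)] lowers it, scales both entries by the same value of [xi],
    or kills both. *)
Lemma lows_act n u f : lows n u f -> forall k x, degree k x ->
  graph (rho x u) (act x f).
Proof.
elim=> [k x kx|{}n k y {}u {}f k0 ky L IH l x lx].
  have [k0|k0|k0] := ltgtP k 0.
  - have kE : k = - `|k|%N%:Z by lia.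
    apply: (lows_graph (n := 0 + `|k|%N)); apply: lowsS; [lia|by rewrite -kE|exact: lows0].
  - by rewrite (vsing k0 kx) (wsing k0 kx); exact: graph0.
  - rewrite k0 in kx; have /asboolP px := kx.
    rewrite -[x]/(hatC0_val (HatC0 px)) vwt wwt; apply: graphZ; exact: lows_graph lows0.
have Df := lows_D L.
have [l0|l0] := ltP l 0.
  have lE : l = - `|l|%N%:Z by lia.
  apply: (lows_graph (n := (n + k) + `|l|%N)); apply: lowsS; [lia|by rewrite -lE|].
  exact: lowsS.
have -> : rho x (rho y u) = rho (bracket x y) u
    + (-1) ^+ (halfint l && halfint (- k%:Z)) *: rho y (rho x u).
  by rewrite (Mmod _ (degree_parity lx) (degree_parity ky)) subrK.
have -> : act x (act y f) = act (bracket x y) f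
    + (-1) ^+ (halfint l && halfint (- k%:Z)) *: act y (act x f).
  by rewrite (act_bracket (degree_parity lx) (degree_parity ky) Df) subrK.
rewrite ![_ _ + _ *: _]addrC; apply: graph_lin; last exact: IH (degree_bracket lx ky).
apply: graph_act_lin (IH _ _ lx) => n' u' f' L'.
exact: (lows_graph (n := n' + k)) (lowsS k0 ky L').
Qed.

Lemma graph_act x u f : graph u f -> graph (rho x u) (act x f).
Proof.
move=> G; have [b ->] := deg_part_sum x.
elim: (box b) => [|k s IH].
  by rewrite !big_nil linear0l act0l; [exact: graph0|exact: graph_D G].
rewrite !big_cons -[deg_part k x]scale1r linearPl act_linl; last exact: graph_D G.
apply: graph_lin => //; apply: graph_act_lin G => n u' f' L.
exact: lows_act L _ _ (degree_deg_part k x).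
Qed.

Lemma lows_degop n u f : lows n u f -> rho degop u = (xi degop0 + n%:R) *: u.
Proof.
elim=> [|{}n k x {}u {}f k0 kx L IH]; first by rewrite addr0 -vwt.
have kn0 : - k%:Z != 0 by lia.
have := Mmod u (degree_parity degop_degree) (degree_parity kx).
rewrite (bracket_degop kx kn0) /= scale1r linearZl_LR /= => /eqP.
rewrite eq_sym subr_eq => /eqP ->.
rewrite IH linearZr_LR /= -scalerDl opprK natrD -pmulrn.
by rewrite [in RHS]addrA [in RHS]addrC.
Qed.

(** A substitute for the projection onto the top component: the product of [degop - (xi degop0 + j)]
    over j = 1, ..., K. It annihilates the components at depth 1 to K and multiplies [v] by a
    nonzero scalar. *)
Fixpoint kill (K : nat) (u : M) : M :=
  if K is K'.+1 then rho degop (kill K' u) - (xi degop0 + K%:R) *: kill K' u else u.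

Lemma kill_lin K a u u' : kill K (a *: u + u') = a *: kill K u + kill K u'.
Proof.
elim: K => //= K ->; rewrite linearPr !scalerDr !scalerN !scalerA [_ * a]mulrC opprD.
by rewrite addrACA.
Qed.

Lemma kill_eigen K (n : nat) u : rho degop u = (xi degop0 + n%:R) *: u ->
  kill K u = (\prod_(j < K) (n%:R - j.+1%:R)) *: u.
Proof.
move=> E; elim: K => [|K IH]; first by rewrite big_ord0 scale1r.
rewrite /= IH linearZr_LR /= E !scalerA -scalerBl big_ord_recr /=; congr (_ *: _).
by rewrite -[K.+1]addn1; ring.
Qed.

Lemma kill0 K : kill K 0 = 0.
Proof. by elim: K => //= K ->; rewrite linear0r scaler0 subr0. Qed.

Lemma B0l f : B 0 f = 0.
Proof.
have := B_lin f (-1) D0 D0; rewrite scaler0 addr0 => {1}->.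
by rewrite mulN1r addNr.
Qed.

Lemma B0r f : D f -> B f 0 = 0.
Proof. by move=> Df; rewrite B_conj// B0l conjC0. Qed.

(** The same scalar a is the coefficient of [v] in u, detected by [kill], and that of [w] in f,
    detected by pairing with [w]: a lowered vector is orthogonal to [w], since the star of a
    lowering element raises and kills [w]. *)
Lemma graph_expect u f : graph u f -> exists a K0, B f w = a * B w w /\
  forall K, (K0 <= K)%N -> kill K u = (a * \prod_(j < K) (0 - j.+1%:R)) *: v.
Proof.
elim=> [|b n u1 f1 u2 f2 L G [a [K0 [Ea EK]]]].
  exists 0, 0%N; split => [|K _]; first by rewrite B0l mul0r.
  by rewrite mul0r scale0r kill0.
have [D1 D2] := (lows_D L, graph_D G).
case: n u1 f1 / L D1 => [D1|n k x u1 f1 k0 kx L D1].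
  exists (b + a), K0; split; first by rewrite B_lin// Ea mulrDl.
  move=> K KK; rewrite kill_lin EK// (kill_eigen _ (lows_degop lows0)).
  by rewrite scalerA mulrDl scalerDl.
exists a, (maxn K0 (n + k)%N); split.
  rewrite B_lin// Ea act_star//; last exact: lows_D L.
  have kx' : degree k (star x) by rewrite -[k%:Z]opprK; exact: degree_star.
  rewrite (wsing _ kx'); last by lia.
  by rewrite B0r ?mulr0 ?add0r//; exact: lows_D L.
move=> K; rewrite geq_max => /andP[KK Kn]; rewrite kill_lin EK//.
have /lows_degop E := lowsS k0 kx L.
rewrite (kill_eigen _ E); suff -> : \prod_(j < K) ((n + k)%:R - j.+1%:R) = 0 :> C.
  by rewrite scale0r scaler0 add0r.
have jK : ((n + k).-1 < K)%N by lia.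
by rewrite (bigD1 (Ordinal jK)) //= prednK ?subrr ?mul0r//; lia.
Qed.

Lemma prod_fact_neq0 K : \prod_(j < K) (0 - j.+1%:R) != 0 :> C.
Proof. by apply/prodf_neq0 => j _; rewrite sub0r oppr_eq0 pnatr_eq0. Qed.

Lemma graph_0w f : graph 0 f -> B f w = 0.
Proof.
move=> /graph_expect[a [K [-> /(_ K (leqnn K))]]]; rewrite kill0 => /esym/eqP.
rewrite scaler_eq0 (negPf v0) orbF mulf_eq0 (negPf (prod_fact_neq0 K)) orbF.
by move=> /eqP ->; rewrite mul0r.
Qed.

Lemma graph_0_lows n u' f' : lows n u' f' -> forall f, graph 0 f -> B f f' = 0.
Proof.
elim=> [f|{}n k x {}u' {}f' k0 kx L IH f G]; first exact: graph_0w.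
rewrite -[x]starK -act_star; [|exact: graph_D G|exact: lows_D L].
by apply: IH; rewrite -(linear0r rho (star x)); exact: graph_act.
Qed.

(** The vectors paired with 0 form a submodule orthogonal to [w]; by contravariance each is
    orthogonal to the whole cyclic module, to which it belongs itself. *)
Lemma graph_0_fun f : graph 0 f -> f = 0.
Proof.
move=> G; have Df := graph_D G.
suff H u' f' : graph u' f' -> B f f' = 0.
  apply/eqP; apply: contraT => f0; have := B_gt0 Df f0.
  by rewrite (H _ _ G) ltxx.
elim=> [|a n u1 f1 u2 f2 L G' IH]; first exact: B0r.
have [D1 D2] := (lows_D L, graph_D G').
rewrite B_conj; last exact: Dlin.
rewrite B_lin// rmorphD rmorphM /= -!B_conj// IH.
by rewrite (graph_0_lows L G) mulr0 addr0.
Qed.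

Lemma graph_inj u f f' : graph u f -> graph u f' -> f = f'.
Proof.
move=> G G'; apply/eqP; rewrite -subr_eq0; apply/eqP; apply: graph_0_fun.
by have := graph_lin (-1) G' G; rewrite !scaleN1r addNr [- f' + f]addrC.
Qed.

Lemma graph_total u : exists f, graph u f.
Proof.
have [_ irr] := Mirr; pose S : set M := [set u | exists f, graph u f].
have : S = [set 0] \/ S = setT.
  apply: irr; first by exists 0; exact: graph0.
    by move=> a u1 u2 [f1 G1] [f2 G2]; exists (a *: f1 + f2); exact: graph_lin.
  by move=> x u1 [f1 G1]; exists (act x f1); exact: graph_act.
have Sv : S v by exists w; exact: lows_graph lows0.
case=> E; last by have : S u by rewrite E.
by move: Sv v0; rewrite E => /= ->; rewrite eqxx.
Qed.

Lemma graph_ker u : graph u 0 -> u = 0.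
Proof.
have [_ irr] := Mirr; pose S : set M := [set u | graph u 0].
have : S = [set 0] \/ S = setT.
  apply: irr; first exact: graph0.
    by move=> a u1 u2 G1 G2; have := graph_lin a G1 G2; rewrite scaler0 addr0.
  by move=> x u1 G1; have := graph_act x G1; rewrite act0r.
case=> E; first by move=> G; have : S u by []; rewrite E.
have Sv : S v by rewrite E.
have G := lows_graph lows0; case/eqP: w0; exact: graph_inj G Sv.
Qed.

Theorem unitary_transfer : unitarizable rho.
Proof.
(* The embedding whose graph is [graph]; the default 0 is never taken, by [graph_total]. The form on
   M is pulled back along it. *)
pose T u : N := xget 0 [set f | graph u f].
have GT u : graph u (T u) by exact: (xgetPex 0 (graph_total u)).
have Tlin a u u' : T (a *: u + u') = a *: T u + T u'.
  exact: graph_inj (GT _) (graph_lin a (GT u) (GT u')).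
have Tact x u : T (rho x u) = act x (T u).
  exact: graph_inj (GT _) (graph_act x (GT u)).
have DT u : D (T u) by exact: graph_D (GT u).
have T0 u : u != 0 -> T u != 0.
  by apply: contraNneq => E; apply/eqP/graph_ker; rewrite -E.
have T00 : T 0 = 0 by apply: graph_0_fun; exact: GT.
pose bf u u' := B (T u) (T u').
have bfl a u u' z : bf (a *: u + u') z = a * bf u z + bf u' z.
  by rewrite /bf Tlin B_lin.
have bfc u u' : bf u u' = Num.conj (bf u' u) by exact: B_conj.
have bfr a u u' z : bf z (a *: u + u') = Num.conj a * bf z u + bf z u'.
  by rewrite bfc bfl rmorphD rmorphM /= -!bfc.
have p1 u' : zmod_morphism (bf ^~ u').
  by move=> u1 u2; rewrite addrC -scaleN1r bfl mulN1r addrC.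
have p2 u : zmod_morphism (bf u).
  by move=> u1 u2; rewrite addrC -scaleN1r bfr rmorphN rmorph1 mulN1r addrC.
have p3 u' : scalable_for *%R (bf ^~ u').
  by move=> a u; rewrite -[a *: u]addr0 bfl /bf T00 B0l addr0.
have p4 u : scalable_for (Num.conj \; *%R) (bf u).
  by move=> a u'; rewrite -[a *: u']addr0 bfr /bf T00 B0r// addr0.
have p5 u u' : bf u u' = (-1) ^+ false * Num.conj (bf u' u).
  by rewrite expr0 mul1r.
have p6 u : u != 0 -> 0 < bf u u by move=> u0; apply: B_gt0 => //; exact: T0.
pose m1 := isBilinear.Build R[i] M M R[i] *%R (Num.conj \; *%R) bf p1 p2 p3 p4.
pose m2 := isHermitianSesquilinear.Build R[i] M false Num.conj bf p5.
pose m3 := isDotProduct.Build R[i] M bf p6.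
pose f : {dot M for Num.conj} := HB.pack bf m1 m2 m3.
exists f => x u u'; rewrite /f /= /bf !Tact; exact: act_star.
Qed.

End Transfer.

(** * Odd reflections *)

Section OddReflections.
Variables (R : realType) (d : nat) (F : fock R d).
Local Notation C := R[i].
Implicit Types (f g u : F) (a l n : nat).

(** In doubled indices, boson a sits at a + 1/2 and fermion l at l + 1, both counted from 0. Thus
    boson a precedes fermion l in the natural order exactly when a <= l. *)
Definition bos a : int := a.*2.+1.
Definition fer l : int := l.*2.+2.

Lemma bos_half a : halfint (bos a). Proof. by rewrite /halfint /bos; lia. Qed.
Lemma fer_half l : halfint (fer l) = false. Proof. by rewrite /halfint /fer; lia. Qed.
Lemma fer_bos a l : (fer a == bos l) = false. Proof. by rewrite /bos /fer; lia. Qed.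
Lemma bos_eq a l : (bos a == bos l) = (a == l). Proof. by rewrite /bos; lia. Qed.
Lemma fer_eq a l : (fer a == fer l) = (a == l). Proof. by rewrite /fer; lia. Qed.

Lemma qunit_ann0 (i j : int) f : 0 < j -> (forall p, ann_ j p f = 0) -> qunit i j f = 0.
Proof. by move=> j0 H; rewrite /qunit big1// => p _; rewrite /an j0 H linear0. Qed.

Lemma ann_qunit0 (i j k : int) p f : 0 < j -> 0 < k -> i != j ->
  (forall q, ann_ i q f = 0) -> ann_ i p (qunit j k f) = 0.
Proof.
move=> j0 k0 ij H; rewrite /qunit linear_sum big1// => q _.
rewrite /ad /an j0 k0 ann_crtE (negPf ij) scale0r addr0 ann_annE H.
by rewrite !linear0.
Qed.

Lemma dom_qunit i j f : dom f -> dom (qunit i j f).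
Proof.
move=> [ff [K Kf]]; split; first exact: fin_qunit.
exists (K + `|i| + `|j|)%N; apply: bd_qunit; [lia|lia|].
by apply: bdW Kf; lia.
Qed.

Lemma sum_ltn n m : (\sum_(a < n) (a < m))%N = minn n m.
Proof. by elim: n => [|n IH]; rewrite ?big_ord0 ?min0n// big_ord_recr /= IH; lia. Qed.

Section Reflect.
Variables (n : nat) (col : nat -> nat).
Implicit Types S : rel nat.

(* [S a l] means that boson [a] precedes fermion [l] in the current order of the
   positive modes. *)
Definition nbos S a : nat := (\sum_(l < n | S a l) (a < col l))%N.
Definition nfer S l : nat := (col l - \sum_(a < n | S a l) (a < col l))%N.

(** Odd reflections preserve the even positive roots, so [sing_bb] and [sing_ff] do not mention S;
    only the direction of the odd root vectors changes. *)
Record singular S u : Prop := Singular {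
  sing_dom : dom u;
  sing_neq0 : u != 0;
  sing_ann : forall (i : int) p, i <= 0 \/ n.*2%:Z < i -> ann_ i p u = 0;
  sing_bb : forall a a', (a < a')%N -> qunit (bos a) (bos a') u = 0;
  sing_ff : forall l l', (l < l')%N -> qunit (fer l) (fer l') u = 0;
  sing_bf : forall a l, (a < n)%N -> (l < n)%N -> S a l -> qunit (bos a) (fer l) u = 0;
  sing_fb : forall a l, (a < n)%N -> (l < n)%N -> ~~ S a l -> qunit (fer l) (bos a) u = 0;
  sing_b : forall a, (a < n)%N -> qunit (bos a) (bos a) u = (nbos S a)%:R *: u;
  sing_f : forall l, (l < n)%N -> qunit (fer l) (fer l) u = (nfer S l)%:R *: u }.

Definition add_pair S a0 l0 : rel nat := fun a l => S a l || ((a == a0) && (l == l0)).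

Hypothesis col_mono : forall l l', (l <= l')%N -> (col l' <= col l)%N.

Lemma nbos_add S a0 l0 a : (l0 < n)%N -> ~~ S a0 l0 ->
  nbos (add_pair S a0 l0) a = (nbos S a + ((a == a0) && (a0 < col l0)))%N.
Proof.
move=> ln nS; rewrite /nbos /add_pair; have [->|aa] := eqVneq a a0; last first.
  by rewrite addn0; apply: eq_bigl => l; rewrite /= orbF.
rewrite (bigD1 (Ordinal ln)) /= ?eqxx ?orbT//= addnC; congr (_ + _)%N.
apply: eq_bigl => l; rewrite -val_eqE /=; have [->|] := eqVneq (l : nat) l0; rewrite ?andbF ?orbF ?andbT//.
by rewrite (negPf nS).
Qed.

Lemma nfer_sum_add S a0 l0 l : (a0 < n)%N -> ~~ S a0 l0 ->
  (\sum_(a < n | add_pair S a0 l0 a l) (a < col l) =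
   \sum_(a < n | S a l) (a < col l) + ((l == l0) && (a0 < col l0)))%N.
Proof.
move=> ln nS; rewrite /add_pair; have [->|aa] := eqVneq l l0; last first.
  by rewrite addn0; apply: eq_bigl => a; rewrite /= andbF orbF.
rewrite (bigD1 (Ordinal ln)) /= ?eqxx ?orbT//= addnC; congr (_ + _)%N.
apply: eq_bigl => a; rewrite -val_eqE /=; have [->|] := eqVneq (a : nat) a0; rewrite ?andbF ?orbF ?andbT//.
by rewrite (negPf nS).
Qed.

(** The conditions on S say that boson a0 comes directly after fermion l0, so that the odd root
    joining them is simple. By unitarity, either its two occupation numbers vanish and u is already
    singular for the new order, or the odd root vector sends u to a nonzero singular vector. *)
Lemma odd_reflection S a0 l0 u : (a0 < n)%N -> (l0 < n)%N ->
  (forall a, (a < n)%N -> S a l0 = (a < a0)%N) ->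
  (forall l, (l < n)%N -> S a0 l = (l0 < l)%N) ->
  singular S u -> exists u', singular (add_pair S a0 l0) u'.
Proof.
move=> an ln Sa Sl sg; set S' := add_pair S a0 l0.
have nS : ~~ S a0 l0 by rewrite Sa// ltnn.
have fb0 : qunit (fer l0) (bos a0) u = 0 by apply: (sing_fb sg).
have sumS : (\sum_(a < n | S a l0) (a < col l0) = minn a0 (col l0))%N.
  rewrite big_mkcond /= (eq_bigr (fun a : 'I_n => (a < minn a0 (col l0))%N : nat)).
    by rewrite sum_ltn; lia.
  by move=> a _; rewrite Sa// ltn_min; case: ltnP.
have nb' := nbos_add (S := S) _ ln nS; have nf' := nfer_sum_add (S := S) _ an nS.
have S'b a l : (a < n)%N -> (l < n)%N -> S a l -> S' a l by rewrite /S'/add_pair => _ _ ->.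
have S'f a l : ~~ S' a l -> ~~ S a l by rewrite /S'/add_pair negb_or => /andP[].
have NNE i j : qunit i j (qunit (bos a0) (fer l0) u) =
    (-1) ^+ (halfint i (+) halfint j) *: qunit (bos a0) (fer l0) (qunit i j u)
    + (j == bos a0)%:R *: qunit i (fer l0) u
    - ((-1) ^+ (halfint i (+) halfint j) * (fer l0 == i)%:R) *: qunit (bos a0) j u.
  by rewrite qunit_qunit bos_half fer_half /= andbT.
(* If [col l0 <= a0], fermion l0 has given all its quanta to the bosons below a0, and boson a0 has
   received none, since [col] is non-increasing. Both weights are then 0. *)
have [ac|ac] := ltnP a0 (col l0); last first.
  have nf0 : nfer S l0 = 0%N by rewrite /nfer sumS; lia.
  have nb0 : nbos S a0 = 0%N.
    rewrite /nbos big1// => l; rewrite Sl// => ll.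
    by have := col_mono (ltnW ll); lia.
  have E0 : qunit (bos a0) (fer l0) u = 0.
    have fu := (sing_dom sg).1; apply/eqP; apply: contraT => X0.
    have := dot_gt0 (fin_qunit (bos a0) (fer l0) fu) X0.
    rewrite dot_qunit//; last exact: fin_qunit.
    rewrite NNE fb0 linear0 (sing_f sg)// (sing_b sg)// nf0 nb0 !scale0r !scaler0.
    by rewrite subr0 addr0 dot0r// mulr0 ltxx.
  exists u; case: (sg) => s1 s2 s3 s4 s5 s6 s7 s8 s9; split=> //.
  - move=> a l al ll; rewrite /S'/add_pair => /orP[|/andP[/eqP-> /eqP->]//].
    exact: s6.
  - by move=> a l al ll /S'f; exact: s7.
  - by move=> a al; rewrite s8// nb' ltnNge ac andbF addn0.
  - by move=> l ll; rewrite s9// /nfer nf' (ltnNge a0) ac andbF addn0.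
have nfE : nfer S l0 = (col l0 - a0)%N by rewrite /nfer sumS; lia.
exists (qunit (bos a0) (fer l0) u); case: (sg) => s1 s2 s3 s4 s5 s6 s7 s8 s9; split.
- exact: dom_qunit.
(* The opposite odd root vector brings the new vector back to the sum of the two occupation numbers
   times u, and the fermionic one is [col l0 - a0 > 0]. *)
- apply: contraNneq s2 => E.
  have := NNE (fer l0) (bos a0); rewrite E !linear0 fb0 linear0 !eqxx bos_half fer_half.
  rewrite scaler0 add0r scale1r /= expr1 mulr1 scaleN1r opprK s9// s8// -scalerDl -natrD.
  move=> /esym/eqP; rewrite scaler_eq0 pnatr_eq0 nfE => /orP[|//]; lia.
- move=> i p ip; apply: ann_qunit0 => //; rewrite ?/bos ?/fer; [|by move=> q; exact: s3].
  by case: ip; lia.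
- move=> a a' aa; rewrite NNE s4// linear0 scaler0 add0r bos_eq fer_bos mulr0 scale0r subr0.
  have [E|_] := eqVneq a' a0; last by rewrite scale0r.
  have al : (a < n)%N by lia.
  by rewrite s6 ?scaler0// Sa//; lia.
- move=> l l' ll; rewrite NNE s5// linear0 scaler0 add0r fer_bos scale0r add0r fer_eq.
  have [E|_] := eqVneq l0 l; last by rewrite mulr0 scale0r oppr0.
  have [l'n|l'n] := ltnP l' n.
    by rewrite s6 ?scaler0 ?oppr0// Sl//; lia.
  rewrite qunit_ann0 ?scaler0 ?oppr0 ?/fer; [by []|lia|].
  by move=> p; apply: s3; right; lia.
- move=> a l al ll; rewrite /S'/add_pair => H; rewrite NNE fer_bos fer_half bos_half /=.
  have [Sal|nSal] := boolP (S a l).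
    rewrite s6// linear0 scaler0 add0r scale0r add0r.
    by rewrite /fer /bos (_ : (_ == _) = false) ?mulr0 ?scale0r ?oppr0//; lia.
  move: H; rewrite (negPf nSal) /= => /andP[/eqP-> /eqP->].
  rewrite fer_bos mulr0 !scale0r subr0 addr0 expr1 scaleN1r.
  (* An odd root vector anticommutes with itself, so its square is 0. *)
  have := NNE (bos a0) (fer l0); rewrite fer_bos fer_half bos_half mulr0 !scale0r subr0 addr0 expr1 scaleN1r.
  move=> E; have : (qunit (bos a0) (fer l0) (qunit (bos a0) (fer l0) u)) *+ 2 = 0.
    by rewrite mulr2n {1}E addNr.
  by move=> /eqP; rewrite -scaler_nat scaler_eq0 pnatr_eq0 /= => /eqP ->; rewrite oppr0.
- move=> a l al ll nSal; rewrite NNE s7 ?(S'f _ _ nSal)// linear0 scaler0 add0r.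
  have nSal' := S'f _ _ nSal; rewrite bos_eq fer_eq.
  have ne : ~~ ((a == a0) && (l == l0)).
    by move: nSal; rewrite /S'/add_pair negb_or => /andP[].
  have -> : (a == a0)%:R *: qunit (fer l) (fer l0) u = 0.
    have [E|_] := eqVneq a a0; last by rewrite scale0r.
    rewrite E eqxx /= in ne; rewrite E Sl// -leqNgt in nSal'.
    by rewrite s5 ?scaler0//; lia.
  rewrite add0r; have [E|_] := eqVneq l0 l; last by rewrite mulr0 scale0r oppr0.
  rewrite -E eqxx andbT /= in ne; rewrite -E Sa// -leqNgt in nSal'.
  by rewrite s4 ?scaler0 ?oppr0//; lia.
- move=> a al; rewrite NNE s8// nb' fer_bos mulr0 scale0r subr0 bos_eq ac andbT.
  rewrite addbb expr0 scale1r linearZ /= natrD scalerDl; congr (_ + _).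
  by have [->|] := eqVneq a a0; rewrite ?scale0r.
- move=> l ll; rewrite NNE s9// /nfer nf' ac andbT fer_bos scale0r addr0 addbb expr0 scale1r.
  rewrite linearZ /= mul1r fer_eq eq_sym; have [->|_] := eqVneq l l0; last first.
    by rewrite scale0r subr0 addn0.
  rewrite -scalerBl sumS; congr (_ *: _); rewrite -natrB; last by lia.
  by congr (_%:R); lia.
Qed.

Lemma singular_ext S1 S2 u : (forall a l, (a < n)%N -> (l < n)%N -> S1 a l = S2 a l) ->
  singular S1 u -> singular S2 u.
Proof.
move=> E [s1 s2 s3 s4 s5 s6 s7 s8 s9]; split=> //.
- by move=> a l al ll; rewrite -E//; exact: s6.
- by move=> a l al ll; rewrite -E//; exact: s7.
- by move=> a al; rewrite s8//; congr (_%:R *: _); apply: eq_bigl => l; rewrite E.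
- move=> l ll; rewrite s9//; congr ((_ - _)%:R *: _).
  by apply: eq_bigl => a; rewrite E.
Qed.

(** Bosons are moved in increasing order, and boson a0 passes the fermions n - 1, n - 2, ..., a0 in
    turn, so the pair exchanged is always adjacent. At this stage the bosons below a0 are in place
    and boson a0 has passed k fermions. *)
Definition stage a0 k : rel nat := fun a l =>
  ((a < a0) && (a <= l))%N || ((a == a0) && (n - k <= l)%N).

Lemma all_reflections u : singular (fun _ _ => false) u ->
  exists u', singular (fun a l => (a <= l)%N) u'.
Proof.
move=> s0.
suff H a0 : (a0 <= n)%N -> exists u', singular (stage a0 0) u'.
  have [u' su'] := H n (leqnn n); exists u'; apply: singular_ext su' => a l al ll.
  by rewrite /stage; lia.
elim: a0 => [_|a0 IH a0n].
  by exists u; apply: singular_ext s0 => a l al ll; rewrite /stage; lia.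
have {IH} [u0 su0] := IH (ltnW a0n).
suff H k : (k <= n - a0)%N -> exists u', singular (stage a0 k) u'.
  have [u' su'] := H _ (leqnn _); exists u'; apply: singular_ext su' => a l al ll.
  by rewrite /stage; lia.
elim: k => [_|k IH kn]; first by exists u0.
have [u1 su1] := IH (ltnW kn).
have [||||u2 su2] := @odd_reflection (stage a0 k) a0 (n - k.+1) u1 _ _ _ _ su1.
- by [].
- by lia.
- by move=> a al; rewrite /stage; lia.
- by move=> l ll; rewrite /stage; lia.
exists u2; apply: singular_ext su2 => a l al ll; rewrite /add_pair /stage; lia.
Qed.

End Reflect.
End OddReflections.

(** * The vector of a partition *)

Section ConcreteFock.
Variables (R : realType) (d : nat).
Local Notation C := R[i].
Local Notation F := ((nat -> nat) -> C).
Implicit Types (i j k l : int) (p q : 'I_d).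

Definition mode i p : nat := pickle (i, p).
Definition fermionic (n : nat) : bool :=
  if (unpickle n : option (int * 'I_d)) is Some t then ~~ halfint t.1 else false.

Lemma mode_eq i p j q : (mode i p == mode j q) = (i == j) && (p == q).
Proof. by rewrite (inj_eq (pcan_inj pickleK)). Qed.

Lemma fermionic_mode i p : fermionic (mode i p) = ~~ halfint i.
Proof. by rewrite /fermionic /mode pickleK. Qed.

Definition crtm i p : {linear F -> F} := crt fermionic (mode i p).
Definition annm i p : {linear F -> F} := ann fermionic (mode i p).

Lemma annm_annm i p j q f :
  annm i p (annm j q f) = (-1) ^+ ferm2 i j *: annm j q (annm i p f).
Proof. by have := ann_ann fermionic (mode i p) (mode j q) f; rewrite !fermionic_mode. Qed.

Lemma crtm_crtm i p j q f :
  crtm i p (crtm j q f) = (-1) ^+ ferm2 i j *: crtm j q (crtm i p f).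
Proof. by have := crt_crt fermionic (mode i p) (mode j q) f; rewrite !fermionic_mode. Qed.

Lemma annm_crtm i p j q f : annm i p (crtm j q f) =
  (-1) ^+ ferm2 i j *: crtm j q (annm i p f) + ((i == j) && (p == q))%:R *: f.
Proof.
by have := ann_crt fermionic (mode i p) (mode j q) f; rewrite !fermionic_mode mode_eq.
Qed.

Definition Fockd : fock R d :=
  @Fock R d F crtm annm annm_annm crtm_crtm annm_crtm (@finS R) (@finS_lin R) (finS0 R)
   (fun i p f => @finS_crt R fermionic (mode i p) f)
   (fun i p f => @finS_ann R fermionic (mode i p) f)
   (@fdot R) (@fdot_linl R) (@fdot_conj R) (@fdot_ge0 R)
   (fun i p f g => @fdot_crt R fermionic (mode i p) f g).

Variable occ : int -> 'I_d -> bool.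
Hypothesis occ_ferm : forall i p, occ i p -> ~~ halfint i.

Definition occ_state (n : nat) : nat :=
  if (unpickle n : option (int * 'I_d)) is Some t then occ t.1 t.2 : nat else 0%N.

Definition basis_vec : Fockd := (fun s => (s == occ_state)%:R) : F.

Lemma occ_state_mode i p : occ_state (mode i p) = occ i p.
Proof. by rewrite /occ_state /mode pickleK. Qed.

Lemma basis_vec_neq0 : basis_vec != 0.
Proof.
apply/eqP => /(congr1 (fun f : F => f occ_state)); rewrite /basis_vec eqxx => /eqP.
by rewrite -[X in _ == X]/(0 : C) oner_eq0.
Qed.

Lemma basis_vec_fin : fin basis_vec.
Proof.
exists [:: occ_state] => s; rewrite /basis_vec inE.
by have [//|_] := eqVneq s occ_state; rewrite mulr0n eqxx.
Qed.

Lemma ann_basis i p : ~~ occ i p -> ann_ i p basis_vec = 0.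
Proof.
move=> nocc; apply/funext => s; rewrite -[LHS]/(ann fermionic (mode i p) _ s) /ann.
rewrite /basis_vec; case: eqP => [E|_]; last by rewrite mulr0.
have := congr1 (fun t => t (mode i p)) E.
by rewrite /= inc_self occ_state_mode (negPf nocc).
Qed.

Lemma crt_basis i p : occ i p -> crt_ i p basis_vec = 0.
Proof.
move=> io; apply/funext => s; rewrite -[LHS]/(crt fermionic (mode i p) _ s) /crt.
rewrite /basis_vec; case: eqP => [E|_]; last by rewrite mulr0.
have := congr1 (fun t => t (mode i p)) E.
rewrite /= dec_self occ_state_mode io /phi fermionic_mode (occ_ferm io).
(* The equality forces occupation 2 at this mode, where the fermionic [phi] vanishes. *)
by case: (s _) => [|[|[|m]]]//= _; rewrite mulr0 mul0r.
Qed.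

Lemma crt_ann_basis i p : occ i p -> crt_ i p (ann_ i p basis_vec) = basis_vec.
Proof.
move=> io; have := @ann_crtE _ _ Fockd i p i p basis_vec.
rewrite crt_basis// linear0 !eqxx andbb (occ_ferm io) /= expr1 scaleN1r scale1r.
by move=> /eqP; rewrite eq_sym addrC subr_eq0 => /eqP <-.
Qed.

End ConcreteFock.

(** * The fermionic state filled by the columns of a diagram *)

Section HookVector.
Variables (R : realType) (d : nat) (lam : 'I_d -> nat) (n : nat).
Hypothesis lam_n : forall p, (lam p <= n)%N.
Local Notation F := (Fockd R d).

Definition column (l : nat) : nat := #|[pred p | l < lam p]%N|.

Lemma column_mono l l' : (l <= l')%N -> (column l' <= column l)%N.
Proof.
by move=> ll; apply: fintype.subset_leq_card; apply/fintype.subsetP => p; rewrite !inE; apply: leq_ltn_trans.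
Qed.

Definition tocc (i : int) (p : 'I_d) : bool :=
  [&& 0 < i, ~~ halfint i & (`|i|./2 <= lam p)%N].

Lemma tocc_fer l p : tocc (fer l) p = (l < lam p)%N.
Proof. by rewrite /tocc fer_half /fer /= doubleK. Qed.

Lemma tocc_bos a p : tocc (bos a) p = false.
Proof. by rewrite /tocc bos_half andbF. Qed.

Lemma tocc_ferm i p : tocc i p -> ~~ halfint i.
Proof. by case/and3P. Qed.

Lemma hook_start : @singular R d F n column (fun _ _ => false) (basis_vec R tocc).
Proof.
set v := basis_vec _ _.
have ab a p : ann_ (bos a) p v = 0 by apply: ann_basis; rewrite tocc_bos.
have af (i : int) p : i <= 0 \/ n.*2%:Z < i -> ann_ i p v = 0.
  move=> ip; apply: ann_basis; apply/negP => /and3P[i0 ih il].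
  by have := lam_n p; move: ih; rewrite /halfint; lia.
split=> //.
- split; first exact: basis_vec_fin.
  by exists n.*2 => i p ip; have [i0|i0] := leP i 0; apply: af; [left|right; lia].
- exact: basis_vec_neq0.
- by move=> a a' _; apply: qunit_ann0 => // p; exact: ab.
- move=> l l' ll; rewrite /qunit big1// => p _; rewrite /an /ad /=.
  (* Pauli exclusion: a copy that contains fermion l' also contains l < l', so the quantum cannot be
     moved there. *)
  have [lp|lp] := boolP (l' < lam p)%N; last by rewrite ann_basis ?linear0// tocc_fer.
  have := @ann_crtE _ _ F (fer l') p (fer l) p v.
  rewrite crt_basis ?tocc_fer; [|exact: tocc_ferm|exact: ltn_trans lp].
  rewrite linear0 !fer_half fer_eq (gtn_eqF ll) scale0r addr0 expr1 scaleN1r.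
  by move=> /esym/eqP; rewrite oppr_eq0 => /eqP.
- by move=> a l _ _ _; apply: qunit_ann0 => // p; exact: ab.
- move=> a an; rewrite /nbos big_pred0_eq scale0r.
  by apply: qunit_ann0 => // p; exact: ab.
- move=> l ln; rewrite /nfer big_pred0_eq subn0 /qunit.
  rewrite (eq_bigr (fun p => (l < lam p)%N%:R *: v)).
    rewrite -scaler_suml -natr_sum; congr (_%:R *: _).
    by rewrite /column -sum1_card [RHS]big_mkcond; apply: eq_bigr => p _; rewrite inE; case: ltnP.
  move=> p _; rewrite /an /ad /=.
  have [lp|lp] := ltnP l (lam p).
    by rewrite scale1r crt_ann_basis ?tocc_fer//; exact: tocc_ferm.
  by rewrite ann_basis ?linear0 ?scale0r// tocc_fer -leqNgt.
Qed.

End HookVector.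

(** * The weight of a singular vector in the natural order *)

Section HighestWeight.
Variables (R : realType) (d : nat) (F : fock R d) (n : nat) (col : nat -> nat) (w : F).
Local Notation C := R[i].
Hypothesis sw : singular n col (fun a l => a <= l)%N w.

Lemma int_mode_ind (P : int -> Prop) :
  (forall a, P (bos a)) -> (forall l, P (fer l)) -> forall i : int, 0 < i -> P i.
Proof.
move=> Pb Pf [[|m]|//] // _; have [om|om] := boolP (odd m).
  have -> : m.+1%:Z = fer m./2 by rewrite /fer; lia.
  exact: Pf.
have -> : m.+1%:Z = bos m./2 by rewrite /bos; lia.
exact: Pb.
Qed.

Lemma singular_qunit (i j : int) : i < j -> qunit i j w = 0.
Proof.
move=> ij; have [j0|j0] := leP j 0.
  rewrite /qunit big1// => p _; rewrite /ad /an !ltNge j0 (ltW (lt_le_trans ij j0)) /=.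
  rewrite ann_crtE (lt_eqF ij) scale0r addr0 (sing_ann sw) ?linear0 ?scaler0//.
  by left; exact: ltW (lt_le_trans ij j0).
have [jn|jn] := leP j n.*2%:Z; last first.
  by apply: qunit_ann0 => // p; apply: (sing_ann sw); right.
have [i0|i0] := leP i 0.
  rewrite /qunit big1// => p _; rewrite /ad /an j0 ltNge i0 /= ann_annE.
  by rewrite (sing_ann sw) ?linear0 ?scaler0//; left.
elim/int_mode_ind: i / i0 ij => a; elim/int_mode_ind: j / j0 jn => l; rewrite /bos /fer => jn ij.
- by apply: (sing_bb sw); lia.
- by apply: (sing_bf sw); lia.
- by apply: (sing_fb sw); lia.
- by apply: (sing_ff sw); lia.
Qed.

Lemma singular_raise (k : int) (x : hatC R) : 0 < k -> degree k x -> act x w = 0.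
Proof.
move=> k0 [kx cx]; have [L E] := actE x (sing_dom sw).
rewrite (E L (leqnn L)) cx ?mulr0 ?scale0r ?addr0; last by lia.
rewrite /nqsum big1// => i _; rewrite big1// => j _.
have [->|/kx kij] := eqVneq (hmat x i j) 0; first by rewrite scale0r.
have ij : i < j by lia.
by rewrite /nqunit /vac (lt_eqF ij) !mul0r scale0r subr0 singular_qunit ?scaler0.
Qed.

Definition occnum (s : nat) : nat :=
  if odd s then nbos n col (fun a l => a <= l)%N s./2
  else nfer n col (fun a l => a <= l)%N s./2.-1.

Lemma big_box_pos (V : nmodType) (m L : nat) (G : int -> V) : (m <= L)%N ->
  (forall i : int, i <= 0 \/ m%:Z < i -> G i = 0) ->
  \sum_(i <- box L) G i = \sum_(1 <= s < m.+1) G s%:Z.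
Proof.
move=> mL G0; rewrite (bigID (fun i : int => 0 < i <= m%:Z)) /= [X in _ + X]big1 ?addr0.
  rewrite -big_filter -[RHS](big_map Posz xpredT); apply: perm_big; apply: uniq_perm.
  - by rewrite filter_uniq// box_uniq.
  - by rewrite map_inj_uniq ?iota_uniq//; move=> a b [].
  move=> i; rewrite mem_filter mem_box; apply/idP/mapP => [H|[s]].
    by exists `|i|%N; [rewrite mem_index_iota; lia|lia].
  by rewrite mem_index_iota => H ->; lia.
by move=> i /negP H; apply: G0; lia.
Qed.

Lemma singular_weight (h : hatC0 R) : act h w =
  (\sum_(1 <= s < n.*2.+1) (occnum s)%:R * omega s h + d%:R * Lambda0 h) *: w.
Proof.
have [L0 E] := actE h (sing_dom sw); pose L := (L0 + n.*2)%N.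
rewrite (E L (leq_addr _ _)) scalerDl; congr (_ + _).
transitivity (\sum_(i <- box L) hmat h i i *: nqunit i i w).
  rewrite /nqsum big_seq [RHS]big_seq; apply: eq_bigr => i iL.
  rewrite (bigD1_seq i) ?box_uniq//= big1 ?addr0// => j ji.
  by rewrite hatC0E eq_sym (negPf ji) scale0r.
have nnE i : 0 < i -> nqunit i i w = qunit i i w.
  by move=> i0; rewrite /nqunit /vac [i <= 0]leNgt i0 andbF !mul0r scale0r subr0.
rewrite (@big_box_pos _ n.*2) ?leq_addl//; last first.
  move=> i [i0|ni].
    suff -> : nqunit i i w = 0 by rewrite scaler0.
    rewrite /nqunit /qunit (eq_bigr (fun _ => (-1) ^+ halfint i *: w)); last first.
      move=> p _; rewrite /ad /an ltNge i0 /= ann_crtE (sing_ann sw); last by left.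
      by rewrite linear0 scaler0 add0r !eqxx scale1r.
    by rewrite sumr_const card_ord /vac eqxx i0 /= mul1r -scaler_nat scalerA mulrC subrr.
  have i0 : 0 < i by apply: le_lt_trans ni.
  rewrite nnE// qunit_ann0 ?scaler0// => p; apply: (sing_ann sw); by right.
rewrite scaler_suml big_nat [RHS]big_nat; apply: eq_bigr => s /andP[s0 sn].
rewrite nnE// [_%:R * _]mulrC -scalerA; congr (_ *: _).
rewrite /occnum; case: ifPn => os.
  have -> : s%:Z = bos s./2 by rewrite /bos; lia.
  by rewrite (sing_b sw)//; lia.
have -> : s%:Z = fer s./2.-1 by rewrite /fer; lia.
by rewrite (sing_f sw)//; lia.
Qed.

End HighestWeight.

(** * Occupation numbers of a partition *)

Section Partition.
Variables (d : nat) (lam : d.-tuple nat).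
Hypothesis plam : is_partition lam.
Local Notation part a := (nth 0%N lam a).

(** Both sides say that the cell in row a and column l, counted from 0, belongs to the diagram. *)
Lemma conj_seqE (s : seq nat) l a : sorted geq s ->
  (a < count (leq l.+1) s)%N = (l < nth 0%N s a)%N.
Proof.
elim: s a => [|x s IH] a /=; first by rewrite nth_nil.
move=> ps; have ss := path_sorted ps.
have sx : all (geq x) s by apply: order_path_min ps => u v t /= H1 H2; exact: leq_trans H2 H1.
have [lx|lx] := ltnP l x; first by case: a => [//|a]; rewrite add1n ltnS IH.
have c0 : count (leq l.+1) s = 0%N.
  apply/eqP; rewrite -leqn0 leqNgt -has_count; apply/hasPn => y ys; rewrite -leqNgt.
  by apply: leq_trans lx; exact: (allP sx).
rewrite c0 addn0 ltn0; apply/esym/negbTE; rewrite -leqNgt.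
case: a => [//|a] /=; have [al|al] := ltnP a (size s); last by rewrite nth_default.
by apply: leq_trans lx; apply: (allP sx); exact: mem_nth.
Qed.

Lemma conj_partE l a : (a < conj_part lam l.+1)%N = (l < part a)%N.
Proof. exact: conj_seqE. Qed.

Lemma part_mono a b : (a <= b)%N -> (part b <= part a)%N.
Proof.
move=> ab; rewrite leqNgt; apply/negP => H.
have : (b < conj_part lam (part a).+1)%N by rewrite conj_partE.
move=> /(leq_ltn_trans ab); by rewrite conj_partE ltnn.
Qed.

Lemma ltn_rank a : (a < rank lam)%N = (a < part a)%N.
Proof.
rewrite /rank; apply/idP/idP => [|ap].
  apply: contraTT; rewrite -leqNgt => pa; rewrite -leqNgt.
  apply/bigmax_leqP => i; rewrite (tnth_nth 0%N) => ip; rewrite leqNgt; apply/negP => ai.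
  by have := part_mono (ltnSE ai); lia.
have ad : (a < d)%N.
  by rewrite ltnNge; apply: contraTN ap => da; rewrite nth_default ?size_tuple.
by apply: (@leq_bigmax_cond _ _ (fun i : 'I_d => i.+1) (Ordinal ad)); rewrite (tnth_nth 0%N).
Qed.

Lemma rank_leq : (rank lam <= d)%N.
Proof. by apply/bigmax_leqP => i _; exact: ltn_ord. Qed.

Lemma columnE l : column (tnth lam) l = conj_part lam l.+1.
Proof.
rewrite /column /conj_part -sum1_card -sum1_count [RHS]big_tuple.
by apply: eq_bigl => p; rewrite inE.
Qed.

Lemma sum_ltn_ge n a m : (\sum_(l < n | (a <= l)%N) (l < m))%N = (minn n m - a)%N.
Proof.
elim: n => [|n IH]; first by rewrite big_ord0 min0n.
by rewrite big_mkcond big_ord_recr -big_mkcond /= IH; case: (leqP a n); case: (ltnP n m) => /=; lia.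
Qed.

Variable n : nat.
Hypothesis pn : forall p, (tnth lam p <= n)%N.

Lemma part_leq a : (part a <= n)%N.
Proof.
have [ad|ad] := ltnP a d; last by rewrite nth_default ?size_tuple.
by have := pn (Ordinal ad); rewrite (tnth_nth 0%N).
Qed.

Lemma occnum_odd a : occnum n (column (tnth lam)) a.*2.+1 = (part a - a)%N.
Proof.
rewrite /occnum /= odd_double uphalf_double /nbos.
rewrite (eq_bigr (fun l : 'I_n => (l < part a)%N : nat)).
  by rewrite sum_ltn_ge (minn_idPr (part_leq _)).
by move=> l _; rewrite columnE conj_partE.
Qed.

Lemma occnum_even l : (l < n)%N ->
  occnum n (column (tnth lam)) l.*2.+2 = (conj_part lam l.+1 - l.+1)%N.
Proof.
move=> ln; rewrite /occnum /= odd_double /= doubleK /nfer columnE.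
rewrite (eq_bigl (fun a : 'I_n => (a < l.+1)%N)) // big_mkcond /=.
rewrite (eq_bigr (fun a : 'I_n => (a < minn l.+1 (conj_part lam l.+1))%N : nat)).
  by rewrite sum_ltn; lia.
by move=> a _; rewrite ltn_min; case: ltnP.
Qed.

(** The occupation numbers are truncated differences of row or column lengths and positions. Up to
    the rank no truncation occurs and they are the coefficients in [frob]; beyond it the diagonal
    has left the diagram and they are 0. *)
Lemma weight_occnum (R : realType) (h : hatC0 R) : (d <= n)%N -> Lambda lam h =
  \sum_(1 <= s < n.*2.+1) (occnum n (column (tnth lam)) s)%:R * omega s h
  + d%:R * Lambda0 h.
Proof.
move=> dn; have rn : (rank lam <= n)%N by exact: leq_trans rank_leq dn.
(* The zero partition has [rank] 0, whereas its weight is written with r = 1 and zero coefficients;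
   both reduce to the level term. *)
have -> : Lambda lam h = weight d (rank lam) (frob lam) h.
  rewrite /Lambda; case: ifP => // /allP z.
  have -> : rank lam = 0%N.
    apply/eqP; rewrite -leqn0 leqNgt ltn_rank -leqNgt leqn0.
    have [d0|d0] := posnP d; first by rewrite nth_default// size_tuple d0.
    by apply: z; apply: mem_nth; rewrite size_tuple.
  rewrite /weight big_nil; congr (_ + _).
  by rewrite big1// => s _; rewrite mul0r.
rewrite /weight; congr (_ + _).
rewrite [RHS](@big_cat_nat _ _ _ (rank lam).*2.+1) //=; last by lia.
rewrite [X in _ + X]big_nat [X in _ + X]big1 ?addr0; last first.
  move=> s /andP[rs sn]; suff -> : occnum n (column (tnth lam)) s = 0%N by rewrite mul0r.
  have [os|os] := boolP (odd s).
    have sE : s = s./2.*2.+1 by lia.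
    rewrite sE occnum_odd; apply/eqP; rewrite subn_eq0 leqNgt -ltn_rank; lia.
  have sE : s = s./2.-1.*2.+2 by lia.
  rewrite sE occnum_even; last by lia.
  apply/eqP; rewrite subn_eq0 leqNgt conj_partE.
  apply/negP => H; have := leq_trans H (part_mono (leqnSn _)).
  by rewrite -ltn_rank; lia.
rewrite big_nat [RHS]big_nat; apply: eq_bigr => s /andP[s0 sr]; congr (_ * _).
have [os|os] := boolP (odd s).
  have sE : s = s./2.*2.+1 by lia.
  have := ltn_rank s./2; have lr : (s./2 < rank lam)%N by lia.
  rewrite lr => /esym H; rewrite sE occnum_odd /frob /= odd_double /= uphalf_double.
  by rewrite subzn ?(ltnW H).
have sE : s = s./2.-1.*2.+2 by lia.
have := ltn_rank s./2.-1; have lr : (s./2.-1 < rank lam)%N by lia.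
rewrite lr => /esym; rewrite -conj_partE => H.
rewrite sE occnum_even; last by lia.
rewrite /frob /= odd_double /= doubleK.
by rewrite subzn.
Qed.

End Partition.

(** * Unitarity of the modules attached to partitions *)

Section Sufficiency.
Variables (R : realType) (M : lmodType R[i]) (rho : {bilinear hatC R -> M -> M}).
Variable xi : {scalar hatC0 R}.

Theorem partition_unitarizable (d : nat) (lam : d.-tuple nat) :
  is_module rho -> irreducible rho -> quasi_finite_highest_weight rho xi ->
  is_partition lam -> (forall h, xi h = Lambda lam h) -> unitarizable rho.
Proof.
move=> Mmod Mirr [v [[v0 vwt vsing _] _]] plam xiE.
(* This n bounds the parts, so that every occupied fermion is among the first n, and also the
   length, so that the rank is at most n. *)
pose n := (\sum_(p < d) tnth lam p + d)%N.
have pn p : (tnth lam p <= n)%N by rewrite /n (bigD1 p) //=; lia.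
have dn : (d <= n)%N by exact: leq_addl.
have [w sw] := all_reflections (@column_mono _ (tnth lam)) (hook_start R pn).
apply: (@unitary_transfer R M rho xi v Mmod Mirr v0 vwt vsing (Fockd R d) (@dom R d _)
  (@act R d _) (@dot_ R d _) w).
- exact: dom0.
- exact: dom_lin.
- exact: dom_act.
- exact: sing_dom sw.
- exact: act_linr.
- exact: act_linl.
- exact: act_bracket.
- exact: act_star.
- by move=> g a f1 f2 [F1 _] [F2 _]; exact: dot_linl.
- by move=> f g [Ff _]; exact: dot_conj.
- by move=> f [Ff _]; exact: dot_gt0.
- exact: sing_neq0 sw.
- by move=> h; rewrite (singular_weight sw) xiE (weight_occnum plam pn _ dn).
- by move=> k x k0 kx; exact: singular_raise sw _ _ k0 kx.
Qed.

End Sufficiency.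

(** * Root vectors *)

Section LeviElements.
Variable R : realType.
Local Notation C := R[i].
Implicit Types (x y : hatC R) (a b c e i j k : int) (t : int -> C) (P : mat R).

(* The block-diagonal elements of [calC] are determined by their entries at
   positive indices. *)
Definition levi_mat P : mat R := fun i j =>
  if (0 < i) && (0 < j) then P i j
  else if (i < 0) && (j < 0)
  then - (-1) ^+ (halfint (j - i) && halfint i) * P (- j) (- i) else 0.

Lemma calC_levi n P : bnd n P -> calC (levi_mat P).
Proof.
move=> bP; apply/calCP; split.
  split; last by move=> i; rewrite /levi_mat ltxx /= !andbF.
  exists n => i j ij; rewrite /levi_mat bP// bP ?mulr0 ?if_same//.
  by move: ij; lia.
move=> i j; rewrite /levi_mat !betaE !oppr_gt0 !oppr_lt0 !opprK.
case: (ltgtP 0 i) => [i0|i0|_]; case: (ltgtP 0 j) => [j0|j0|_] /=;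
  rewrite ?mul0r ?mulr0//.
- rewrite (gtr0_sg i0) (gtr0_sg j0) [- i + j]addrC halfintN !if_same !mulr1.
  by rewrite mulrA mulrNN sign2 mul1r.
- rewrite (ltr0_sg i0) (ltr0_sg j0) halfintD halfintN intrN.
  by case: (halfint i); case: (halfint j); rewrite /= ?expr0 ?expr1; ring.
Qed.

Definition levi n P (H : bnd n P) : hatC R := mkC 0 (calC_levi H).

Definition blockdiag x : Prop := forall i j, (0 < i) != (0 < j) -> hmat x i j = 0.

Lemma blockdiag_levi n P (H : bnd n P) : blockdiag (levi H).
Proof.
move=> i j; rewrite /levi /hmat /= /levi_mat.
by case: (ltgtP 0 i) => _; case: (ltgtP 0 j).
Qed.

Lemma levi_pos n P (H : bnd n P) i j : 0 < i -> 0 < j -> hmat (levi H) i j = P i j.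
Proof. by rewrite /levi /hmat /= /levi_mat => -> ->. Qed.

Lemma hmat0l x j : hmat x 0 j = 0.
Proof. by have /calCP[[_ H] _] := hmatP x; rewrite (H j).2. Qed.
Lemma hmat0r x j : hmat x j 0 = 0.
Proof. by have /calCP[[_ H] _] := hmatP x; rewrite (H j).1. Qed.

Lemma levi_ext x y : blockdiag x -> blockdiag y -> hcen x = hcen y ->
  (forall i j, 0 < i -> 0 < j -> hmat x i j = hmat y i j) -> x = y.
Proof.
move=> bx b_y cxy H; apply: hatC_eq => //; apply/funext => i; apply/funext => j.
have [ij|ij] := boolP ((0 < i) != (0 < j)); first by rewrite bx// b_y.
have [i0|i0|<-] := ltgtP 0 i; last by rewrite !hmat0l.
  by apply: H => //; move: ij; rewrite i0 negbK => /eqP <-.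
have [->|j0] := eqVneq j 0; first by rewrite !hmat0r.
have /calCP[_ sx] := hmatP x; have /calCP[_ sy] := hmatP y.
have in0 : i != 0 by lia.
rewrite -[LHS]mulr1 -[RHS]mulr1 -(beta_sq R in0) !mulrA sx sy H//; lia.
Qed.

Lemma blockdiag_cocycle x y : blockdiag x -> cocycle (hmat x) (hmat y) = 0.
Proof.
move=> bx; apply: cocycle0; first exact: hmatP.
by move=> i j ij; apply: bx; move: ij; rewrite !leNgt; case: (0 < i); case: (0 < j).
Qed.

Lemma bracketE p q x y i j : parity p x -> parity q y ->
  hmat (bracket x y) i j = mul (hmat x) (hmat y) i j - (-1) ^+ (p && q) * mul (hmat y) (hmat x) i j.
Proof. by move=> [xp _] [yq _]; exact: superbracketE. Qed.

Lemma mul_blockdiag x y i j : blockdiag x -> blockdiag y -> (0 < i) != (0 < j) ->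
  mul (hmat x) (hmat y) i j = 0.
Proof.
move=> bx b_y ij; apply: fsbig1 => k _.
have [ik|ik] := boolP ((0 < i) != (0 < k)); first by rewrite bx// mul0r.
by rewrite b_y ?mulr0//; move: ik; rewrite negbK => /eqP <-.
Qed.

Lemma blockdiag_bracket p q x y : parity p x -> parity q y ->
  blockdiag x -> blockdiag y -> blockdiag (bracket x y).
Proof.
move=> px qy bx b_y i j ij; rewrite (bracketE _ _ px qy) !mul_blockdiag//.
by rewrite mulr0 subr0.
Qed.

Lemma blockdiagD u x y : blockdiag x -> blockdiag y -> blockdiag (u *: x + y).
Proof.
move=> bx b_y i j ij; rewrite -[LHS]/(u * hmat x i j + hmat y i j).
by rewrite bx// b_y// mulr0 addr0.
Qed.

Lemma degree_levi n P (H : bnd n P) k : has_degree k P -> degree k (levi H).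
Proof.
move=> kP; split=> // i j; rewrite /levi /hmat /= /levi_mat.
case: ifP => _; first exact: kP.
case: ifP => _; last by rewrite eqxx.
by rewrite mulf_eq0 negb_or => /andP[_ /kP <-]; lia.
Qed.

Definition unit_mat a b : mat R := fun i j => ((i == a) && (j == b))%:R.
Definition upper_mat t : mat R := fun i j => if j == i + 1 then t i else 0.
Definition lower_mat t : mat R := fun i j => if i == j + 1 then t j else 0.
Definition diag_mat t : mat R := fun i j => if i == j then t i else 0.

Lemma bnd_unit a b : bnd `|a - b|%N (unit_mat a b).
Proof.
move=> i j ij; rewrite /unit_mat; case: eqP => //= ia; case: eqP => // jb.
by move: ij; rewrite ia jb ltnn.
Qed.
Lemma bnd_upper t : bnd 1 (upper_mat t).
Proof. by move=> i j ij; rewrite /upper_mat; case: eqP => // E; move: ij; rewrite E; lia. Qed.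
Lemma bnd_lower t : bnd 1 (lower_mat t).
Proof. by move=> i j ij; rewrite /lower_mat; case: eqP => // E; move: ij; rewrite E; lia. Qed.
Lemma bnd_diag t : bnd 0 (diag_mat t).
Proof. by move=> i j ij; rewrite /diag_mat; case: eqP => // E; move: ij; rewrite E; lia. Qed.

Definition E_ a b : hatC R := levi (@bnd_unit a b).
Definition upper t : hatC R := levi (@bnd_upper t).
Definition lower t : hatC R := levi (@bnd_lower t).
Definition diag t : hatC R := levi (@bnd_diag t).

Lemma degree_E a b : degree (b - a) (E_ a b).
Proof.
apply: degree_levi => i j; rewrite /unit_mat.
by have [->|_] := eqVneq i a; have [->|_] := eqVneq j b; rewrite /= ?eqxx.
Qed.
Lemma degree_upper t : degree 1 (upper t).
Proof.
apply: degree_levi => i j; rewrite /upper_mat.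
by have [->|_] := eqVneq j (i + 1); rewrite ?eqxx// addrAC subrr add0r.
Qed.
Lemma degree_lower t : degree (-1) (lower t).
Proof.
apply: degree_levi => i j; rewrite /lower_mat.
by have [->|_] := eqVneq i (j + 1); rewrite ?eqxx// opprD addrA subrr add0r.
Qed.
Lemma degree_diag t : degree 0 (diag t).
Proof.
apply: degree_levi => i j; rewrite /diag_mat.
by have [->|_] := eqVneq i j; rewrite ?eqxx// subrr.
Qed.

Lemma mul_unit x a b i j : 0 < a -> 0 < b -> blockdiag x -> 0 < i -> 0 < j ->
  mul (hmat (E_ a b)) (hmat x) i j = (i == a)%:R * hmat x b j.
Proof.
move=> a0 b0 bx i0 j0; rewrite /Defs.mul (fsum1 (a := b)).
  by rewrite levi_pos// /unit_mat eqxx andbT.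
move=> k kb; have [k0|k0] := boolP (0 < k).
  by rewrite levi_pos// /unit_mat (negPf kb) andbF mul0r.
by rewrite bx ?mulr0// (negPf k0) j0.
Qed.

Lemma bracket_E a b c e : 0 < a -> 0 < b -> 0 < c -> 0 < e ->
  bracket (E_ a b) (E_ c e) = (b == c)%:R *: E_ a e
   + (- ((-1) ^+ (halfint (b - a) && halfint (e - c)) * (e == a)%:R)) *: E_ c b.
Proof.
move=> a0 b0 c0 e0.
have [p1 p2] := (degree_parity (degree_E a b), degree_parity (degree_E c e)).
have bl k l : blockdiag (E_ k l) by exact: blockdiag_levi.
apply: levi_ext.
- exact: blockdiag_bracket p1 p2 (bl _ _) (bl _ _).
- by rewrite -[X in _ + X]addr0; do 2?apply: blockdiagD => //.
- by rewrite [LHS]blockdiag_cocycle// hcenD !hcenZ /levi /hcen /= !mulr0 addr0.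
move=> i j i0 j0; rewrite (bracketE _ _ p1 p2) !mul_unit// !levi_pos//.
rewrite hmatD !hmatZ -[RHS]/(_ * hmat (E_ a e) i j + _ * hmat (E_ c b) i j) !levi_pos//.
rewrite /unit_mat.
rewrite -!mulnb !natrM; ring.
Qed.

(** Degree 1 stands for 1/2, so this is an anticommutator and both products enter with a plus sign.
    The indicator removes the passage through index 0, which lies outside the positive block. *)
Lemma bracket_upper_lower t1 t2 : bracket (upper t1) (lower t2) =
  diag (fun i => t1 i * t2 i + (1 < i)%R%:R * (t1 (i - 1) * t2 (i - 1))).
Proof.
have [p1 p2] := (degree_parity (degree_upper t1), degree_parity (degree_lower t2)).
apply: levi_ext.
- apply: blockdiag_bracket p1 p2 _ _; exact: blockdiag_levi.
- exact: blockdiag_levi.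
- by rewrite [LHS]blockdiag_cocycle//; exact: blockdiag_levi.
move=> i j i0 j0; rewrite (bracketE _ _ p1 p2) /= expr1 mulN1r opprK !levi_pos// /diag_mat.
rewrite {1}/Defs.mul (fsum1 (a := i + 1)); last first.
  move=> k ki; have [k0|k0] := boolP (0 < k).
    by rewrite levi_pos// /upper_mat (negPf ki) mul0r.
  by rewrite [hmat (upper t1) i k]blockdiag_levi ?mul0r// i0 (negPf k0).
rewrite {1}/Defs.mul (fsum1 (a := i - 1)); last first.
  move=> k ki; have [k0|k0] := boolP (0 < k).
    by rewrite levi_pos// /lower_mat -subr_eq eq_sym (negPf ki) mul0r.
  by rewrite [hmat (lower t2) i k]blockdiag_levi ?mul0r// i0 (negPf k0).
have i10 : 0 < i + 1 by lia.
rewrite [hmat (upper t1) i _]levi_pos// [hmat (lower t2) _ j]levi_pos//.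
rewrite /upper_mat /lower_mat eqxx (inj_eq (addIr 1)).
have [i1|i1] := ltP 1 i.
  have i10' : 0 < i - 1 by lia.
  rewrite !levi_pos// /upper_mat /lower_mat !subrK eqxx [j == i]eq_sym.
  by case: eqP => [->|_]; rewrite ?mulr0 ?addr0 /= ?mulr1n ?mul1r//; ring.
have -> : i = 1 by lia.
rewrite subrr hmat0r mul0r addr0 mul0r addr0.
by case: eqP => [<-|]; rewrite ?mulr0.
Qed.

Lemma hmat_star x i j :
  hmat (star x) i j = (-1) ^+ (neg_half i + neg_half j) * Num.conj (hmat x j i).
Proof. by []. Qed.

Lemma star_E a b : 0 < a -> 0 < b -> star (E_ a b) = E_ b a.
Proof.
move=> a0 b0; apply: levi_ext.
- move=> i j ij; rewrite hmat_star.
  by rewrite [hmat (E_ a b) j i]blockdiag_levi ?conjC0 ?mulr0// eq_sym.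
- exact: blockdiag_levi.
- by rewrite /star /hcen /= conjC0.
move=> i j i0 j0; rewrite hmat_star !levi_pos// /neg_half.
rewrite /unit_mat ![_ < 0]ltNge (ltW i0) (ltW j0) !andbF expr0 mul1r.
by rewrite conjC_nat andbC.
Qed.

Definition Zc : hatC R := mkC 1 (calC0 R).

Lemma degree_Zc : degree 0 Zc.
Proof. by split=> [i j|]; rewrite /Zc /hmat /= ?eqxx. Qed.

Lemma bracket_Zc x : bracket Zc x = 0.
Proof.
apply: hatC_eq.
  rewrite -[LHS]/(superbracket 0 (hmat x)) /superbracket.
  have E p : parity_part p (0 : mat R) = 0.
    by apply/funext => i; apply/funext => j; rewrite /parity_part if_same.
  by rewrite big1// => p _; rewrite big1// => q _; rewrite E mulm0 mul0m scaler0 subr0.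
by apply: (@cocycle0 _ 0 (hmat x)); first exact: calC0.
Qed.

(* Root vectors for the longest root of the symplectic part. *)
Definition long_mat a : mat R := fun i j => ((i == a) && (j == - a))%:R.

Lemma calC_long a : a != 0 -> halfint a = false -> calC (long_mat a).
Proof.
move=> a0 ha; apply/calCP; split.
  split.
    exists (absz (a + a)%R) => i j; rewrite /long_mat; case: eqP => //= ->; case: eqP => // ->.
    by rewrite opprK ltnn.
  by move=> i; rewrite /long_mat [0 == a]eq_sym [0 == - a]eq_sym oppr_eq0 (negPf a0) andbF.
move=> i j; rewrite /long_mat !betaE eqr_oppLR eqr_opp andbC.
case: eqP => [->|_]; last by rewrite !mul0r mulr0.
case: eqP => [->|_] /=; last by rewrite !mul0r mulr0.
rewrite halfintN ha andbF expr0 sgrN intrN; ring.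
Qed.

Lemma hf2 : halfint 2 = false. Proof. by []. Qed.
Definition Flong : hatC R := mkC 0 (@calC_long 2 isT hf2).
Definition Elong : hatC R := mkC 0 (@calC_long (-2) isT hf2).

Lemma degree_Flong : degree (- 4) Flong.
Proof.
split=> // i j; rewrite /Flong /hmat /= /long_mat.
by have [->|_] := eqVneq i 2; have [->|_] := eqVneq j (-2); rewrite /= ?eqxx.
Qed.
Lemma degree_Elong : degree 4 Elong.
Proof.
split=> // i j; rewrite /Elong /hmat /= /long_mat.
by have [->|_] := eqVneq i (-2); have [->|_] := eqVneq j 2; rewrite /= ?eqxx.
Qed.

Lemma star_Flong : star Flong = Elong.
Proof.
apply: hatC_eq; last by rewrite /star /hcen /= conjC0.
apply/funext => i; apply/funext => j; rewrite hmat_star.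
rewrite /Flong /Elong /hmat /= /long_mat conjC_nat opprK andbC.
have [->|_] := eqVneq i (-2); last by rewrite mulr0.
by have [->|_] := eqVneq j 2; rewrite /= ?mulr0// mulr1.
Qed.

Lemma mul_long a x i j : mul (long_mat a) (hmat x) i j = (i == a)%:R * hmat x (- a) j.
Proof.
rewrite /Defs.mul (fsum1 (a := - a)); first by rewrite /long_mat eqxx andbT.
by move=> k ka; rewrite /long_mat (negPf ka) andbF mul0r.
Qed.

Lemma mulr_long a x i j : mul (hmat x) (long_mat a) i j = hmat x i a * (j == - a)%:R.
Proof.
rewrite /Defs.mul (fsum1 (a := a)); first by rewrite /long_mat eqxx.
by move=> k ka; rewrite /long_mat (negPf ka) mulr0.
Qed.

Lemma hmat_E22 i j :
  hmat (E_ 2 2) i j = ((i == 2) && (j == 2))%:R - ((i == -2) && (j == -2))%:R.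
Proof.
have [ij|ij] := boolP ((0 < i) != (0 < j)).
  rewrite [LHS]blockdiag_levi//.
  have -> : (i == 2) && (j == 2) = false by apply/negP => /andP[/eqP E1 /eqP E2]; rewrite E1 E2 in ij.
  have -> : (i == -2) && (j == -2) = false by apply/negP => /andP[/eqP E1 /eqP E2]; rewrite E1 E2 in ij.
  by rewrite subr0.
have [i0|i0|i0] := ltgtP 0 i.
- have j0 : 0 < j by move: ij; rewrite i0 negbK => /eqP <-.
  rewrite levi_pos// /unit_mat.
  have -> : i == -2 = false by lia.
  by rewrite subr0.
- have [->|j0] := eqVneq j 0; first by rewrite hmat0r !andbF subr0.
  have jn : j < 0 by move: ij; lia.
  rewrite /E_ /levi /hmat /= /levi_mat i0 jn ltNge (ltW i0) /= /unit_mat.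
  have -> : i == 2 = false by lia.
  rewrite /= sub0r !eqr_oppLR [(j == _) && _]andbC.
  have [->|_] := eqVneq i (-2); last by rewrite mulr0 oppr0.
  by have [->|_] := eqVneq j (-2); rewrite /= ?mulr0 ?oppr0// mulr1.
by rewrite -i0 hmat0l subr0.
Qed.

(** The coroot involves the centre because these root vectors join index 1 to index -1 across the
    cut of J, where the cocycle is 1. Through it the level bounds the weight. *)
Lemma bracket_long : bracket Elong Flong = Zc - E_ 2 2.
Proof.
have [p1 p2] := (degree_parity degree_Elong, degree_parity degree_Flong).
apply: hatC_eq.
  apply/funext => i; apply/funext => j; rewrite (bracketE _ _ p1 p2) /= expr0 mul1r.
  rewrite -[hmat Elong]/(long_mat (-2)) mul_long mulr_long opprK.
  rewrite -[RHS]/(0 - hmat (E_ 2 2) i j) hmat_E22 sub0r opprB.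
  by rewrite /Flong /hmat /= /long_mat !eqxx /= mulrC -!natrM !mulnb andbT andbC.
rewrite -[LHS]/(cocycle (long_mat (-2)) (long_mat 2)) -[RHS]/(1 - 0).
rewrite /cocycle /supertrace (fsum1 (a := -2)); last first.
  move=> r r2; rewrite /Defs.mul fsbig1 ?mulr0// => k _.
  by rewrite superbracketJ /long_mat (negPf r2) /= mulr0 mul0r.
rewrite /= expr0 mul1r /Defs.mul (fsum1 (a := 2)) ?superbracketJ /long_mat ?eqxx /=.
  by rewrite mulr1 mulr1 subr0.
by move=> k k2; rewrite superbracketJ /long_mat opprK (negPf k2) andbF /= mulr0.
Qed.

Lemma bracket_E22_long : bracket (E_ 2 2) Flong = 2 *: Flong.
Proof.
have [p1 p2] := (degree_parity (degree_E 2 2), degree_parity degree_Flong).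
apply: hatC_eq.
  apply/funext => i; apply/funext => j; rewrite (bracketE _ _ p1 p2) /= expr0 mul1r.
  rewrite -[hmat Flong]/(long_mat 2) mul_long mulr_long !hmat_E22.
  rewrite -[RHS]/(2 * long_mat 2 i j) /long_mat !eqxx /= !andbT !andbF subr0 sub0r.
  by rewrite mulrN opprK -!natrM !mulnb; ring.
rewrite [LHS]blockdiag_cocycle; first by rewrite hcenZ mulr0.
exact: blockdiag_levi.
Qed.

End LeviElements.

(** * Weights of unitarizable modules *)

Section CompactSl2.
Variables (R : realType) (M : lmodType R[i]) (f : {dot M for Num.conj}).
Local Notation C := R[i].
Variables (e g h : M -> M) (v : M) (mu : C).
Hypothesis adj : forall u w, f (g u) w = f u (e w).
Hypothesis eg : forall u, e (g u) = g (e u) + h u.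
Hypothesis hg : forall u, h (g u) = g (h u) - 2 *: g u.
Hypothesis g_lin : linear g.
Hypothesis v0 : v != 0.
Hypothesis ev : e v = 0.
Hypothesis hv : h v = mu *: v.

Lemma lin_Z (t : M -> M) a u : linear t -> t (a *: u) = a *: t u.
Proof.
move=> tl; have := tl a u 0; rewrite !addr0 => ->.
have := tl (-1) 0 0; rewrite scaler0 addr0 => {1}->.
by rewrite scaleN1r addNr addr0.
Qed.

Lemma sl2_h k : h (iter k g v) = (mu - 2 * k%:R) *: iter k g v.
Proof.
elim: k => [|k IH] /=; first by rewrite mulr0 subr0.
rewrite hg IH (lin_Z _ _ g_lin) -scalerBl; congr (_ *: _).
by rewrite -natr1; ring.
Qed.

Lemma sl2_e k : e (iter k.+1 g v) = (k.+1%:R * (mu - k%:R)) *: iter k g v.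
Proof.
elim: k => [|k IH].
  have g0 : g 0 = 0 by rewrite -(scale0r v) (lin_Z _ _ g_lin) !scale0r.
  by rewrite /= eg ev hv g0 add0r mul1r subr0.
rewrite [iter _ _ _]iterS eg IH sl2_h (lin_Z _ _ g_lin) -iterS -scalerDl; congr (_ *: _).
by rewrite -!natr1; ring.
Qed.

Lemma sl2_norm k : f (iter k.+1 g v) (iter k.+1 g v) =
  Num.conj (k.+1%:R * (mu - k%:R)) * f (iter k g v) (iter k g v).
Proof. by rewrite {1}iterS adj sl2_e linearZr_LR. Qed.

Lemma no_infinite_complex (z : C) : (forall k : nat, 0 < z - k%:R) -> False.
Proof.
case: z => x y H.
have E k : (k%:R : C) = (k%:R : R)%:C%C by rewrite rmorph_nat.
have := H 0%N; rewrite E ltcE /= => /andP[_]; rewrite subr0 => /ltW x0.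
have := H (Num.bound x); rewrite E ltcE /= => /andP[_]; rewrite subr_gt0.
by move=> /lt_trans /(_ (archi_boundP x0)); rewrite ltxx.
Qed.

(** If mu were not a natural number, no power of g would kill v, and positivity of the successive
    norms would give mu > k for every k, against the archimedean property. *)
Lemma sl2_weight : exists n : nat, mu = n%:R.
Proof.
apply: contrapT => H; apply: (@no_infinite_complex mu) => k.
have pos j : 0 < f (iter j g v) (iter j g v) /\ forall i, (i < j)%N -> 0 < mu - i%:R.
  elim: j => [|j [Pj IH]]; first by split=> //; exact: neq0_dnorm_gt0.
  set c := j.+1%:R * (mu - j%:R).
  have c0 : c != 0.
    rewrite mulf_neq0 ?pnatr_eq0// subr_eq0; apply/eqP => E; apply: H.
    by exists j.
  have N := sl2_norm j; rewrite -/c in N.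
  have P1 : 0 < f (iter j.+1 g v) (iter j.+1 g v).
    apply: neq0_dnorm_gt0; apply/eqP => E; move/eqP: N.
    by rewrite {1}E linear0l eq_sym mulf_eq0 conjC_eq0 (negPf c0) (gt_eqF Pj).
  have cc : 0 < Num.conj c by rewrite N pmulr_lgt0 in P1.
  have c1 : 0 < c by rewrite -[c]conjCK conj_Creal// ger0_real// ltW.
  split=> // i; rewrite ltnS leq_eqVlt => /orP[/eqP->|]; last exact: IH.
  by move: c1; rewrite /c pmulr_rgt0// ltr0n.
by have [_ /(_ k (ltnSn k))] := pos k.+1.
Qed.

End CompactSl2.

(** * Constraints on the highest weight of a unitarizable module *)

Section Necessity.
Variables (R : realType) (M : lmodType R[i]) (rho : {bilinear hatC R -> M -> M}).
Variables (xi : {scalar hatC0 R}) (f : {dot M for Num.conj}).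
Local Notation C := R[i].
Implicit Types (a b c e i j : int).
Hypothesis Mmod : is_module rho.
Hypothesis fstar : forall x u w, f (rho x u) w = f u (rho (star x) w).

Lemma rho_lin x : linear (rho x).
Proof. by move=> a u w; rewrite linearPr. Qed.

Lemma rho_swap p q x y u : parity p x -> parity q y ->
  rho x (rho y u) = rho (bracket x y) u + (-1) ^+ (p && q) *: rho y (rho x u).
Proof. by move=> px qy; rewrite (Mmod _ px qy) subrK. Qed.

Lemma rho_EE a b c e u : 0 < a -> 0 < b -> 0 < c -> 0 < e ->
  rho (E_ R a b) (rho (E_ R c e) u) = (b == c)%:R *: rho (E_ R a e) u
   - ((-1) ^+ (halfint (b - a) && halfint (e - c)) * (e == a)%:R) *: rho (E_ R c b) u
   + (-1) ^+ (halfint (b - a) && halfint (e - c)) *: rho (E_ R c e) (rho (E_ R a b) u).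
Proof.
move=> a0 b0 c0 e0.
rewrite (rho_swap _ (degree_parity (degree_E R a b)) (degree_parity (degree_E R c e))).
by rewrite bracket_E// linearDl !linearZl_LR /= scaleNr.
Qed.

Lemma E_sl2 i j u n m : 0 < i -> 0 < j -> i != j -> halfint i = halfint j ->
  u != 0 -> rho (E_ R i j) u = 0 -> rho (E_ R i i) u = n *: u -> rho (E_ R j j) u = m *: u ->
  exists k : nat, n - m = k%:R :> C.
Proof.
move=> i0 j0 ij hij u0 e0 en em.
have hd t s : halfint (s - t) = halfint s (+) halfint t by rewrite halfintD halfintN.
have ji : (j == i) = false by rewrite eq_sym (negPf ij).
apply: (@sl2_weight _ _ f (rho (E_ R i j)) (rho (E_ R j i))
  (fun w => rho (E_ R i i) w - rho (E_ R j j) w) u) => //.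
- by move=> w w'; rewrite fstar star_E.
- move=> w; rewrite rho_EE// !eqxx !hd hij addbb /= expr0 mul1r !scale1r.
  by rewrite addrC.
- move=> w; rewrite (rho_EE _ i0 i0 j0 i0) (rho_EE _ j0 j0 j0 i0).
  rewrite !eqxx (negPf ij) !hd hij !addbb /= expr0 !(mul1r, mulr1, mulr0, scale1r, scale0r).
  rewrite sub0r subr0 !linearBr (_ : 2 = 1 + 1)// scalerDl scale1r !opprD.
  by rewrite addrACA addrC.
- exact: rho_lin.
- by rewrite en em scalerBl.
Qed.

Lemma E_weight a c e u n : 0 < a -> 0 < c -> 0 < e -> rho (E_ R a a) u = n *: u ->
  rho (E_ R a a) (rho (E_ R c e) u) =
  (n + (a == c)%:R - (e == a)%:R) *: rho (E_ R c e) u.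
Proof.
move=> a0 c0 e0 en; rewrite rho_EE// subrr /= expr0 mul1r scale1r en linearZr_LR /=.
have -> : (a == c)%:R *: rho (E_ R a e) u = (a == c)%:R *: rho (E_ R c e) u.
  by have [->|_] := eqVneq a c; rewrite ?scale0r.
have -> : (e == a)%:R *: rho (E_ R c a) u = (e == a)%:R *: rho (E_ R c e) u.
  by have [->|_] := eqVneq e a; rewrite ?scale0r.
by rewrite -scalerBl -scalerDl; congr (_ *: _); ring.
Qed.

(** For an odd pair the bracket is an anticommutator, so the diagonal units enter as a sum, where an
    even pair gives their difference. *)
Lemma odd_norm i j u n m : 0 < i -> 0 < j -> halfint i != halfint j ->
  rho (E_ R i j) u = 0 -> rho (E_ R i i) u = n *: u -> rho (E_ R j j) u = m *: u ->
  f (rho (E_ R j i) u) (rho (E_ R j i) u) = Num.conj (n + m) * f u u.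
Proof.
move=> i0 j0 hij e0 en em; rewrite fstar star_E// rho_EE// !eqxx e0 en em.
rewrite linear0r scaler0 addr0 scale1r mulr1 !halfintD !halfintN addbC andbb.
have -> : halfint i (+) halfint j by move: hij; case: halfint; case: halfint.
by rewrite expr1 scaleN1r opprK -scalerDl linearZr_LR.
Qed.

Variable v : M.
Hypothesis v0 : v != 0.
Hypothesis vwt : forall h : hatC0 R, rho h v = xi h *: v.
Hypothesis vsing : forall (k : int) x, 0 < k -> degree k x -> rho x v = 0.
Hypothesis vfin : finite_dim (component rho v (-1)).

Lemma diag_in0 t : diag t \in hatC0_pred R.
Proof. by apply/asboolP; exact: degree_diag. Qed.
Definition diag0 t : hatC0 R := HatC0 (diag_in0 t).

Lemma E_in0 a : E_ R a a \in hatC0_pred R.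
Proof. by apply/asboolP; have := degree_E R a a; rewrite subrr. Qed.
Definition E0 a : hatC0 R := HatC0 (E_in0 a).

Lemma Zc_in0 : Zc R \in hatC0_pred R.
Proof. by apply/asboolP; exact: degree_Zc. Qed.
Definition Zc0 : hatC0 R := HatC0 Zc_in0.

Lemma poly_nonroot (p : {poly C}) : p != 0 ->
  exists n0 : nat, forall q, (n0 <= q)%N -> p.[q%:R] != 0.
Proof.
move=> p0; apply: contrapT => H.
have {}H n0 : exists2 q, (n0 <= q)%N & root p q%:R.
  apply: contrapT => H'; apply: H; exists n0 => q qn; apply/negP => pq.
  by apply: H'; exists q.
have S k : exists s : seq nat, [/\ uniq s, size s = k & all (fun q => root p q%:R) s].
  elim: k => [|k [s [us ss ps]]]; first by exists [::].
  have [q qs pq] := H (sumn s).+1.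
  exists (q :: s); split => /=; rewrite ?us ?ss ?pq// andbT.
  apply/negP => qin; have : (q <= sumn s)%N.
    by rewrite (perm_sumn (perm_to_rem qin)) /= leq_addr.
  by rewrite leqNgt qs.
have [s [us ss ps]] := S (size p).
have := max_poly_roots p0 (rs := map (fun q => q%:R) s).
rewrite all_map ps map_inj_uniq ?us ?size_map ?ss ?ltnn; last first.
  by move=> q q' /eqP; rewrite eqr_nat => /eqP.
by move=> /(_ isT isT).
Qed.

Lemma lower_sum n (c : 'I_n -> C) (t : 'I_n -> int -> C) :
  lower (fun j => \sum_m c m * t m j) = \sum_m c m *: lower (t m).
Proof.
apply: levi_ext.
- exact: blockdiag_levi.
- move=> i j ij; rewrite hmat_sum big1// => m _.
  by rewrite -[LHS]/(c m * hmat (lower (t m)) i j) blockdiag_levi ?mulr0.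
- by rewrite hcen_sum big1// => m _; rewrite hcenZ mulr0.
move=> i j i0 j0; rewrite hmat_sum levi_pos//.
rewrite (eq_bigr (fun m => c m * lower_mat (t m) i j)); last first.
  by move=> m _; rewrite -[LHS]/(c m * hmat (lower (t m)) i j) levi_pos.
rewrite /lower_mat; case: ifP => // _.
by rewrite big1// => m _; rewrite mulr0.
Qed.

Lemma lower_poly : exists2 p : {poly C}, p != 0 &
  rho (lower (fun j => p.[j%:~R])) v = 0.
Proof.
have [n [b Hb]] := vfin.
pose t (m : 'I_n.+1) (j : int) : C := j%:~R ^+ m.
have comp (m : 'I_n.+1) : component rho v (-1) (rho (lower (t m)) v).
  exists 1%N, (fun=> 1), (fun=> rho (lower (t m)) v); split; last first.
    by rewrite big_ord1 scale1r.
  move=> _; rewrite -[- 1]sub0r; apply: lowered_cons => //; first exact: degree_lower.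
  exact: lowered_nil.
have [a aE] := choice (fun m => Hb _ (comp m)).
(* Row m holds the coordinates of the m-th of n + 1 vectors in the span of n vectors; a nonzero row
   of the left kernel gives the coefficients of the polynomial. *)
pose A := \matrix_(m < n.+1, i < n) a m i.
have kA : kermx A != 0.
  rewrite -mxrank_eq0 mxrank_ker; have := rank_leq_col A; lia.
have /rowV0Pn[c /sub_kermxP cA c0] := kA.
exists (rVpoly c).
  apply: contraNneq c0 => pc; apply/eqP.
  by rewrite -(rVpolyK c) pc linear0.
have -> : (fun j : int => (rVpoly c).[j%:~R]) = (fun j => \sum_m c 0 m * t m j).
  apply/funext => j; rewrite (horner_coef_wide _ (size_poly _ _)).
  by apply: eq_bigr => m _; rewrite coef_rVpoly_ord.
rewrite lower_sum linear_sumlz.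
rewrite (eq_bigr (fun m => \sum_i (c 0 m * A m i) *: b i)); last first.
  move=> m _; rewrite linearZl_LR /= aE scaler_sumr; apply: eq_bigr => i _.
  by rewrite scalerA mxE.
rewrite exchange_big big1//= => i _; rewrite -scaler_suml.
have := congr1 (fun B : 'M_(1, n) => B 0 i) cA.
by rewrite !mxE => ->; rewrite scale0r.
Qed.

(** Beyond the natural roots of p, any diagonal element is the bracket of a raising element with the
    lowering element given by p. Both kill [v], so [xi] vanishes on it. *)
Lemma xi_tail : exists2 n0 : nat, (0 < n0)%N &
  forall t : int -> C, (forall i : int, i < n0%:Z -> t i = 0) -> xi (diag0 t) = 0.
Proof.
have [p p0 pv] := lower_poly; have [n1 Hn1] := poly_nonroot p0.
exists n1.+1 => // t t0.
(* The solution of q i + q (i - 1) = t i, as [bracket_upper_lower] requires. It vanishes up to n1,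
   so the division by p in [s] only matters where p has no root. *)
pose q := fix q n : C := if n is m.+1 then t m.+1%:Z - q m else 0.
have q0 n : (n <= n1)%N -> q n = 0.
  by elim: n => //= n IH nn; rewrite IH ?subr0 ?t0//; lia.
pose s (i : int) : C := q `|i|%N / p.[i%:~R].
have sE (i : int) : 0 < i -> s i * p.[i%:~R] = q `|i|%N.
  move=> i0; have [/q0 E|E] := leqP `|i|%N n1; first by rewrite /s E !mul0r.
  rewrite /s mulfVK// (_ : i = `|i|%N%:Z); last by lia.
  by rewrite -pmulrn; apply: Hn1; lia.
have E : diag t = bracket (upper s) (lower (fun i => p.[i%:~R])).
  rewrite bracket_upper_lower; apply: levi_ext => //; try exact: blockdiag_levi.
  move=> i j i0 j0; rewrite !levi_pos// /diag_mat; case: ifP => // _.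
  rewrite sE//; have [i1|i1] := ltP 1 i; last first.
    have -> : i = 1 by lia.
    by rewrite /= mul0r addr0 subr0.
  rewrite mul1r sE; last by lia.
  have -> : `|i|%N = `|i - 1|%N.+1 by lia.
  rewrite /= (_ : `|i - 1|%N.+1%:Z = i) ?subrK//; lia.
have := vwt (diag0 t); rewrite -[hatC0_val _]/(diag t) E.
rewrite (Mmod _ (degree_parity (degree_upper s)) (degree_parity (degree_lower _))).
rewrite pv linear0r (vsing _ (degree_upper s))// linear0r scaler0 subr0.
by move=> /esym/eqP; rewrite scaler_eq0 (negPf v0) orbF => /eqP.
Qed.

Local Notation nu s := (xi (E0 s%:Z)).

Lemma xi_finite : exists2 n0 : nat, (forall s, (n0 <= s)%N -> nu s = 0) &
  forall h, xi h = \sum_(1 <= s < n0) nu s * omega s h + xi Zc0 * Lambda0 h.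
Proof.
have [n0 n00 Hn0] := xi_tail; exists n0.
  move=> s sn; have -> : E0 s = diag0 (fun i => (i == s%:Z)%:R).
    apply: val_inj; apply: levi_ext => //; try exact: blockdiag_levi.
    move=> i j i0 j0; rewrite /= !levi_pos// /unit_mat /diag_mat.
    have [->|ij] := eqVneq i j; first by rewrite andbb.
    by have [E|//] := eqVneq i s%:Z; rewrite -E eq_sym (negPf ij).
  by apply: Hn0 => i si; case: eqP => // E; lia.
move=> h; pose tl (i : int) : C := if n0%:Z <= i then hmat h i i else 0.
have valS I (r : seq I) (P : pred I) (G : I -> hatC0 R) :
    hatC0_val (\sum_(t <- r | P t) G t) = \sum_(t <- r | P t) hatC0_val (G t).
  by elim/big_rec2: _ => // t x y _ <-.
have hE : h = \sum_(1 <= s < n0) omega s h *: E0 s%:Z + Lambda0 h *: Zc0 + diag0 tl.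
  apply: val_inj; rewrite -[RHS]/(hatC0_val _ + _ *: Zc R + diag tl) valS /=.
  apply: levi_ext.
  - by move=> i j ij; rewrite hatC0E; case: eqP => // E; rewrite E eqxx in ij.
  - move=> i j ij; rewrite !hmatD hmatZ.
    rewrite -[LHS]/(hmat _ i j + _ * 0 + hmat (diag tl) i j) mulr0 addr0.
    rewrite [hmat (diag tl) i j]blockdiag_levi// addr0 hmat_sum big1// => s _.
    by rewrite -[LHS]/(_ * hmat (E_ R s s) i j) blockdiag_levi ?mulr0.
  - rewrite !hcenD hcen_sum big1 ?add0r; last by move=> s _; rewrite hcenZ mulr0.
    by rewrite hcenZ [hcen (Zc R)]/(1 : C) mulr1 [hcen (diag tl)]/(0 : C) addr0.
  move=> i j i0 j0; rewrite !hmatD hmatZ.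
  rewrite -[RHS]/(hmat _ i j + _ * 0 + hmat (diag tl) i j) mulr0 addr0 hmat_sum levi_pos//.
  rewrite (eq_bigr (fun s => omega s h * ((i == s%:Z) && (j == s%:Z))%:R)); last first.
    by move=> s _; rewrite -[LHS]/(_ * hmat (E_ R s s) i j) levi_pos.
  rewrite /diag_mat; have [<-|ij] := eqVneq i j; last first.
    rewrite hatC0E (negPf ij) addr0 big1// => s _.
    by case: eqP => [E|_]; rewrite ?mulr0// -E eq_sym (negPf ij) mulr0.
  have [iE i1] : i = `|i|%N%:Z /\ (0 < `|i|)%N by lia.
  rewrite /tl; have [ni|ni] := leP n0%:Z i.
    rewrite big_nat big1 ?add0r// => s /andP[_ sn].
    by rewrite (_ : (i == s%:Z) = false) ?mulr0//; lia.
  rewrite addr0 (bigD1_seq `|i|%N) ?iota_uniq ?mem_index_iota//=; last by lia.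
  rewrite -iE eqxx mulr1 big1 ?addr0; first by rewrite /omega -iE.
  by move=> s si; rewrite (_ : (i == s%:Z) = false) ?mulr0//; lia.
rewrite [LHS](congr1 xi hE) !linearD !linearZ linear_sum /=.
rewrite Hn0 ?addr0 => [|i ni]; last by rewrite /tl leNgt ni.
congr (_ + _); last by rewrite mulrC.
by apply: eq_bigr => s _; rewrite linearZ /= mulrC.
Qed.

Let vraise i j : 0 < i -> 0 < j -> i < j -> rho (E_ R i j) v = 0.
Proof. by move=> i0 j0 ij; apply: vsing (degree_E R i j); rewrite subr_gt0. Qed.

Let vE i : rho (E_ R i i) v = xi (E0 i) *: v.
Proof. exact: (vwt (E0 i)). Qed.

(** The positions s and s + 2 have equal parity, so a compact sl2 makes the difference of their
    coefficients a natural number. Descending from the tail, where the coefficients are 0, each one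
    is natural. *)
Lemma weight_nat : exists c : nat -> nat, forall s, (0 < s)%N -> nu s = (c s)%:R.
Proof.
have [n0 Hn0 _] := xi_finite.
suff H k s : (0 < s)%N -> (n0 <= s + k.*2)%N -> exists m : nat, nu s = m%:R.
  have /choice[c cE] : forall s, exists m : nat, (0 < s)%N -> nu s = m%:R.
    move=> s; have [->|s0] := posnP s; first by exists 0%N.
    have sk : (n0 <= s + n0.*2)%N by lia.
    by have [m mE] := H n0 s s0 sk; exists m.
  by exists c.
elim: k s => [|k IH] s s0 sk; first by exists 0%N; rewrite Hn0// -(addn0 s).
have sk' : (n0 <= s.+2 + k.*2)%N by lia.
have [m mE] := IH s.+2 isT sk'.
have [i0 j0] : 0 < s%:Z /\ 0 < s.+2%:Z by lia.
have [|||k' kE] := @E_sl2 s s.+2 v (nu s) (nu s.+2) i0 j0 _ _ v0 _ (vE _) (vE _).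
- by lia.
- by rewrite /halfint /= negbK.
- by apply: vraise => //; lia.
by exists (k' + m)%N; rewrite natrD -kE mE subrK.
Qed.

Lemma Zc_weight u m : rho (Zc R) u = m *: u -> forall x k, degree k x ->
  rho (Zc R) (rho x u) = m *: rho x u.
Proof.
move=> mE x k kx; rewrite (rho_swap _ (degree_parity (degree_Zc R)) (degree_parity kx)).
by rewrite bracket_Zc linear0l add0r /= expr0 scale1r mE linearZr_LR.
Qed.

Lemma long_sl2 u n m : u != 0 -> rho (Elong R) u = 0 ->
  rho (Zc R) u = n *: u -> rho (E_ R 2 2) u = m *: u -> exists k : nat, n - m = k%:R :> C.
Proof.
move=> u0 e0 nE mE.
have p0 := degree_parity (degree_Zc R).
apply: (@sl2_weight _ _ f (rho (Elong R)) (rho (Flong R))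
  (fun w => rho (Zc R) w - rho (E_ R 2 2) w) u) => //.
- by move=> w w'; rewrite fstar star_Flong.
- move=> w; rewrite (rho_swap _ (degree_parity (degree_Elong R)) (degree_parity (degree_Flong R))).
  by rewrite bracket_long linearBl expr0 scale1r addrC.
- move=> w; rewrite (rho_swap _ p0 (degree_parity (degree_Flong R))).
  rewrite (rho_swap _ (degree_parity (degree_E R 2 2)) (degree_parity (degree_Flong R))).
  rewrite bracket_Zc linear0l add0r bracket_E22_long linearZl_LR /= !expr0 !scale1r.
  by rewrite linearBr opprD [- (2 *: _) - _]addrC addrA.
- exact: rho_lin.
- by rewrite nE mE scalerBl.
Qed.

Lemma reflected_neq0 (c : nat -> nat) s : (forall s, (0 < s)%N -> nu s = (c s)%:R) ->
  (0 < s)%N -> (0 < c s + c s.+1)%N -> rho (E_ R s.+1 s) v != 0.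
Proof.
move=> cE s0 cs; have [i0 j0] : 0 < s%:Z /\ 0 < s.+1%:Z by lia.
have hs : halfint s != halfint s.+1 by rewrite /halfint /=; case: odd.
have H := odd_norm i0 j0 hs (vraise i0 j0 _) (vE _) (vE _).
apply/eqP => E; have : s%:Z < s.+1%:Z by lia.
move=> /H; rewrite E linear0l !cE// -natrD conjC_nat => /esym/eqP.
rewrite mulf_eq0 pnatr_eq0 => /orP[|]; first by lia.
by rewrite gt_eqF// neq0_dnorm_gt0.
Qed.

Lemma weight_facts : exists (D n0 : nat) (c : nat -> nat),
  [/\ (forall s, (0 < s)%N -> (n0 <= s)%N -> c s = 0%N) /\
      (forall h, xi h = \sum_(1 <= s < n0) (c s)%:R * omega s h + D%:R * Lambda0 h),
      forall s, (0 < s)%N -> (0 < c s.+1 + c s.+2)%N -> (c s.+2 < c s)%N,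
      (c 2 <= D)%N &
      (0 < c 1 + c 2)%N -> (c 2 < D)%N].
Proof.
have [c cE] := weight_nat; have [n0 Hn0 xiE] := xi_finite.
have vZ : rho (Zc R) v = xi Zc0 *: v by exact: (vwt Zc0).
have Ev : rho (Elong R) v = 0 by exact: vsing (degree_Elong R).
have [m mE] := long_sl2 v0 Ev vZ (vE 2).
have mD : xi Zc0 = (m + c 2)%:R by rewrite natrD -mE cE// subrK.
exists (m + c 2)%N, n0, c; split.
- split=> [s s0 /Hn0|h].
    by rewrite cE// => /eqP; rewrite pnatr_eq0 => /eqP.
  rewrite xiE mD; congr (_ + _); rewrite big_nat [RHS]big_nat.
  by apply: eq_bigr => s /andP[s0 _]; rewrite cE.
(* The reflected vector is still killed by the raising vector from s + 2 to s. Its coefficient at s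
   + 2 is one larger and that at s is unchanged, hence the strict inequality. *)
- move=> s s0 cs; have u0 := @reflected_neq0 c s.+1 cE isT cs.
  have [i0 [j0 k0]] : 0 < s%:Z /\ 0 < s.+1%:Z /\ 0 < s.+2%:Z by lia.
  have eu : rho (E_ R s s.+2) (rho (E_ R s.+2 s.+1) v) = 0.
    rewrite rho_EE// (vraise i0 k0) ?(vraise i0 j0); try lia.
    rewrite (_ : (s.+1%:Z == s%:Z) = false); last by lia.
    by rewrite mulr0 scale0r linear0r !scaler0 subr0 addr0.
  have hs : halfint s = halfint s.+2 by rewrite /halfint /= negbK.
  have ik : s%:Z != s.+2%:Z by lia.
  have := E_sl2 i0 k0 ik hs u0 eu (E_weight i0 k0 j0 (vE _)) (E_weight k0 k0 j0 (vE _)).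
  rewrite (negPf ik) eqxx (_ : (s.+1%:Z == s%:Z) = false); last by lia.
  rewrite (_ : (s.+1%:Z == s.+2%:Z) = false); last by lia.
  rewrite !cE// !subr0 addr0 => -[k /eqP].
  by rewrite natr1 subr_eq -natrD eqr_nat => /eqP ->; lia.
- exact: leq_addl.
(* The same device for the long root: the reflection raises the coefficient at 2 by one and keeps
   the level. The reflected vector is killed by [Elong], since the bracket of [Elong] with
   [E_ R 2 1] has degree 4 - 1 > 0. *)
move=> cs; have u0 := @reflected_neq0 c 1 cE isT cs.
have Eu : rho (Elong R) (rho (E_ R 2 1) v) = 0.
  rewrite (rho_swap _ (degree_parity (degree_Elong R)) (degree_parity (degree_E R 2 1))).
  rewrite Ev linear0r scaler0 addr0.
  exact: vsing (degree_bracket (degree_Elong R) (degree_E R 2 1)).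
have := long_sl2 u0 Eu (Zc_weight vZ (degree_E R 2 1)) (E_weight _ _ _ (vE 2)).
move=> /(_ isT isT isT); rewrite mD cE// eqxx subr0 => -[k /eqP].
rewrite natr1 subr_eq -natrD eqr_nat => /eqP E.
have {}E : (m + c 2 = k + (c 2).+1)%N by exact: E.
by lia.
Qed.

End Necessity.

(** * Admissible weights and partitions *)

Lemma big_nat_zero_tail (V : nmodType) (m n : nat) (G : nat -> V) :
  (m <= n)%N -> (forall s, (0 < s)%N -> (m <= s)%N -> G s = 0) ->
  \sum_(1 <= s < n) G s = \sum_(1 <= s < m) G s.
Proof.
case: m => [|m] mn G0.
  rewrite [RHS]big_geq// big_nat big1// => s /andP[s0 _]; exact: G0.
rewrite (@big_cat_nat _ _ _ m.+1) //= [X in _ + X]big_nat [X in _ + X]big1 ?addr0//.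
by move=> s /andP[ms _]; apply: G0 => //; exact: leq_trans ms.
Qed.

Section AdmissibleWeight.
Variables (R : realType) (M : lmodType R[i]) (rho : {bilinear hatC R -> M -> M}).
Variables (xi : {scalar hatC0 R}).

Theorem unitarizable_admissible :
  is_module rho -> quasi_finite_highest_weight rho xi -> unitarizable rho ->
  exists (d r : nat) (c : nat -> int),
    admissible d r c /\ forall h, xi h = weight d r c h.
Proof.
move=> Mmod [v [[v0 vwt vsing _] vfin]] [f fstar].
have [D [n0 [c [[c0 xiE] c3 cD cD']]]] := weight_facts Mmod fstar v0 vwt vsing (vfin _).
have cm s : (0 < s)%N -> (c s.+2 <= c s)%N.
  by move=> s0; have := c3 s s0; have [|] := posnP (c s.+1 + c s.+2); lia.
have ex : exists a, c a.*2.+1 == 0%N by exists n0; rewrite c0//; lia.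
case: (ex_minnP ex) => r0 /eqP cr0 r0min.
have cpos a : (a < r0)%N -> (0 < c a.*2.+1)%N.
  by move=> ar; rewrite lt0n; apply/negP => /r0min; lia.
have cz a : (r0 <= a)%N -> c a.*2.+1 = 0%N.
  elim: a => [|a IH]; first by rewrite leqn0 => /eqP E; rewrite -[0%N in LHS]E.
  rewrite leq_eqVlt => /orP[/eqP <-//|/ltnSE/IH E].
  by have := cm a.*2.+1 isT; rewrite E doubleS; lia.
(* A positive coefficient here would force a strict descent from the vanishing coefficient just
   before it. *)
have cz' a : (r0 <= a)%N -> c a.*2.+2 = 0%N.
  by move=> /cz E; have := c3 a.*2.+1 isT; rewrite E; lia.
(* The number r0 counts the positive half-integer coefficients; when there are none, the convention
   r = 1 for the zero weight applies. *)
pose r := maxn 1 r0; exists D, r, (fun s => (c s)%:Z); split; last first.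
  move=> h; rewrite xiE /weight; congr (_ + _).
  have H2 s : (0 < s)%N -> (r.*2.+1 <= s)%N -> c s = 0%N.
    move=> s0 sr; have [os|os] := boolP (odd s).
      have -> : s = s./2.*2.+1 by lia.
      by apply: cz; lia.
    have -> : s = s./2.-1.*2.+2 by lia.
    by apply: cz'; lia.
  pose n := (n0 + r.*2).+1.
  rewrite -(@big_nat_zero_tail _ n0 n); [|by rewrite /n; lia|]; last first.
    by move=> s s0 sn; rewrite c0// mul0r.
  rewrite -[RHS](@big_nat_zero_tail _ _ n) //; first by rewrite /n; lia.
  by move=> s s0 sn; rewrite H2// mul0r.
have c2 : (c 1 = 0 -> c 2 = 0)%N.
  move=> c10; have H : (0 < c 2 + c 3 -> c 3 < c 1)%N by exact: c3 1 isT.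
  by rewrite c10 in H; lia.
split.
- by rewrite /r; lia.
- split=> // m /andP[m0 mr]; have := cpos m; have := c3 m.*2.-1.
  have -> : m.*2.-1.+2 = m.*2.+1 by lia.
  have -> : m.*2.-1.+1 = m.*2 by lia.
  by rewrite /r in mr; lia.
- split=> // m /andP[m0 mr]; have := cpos m; have := c3 m.*2.
  rewrite -doubleS -/(m.*2.+1) doubleS.
  by rewrite /r in mr; lia.
- split=> [|[_ c10 _]]; last first.
    have [r00|r00] := posnP r0; first by rewrite /r r00.
    by have := cpos 0%N r00; move: c10 => /= [->].
  have [r00|r00] := posnP r0.
    rewrite /r r00 /= => -[c10]; split=> //; first by rewrite c10.
    by rewrite c2.
  have := cpos r0.-1; rewrite /r; have -> : (maxn 1 r0).*2.-1 = r0.-1.*2.+1 by lia.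
  by lia.
move: cD cD' c2; case: (c 1) => [|c1]; first by move=> cD _ ->//; lia.
by move=> cD cD' _; have := cD' isT; lia.
Qed.

End AdmissibleWeight.

(** * The diagram with prescribed arms and legs *)

Section AdmissiblePartition.
Variables (d r : nat) (c : nat -> int).
Hypothesis adm : admissible d r c.
Hypothesis cr0 : c r.*2.-1 != 0.

Let arm i : nat := `|c i.*2.+1|%N.
Let legl j : nat := (`|c j.*2| + j)%N.

(** Rows that meet the diagonal are read off the arms. A row i below the Durfee square has one cell
    in each of the first r columns that is longer than i. *)
Definition hook_part (i : nat) : nat :=
  if (i < r)%N then (arm i + i)%N else count (fun j => i < legl j)%N (iota 1 r).

Lemma hook_seq_size : size (map hook_part (iota 0 d)) == d.
Proof. by rewrite size_map size_iota. Qed.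
Definition hook_tuple : d.-tuple nat := Tuple hook_seq_size.

Let odd_dec m : (0 < m < r)%N -> c m.*2.+1 < c m.*2.-1.
Proof. by case: adm => _ [H _] _ _ _; exact: H. Qed.
Let even_dec m : (0 < m < r)%N -> c m.+1.*2 < c m.*2.
Proof. by case: adm => _ _ [H _] _ _; exact: H. Qed.

(** A strictly decreasing integer sequence gains at least one per step when read from its end. The
    arms contain the diagonal cell and end at a positive value; the legs, treated next, do not
    contain it and may end at 0. *)
Let arm_lower k : (k < r)%N -> k.+1%:Z <= c (r - k).*2.-1.
Proof.
case: adm => r0 [_ cr] _ _ _; elim: k => [_|k IH kr]; first by rewrite subn0; lia.
have := IH (ltnW kr); have := @odd_dec (r - k.+1)%N.
have -> : (r - k.+1).*2.+1 = (r - k).*2.-1 by lia.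
by lia.
Qed.

Let leg_lower k : (k < r)%N -> k%:Z <= c (r - k).*2.
Proof.
case: adm => r0 _ [_ cr] _ _; elim: k => [_|k IH kr]; first by rewrite subn0.
have := IH (ltnW kr); have := @even_dec (r - k.+1)%N.
have -> : (r - k.+1).+1 = (r - k)%N by lia.
by lia.
Qed.

Let arm_ge i : (i < r)%N -> (r <= arm i + i)%N /\ c i.*2.+1 = arm i.
Proof.
move=> ir; have H : (r - i.+1 < r)%N by lia.
have := arm_lower H; have -> : (r - (r - i.+1)).*2.-1 = i.*2.+1 by lia.
by rewrite /arm; lia.
Qed.

Let leg_ge j : (0 < j <= r)%N -> (r <= legl j)%N /\ c j.*2 = `|c j.*2|%N.
Proof.
move=> jr; have H : (r - j < r)%N by lia.
have := leg_lower H; have -> : (r - (r - j))%N = j by lia.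
by rewrite /legl; lia.
Qed.

Let leg_mono j j' : (0 < j)%N -> (j <= j')%N -> (j' <= r)%N -> (legl j' <= legl j)%N.
Proof.
move=> j0; elim: j' => [|j' IH]; first by lia.
rewrite leq_eqVlt => /orP[/eqP -> //|/ltnSE jj'] jr.
apply: leq_trans (IH jj' (ltnW jr)).
have := @even_dec j'; have [] := @leg_ge j'; first lia.
have [] := @leg_ge j'.+1; first lia.
by rewrite /legl; lia.
Qed.

(** Condition (ii) enters here: [c 1] is positive, so it reads 1 + c 2 <= d, and the left side is
    the length of the first, longest column. *)
Let leg_d j : (0 < j <= r)%N -> (legl j <= d)%N.
Proof.
move=> /andP[j0 jr]; apply: leq_trans (leg_mono (ltn0Sn 0) j0 jr) _.
have r0 : (0 < r)%N by exact: leq_trans j0 jr.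
have [_ c2] := @leg_ge 1 r0; have [r1 c1] := @arm_ge 0 r0.
rewrite addn0 in r1; rewrite /= in c1 c2.
by case: adm => _ _ _ _; rewrite /legl /= c1 c2; lia.
Qed.

Let hook_nth i : (i < d)%N -> nth 0%N hook_tuple i = hook_part i.
Proof. by move=> id; rewrite (nth_map 0%N) ?size_iota// nth_iota. Qed.

Let hook_big i : (i < r)%N -> hook_part i = (arm i + i)%N.
Proof. by rewrite /hook_part => ->. Qed.

(** Column lengths are non-increasing, so the columns longer than i form an initial segment, and
    their number is at least j exactly when column j is one of them. *)
Let hook_small i : (r <= i)%N -> forall j, (0 < j <= r)%N ->
  (j <= hook_part i)%N = (i < legl j)%N.
Proof.
move=> ri j /andP[j0 jr]; rewrite /hook_part ltnNge ri /=.
suff H m : (m <= r)%N -> (j <= count (fun k => i < legl k) (iota 1 m))%N =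
    (j <= m)%N && (i < legl j)%N by rewrite H// jr.
elim: m => [_|m IH mr]; first by rewrite /= leqn0 (gtn_eqF j0).
have -> : iota 1 m.+1 = iota 1 m ++ [:: m.+1] by rewrite -{1}[m.+1]addn1 iotaD add1n.
rewrite count_cat /= addn0.
have [im|im] := ltnP i (legl m.+1); last first.
  rewrite addn0 IH; last by lia.
  have [jm|jm] := leqP j m; first by rewrite (leqW jm).
  have [->|jm'] := eqVneq j m.+1; first by rewrite [(i < _)%N]ltnNge im /= andbF.
  by rewrite [(j <= m.+1)%N]leqNgt (_ : m.+1 < j)%N//; lia.
have -> : count (fun k => i < legl k)%N (iota 1 m) = m.
  rewrite -[RHS](size_iota 1 m); apply/eqP; rewrite -all_count; apply/allP => k.
  by rewrite mem_iota => kr; apply: leq_trans im (leg_mono _ _ mr); lia.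
rewrite addn1; have [jm|//] := leqP j m.+1; rewrite /= (leq_trans im)//.
by apply: leg_mono.
Qed.

Let hook_le_r i : (r <= i)%N -> (hook_part i <= r)%N.
Proof.
move=> ri; rewrite /hook_part ltnNge ri /=.
by apply: leq_trans (count_size _ _) _; rewrite size_iota.
Qed.

Let hook_step i : (hook_part i.+1 <= hook_part i)%N.
Proof.
have [ir|ir] := ltnP i r; last first.
  rewrite /hook_part ![(_ < r)%N]ltnNge ir (leqW ir) /=.
  by apply: sub_count => j; exact: ltnW.
have [a1 a2] := arm_ge ir.
have [ir'|ir'] := ltnP i.+1 r; last first.
  by rewrite (hook_big ir); apply: leq_trans a1; exact: hook_le_r.
rewrite !hook_big//; have [_ b2] := arm_ge ir'.
have := @odd_dec i.+1; rewrite ir' /= => /(_ isT).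
by rewrite doubleS /= -doubleS b2 a2; lia.
Qed.

Lemma hook_is_partition : is_partition hook_tuple.
Proof.
apply/(sortedP 0%N) => i; rewrite size_tuple => id.
by rewrite !hook_nth//; [exact: hook_step|exact: ltnW].
Qed.

Let r_le_d : (r <= d)%N.
Proof.
have r0 : (0 < r)%N by case: adm.
have rr : (0 < r <= r)%N by rewrite r0 leqnn.
have [H _] := leg_ge rr.
by apply: leq_trans H (leg_d _); lia.
Qed.

Lemma hook_rank : rank hook_tuple = r.
Proof.
suff H a : (a < rank hook_tuple)%N = (a < r)%N.
  by have := H r; have := H (rank hook_tuple); rewrite !ltnn; lia.
rewrite (ltn_rank hook_is_partition).
have [ad|ad] := ltnP a d; last by rewrite nth_default ?size_tuple//; lia.
rewrite hook_nth//; have [ar|ar] := ltnP a r.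
  by rewrite hook_big//; have [] := arm_ge ar; lia.
by apply/negbTE; rewrite -leqNgt; exact: leq_trans (hook_le_r ar) ar.
Qed.

Lemma hook_conj j : (0 < j <= r)%N -> conj_part hook_tuple j = legl j.
Proof.
move=> jr; rewrite /conj_part /= count_map.
have jd := leg_d jr; have [rj _] := leg_ge jr.
rewrite (@eq_count _ _ (fun i => i < legl j)%N) => [|i /=]; last first.
  have [ir|ir] := ltnP i r; last by rewrite hook_small.
  by rewrite hook_big//; have [] := arm_ge ir; lia.
rewrite -[RHS](minn_idPr jd) -sum_ltn -sum1_count -{1}[d]subn0 -/(index_iota 0 d) big_mkord.
by rewrite big_mkcond; apply: eq_bigr => i _; case: ltnP.
Qed.

Lemma hook_Lambda (R : realType) (h : hatC0 R) : Lambda hook_tuple h = weight d r c h.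
Proof.
have r0 : (0 < r)%N by case: adm.
rewrite /Lambda ifF; last first.
  apply/negbTE/allPn; exists (hook_part 0).
    rewrite -hook_nth; last exact: leq_trans r_le_d.
    by apply: mem_nth; rewrite size_tuple; exact: leq_trans r_le_d.
  by have [] := arm_ge r0; rewrite hook_big//=; lia.
rewrite hook_rank /weight; congr (_ + _).
rewrite big_nat [RHS]big_nat; apply: eq_bigr => s /andP[s0 sr]; congr (_%:~R * _).
rewrite /frob; case: ifPn => os.
  have ir : (s./2 < r)%N by lia.
  rewrite hook_nth ?hook_big//; last exact: leq_trans r_le_d.
  have [_] := arm_ge ir; have -> : s./2.*2.+1 = s by lia.
  by move=> ->; lia.
have jr : (0 < s./2 <= r)%N by lia.
rewrite hook_conj//; have [_] := leg_ge jr; rewrite /legl.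
have -> : s./2.*2 = s by lia.
by move=> ->; lia.
Qed.

End AdmissiblePartition.

Theorem admissible_partition (R : realType) (d r : nat) (c : nat -> int) :
  admissible d r c -> exists lam : d.-tuple nat,
    is_partition lam /\ forall h : hatC0 R, Lambda lam h = weight d r c h.
Proof.
(* When the last half-integer coefficient vanishes, condition (i) leaves only the zero weight, which
   comes from the zero partition. *)
move=> adm; have [c0|c0] := eqVneq (c r.*2.-1) 0; last first.
  exists (hook_tuple d r c); split; first exact: hook_is_partition adm c0.
  by move=> h; exact: hook_Lambda.
have [_ _ _ [/(_ c0)[r1 c1 c2] _] _] := adm.
exists (nseq_tuple d 0%N); split.
  apply/(sortedP 0%N) => i; rewrite size_tuple => id.
  by rewrite !nth_nseq !if_same.
move=> h; rewrite /Lambda ifT; last by apply/allP => x; rewrite mem_nseq => /andP[_].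
rewrite /weight r1; congr (_ + _); rewrite big_nat [RHS]big_nat.
apply: eq_bigr => s /andP[s0 s3]; congr (_%:~R * _).
have [->|] := eqVneq s 1%N; first by rewrite c1.
by move=> s1; have -> : s = 2%N by lia.
Qed.

Theorem theorem5p7 (R : realType) (M : lmodType R[i])
    (rho : {bilinear hatC R -> M -> M}) (xi : {scalar hatC0 R})
    (Mmod : is_module rho) (Mirr : irreducible rho)
    (Mhw : quasi_finite_highest_weight rho xi) :
  (unitarizable rho <->
     exists (d : nat) (lam : d.-tuple nat),
       is_partition lam /\ forall h, xi h = Lambda lam h) /\
  (unitarizable rho <->
     exists (d r : nat) (c : nat -> int),
       admissible d r c /\ forall h, xi h = weight d r c h).
Proof.
have UA := unitarizable_admissible Mmod Mhw.
have AP : (exists (d r : nat) (c : nat -> int),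
    admissible d r c /\ forall h, xi h = weight d r c h) ->
    exists (d : nat) (lam : d.-tuple nat),
      is_partition lam /\ forall h, xi h = Lambda lam h.
  move=> [d [r [c [adm E]]]]; have [lam [plam lamE]] := admissible_partition R adm.
  by exists d, lam; split=> // h; rewrite E lamE.
have PU : (exists (d : nat) (lam : d.-tuple nat),
    is_partition lam /\ forall h, xi h = Lambda lam h) -> unitarizable rho.
  by move=> [d [lam [plam E]]]; exact: partition_unitarizable Mmod Mirr Mhw plam E.
by split; split; auto.
Qed.
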